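(* Let $E=(E^0,E^1,r,s)$ be a directed graph with no tails, and let $G^0\subset E^0$ be such that $E^0_{sing}\subseteq G^0$ and the subgraph $T$ of $E$ defined by $T^0:=E^0\setminus G^0$ and $T^1:=\{e\in E^1: s(e),r(e)\in T^0\}$ is acyclic. Suppose that (a) each vertex in $G^0$ is the source of at most one infinite path $\rho\in E^\infty$ such that $r(\rho_i)\in T^0$ for all $i\geq 1$; and that for each $\mu\in T^\infty$, (b) $G^0\geq s(\mu)$; (c) $|r^{-1}(s(\mu_i))|=1$ for all $i$; and (d) if $e\in E^1$ and $r(e)=s(\mu)$, then $|s^{-1}(s(e))|<\infty$. Let $G$ be the directed graph with vertex set $G^0$ and with one edge $e_\beta$ for each path $\beta\in E^*\setminus E^0$ with $s(\beta),r(\beta)\in G^0$ and $r(\beta_i)\in T^0$ for $1\leq i<|\beta|$, where $s(e_\beta)=s(\beta)$ and $r(e_\beta)=r(\beta)$. Then $C^*(G)$ is isomorphic to a full corner of $C^*(E)$.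
   Context: A directed graph $E=(E^0,E^1,r,s)$ consists of countable sets $E^0$ (vertices) and $E^1$ (edges) and maps $r,s:E^1\to E^0$ (range and source). A sink is a vertex emitting no edges (i.e. $s^{-1}(v)=\emptyset$); an infinite emitter is a vertex emitting infinitely many edges; sinks and infinite emitters are called singularities, and $E^0_{sing}$ is the set of all singularities. A finite path of length $n\ge 1$ is $\alpha=\alpha_1\cdots\alpha_n$ with $\alpha_i\in E^1$, $r(\alpha_i)=s(\alpha_{i+1})$; $s(\alpha)=s(\alpha_1)$, $r(\alpha)=r(\alpha_n)$, $|\alpha|=n$. A vertex is a path of length zero with itself as source and range. $E^*$ is the set of finite paths (including vertices). $E^\infty$ is the set of infinite paths $\mu=\mu_1\mu_2\cdots$ with $r(\mu_i)=s(\mu_{i+1})$, and $s(\mu)=s(\mu_1)$. $T^*$, $T^\infty$ are defined in the same way for the graph $T$. Throughout, $r^{-1}$ and $s^{-1}$ refer to the range and source maps of $E$. A finite path $\alpha$ of positive length is a cycle if $s(\alpha)=r(\alpha)$ and $s(\alpha_i)\neq s(\alpha_j)$ for $i\neq j$. A graph or an infinite path is acyclic if it contains no cycle. An acyclic infinite path $\mu$ is a tail if each $s(\mu_i)$ emits only the edge $\mu_i$ and each $r(\mu_i)$ receives only the edge $\mu_i$. For $u,v\in E^0$, $u\geq v$ means there is a path in $E^*$ from $u$ to $v$; for $U\subseteq E^0$, $U\geq v$ means $u\geq v$ for some $u\in U$. A Cuntz-Krieger $E$-family consists of mutually orthogonal projections $\{P_v:v\in E^0\}$ and partial isometries $\{S_e:e\in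 E^1\}$ with mutually orthogonal ranges satisfying $S_e^*S_e=P_{r(e)}$; $S_eS_e^*\leq P_{s(e)}$; and $P_v=\sum_{s(e)=v}S_eS_e^*$ whenever $v$ is not a singularity. The graph $C^*$-algebra $C^*(E)$ is the universal $C^*$-algebra generated by a Cuntz-Krieger $E$-family. A full corner of a $C^*$-algebra $A$ is a subalgebra $PAP$ with $P$ a projection in the multiplier algebra $\mathcal{M}(A)$ such that $PAP$ is not contained in any proper closed two-sided ideal of $A$. *)

(* Defs.v *)
From HB Require Import structures.
From mathcomp Require Import all_boot all_order all_algebra.
From mathcomp Require Import all_classical all_reals all_analysis.

Set Implicit Arguments.
Unset Strict Implicit.
Unset Printing Implicit Defensive.

Import Order.TTheory GRing.Theory Num.Theory.
Import numFieldNormedType.Exports.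

Local Open Scope classical_set_scope.
Local Open Scope ring_scope.

(* Countability of the vertex and edge sets is carried by [countType]. *)
Record digraph := Digraph {
  vert : countType;
  edge : countType;
  src : edge -> vert;
  rng : edge -> vert
}.

Section Graphs.
Variable E : digraph.
Implicit Types (v w : vert E) (e : edge E).

Definition sink v := @src E @^-1` [set v] = set0.
Definition infinite_emitter v := infinite_set (@src E @^-1` [set v]).
Definition singularity v := sink v \/ infinite_emitter v.

Fixpoint is_path v (p : seq (edge E)) : bool :=
  if p is e :: p' then (src e == v) && is_path (rng e) p' else true.

(* A finite path is its source together with its list of edges, so that the
   paths of length zero are the vertices. *)
Definition fpath := {a : vert E * seq (edge E) | is_path a.1 a.2}.

Definition pedges (a : fpath) : seq (edge E) := (val a).2.
Definition psrc (a : fpath) : vert E := (val a).1.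
Definition prng (a : fpath) : vert E := last (psrc a) (map (@rng E) (pedges a)).
Definition plen (a : fpath) : nat := size (pedges a).

Definition is_cycle (a : fpath) : bool :=
  [&& (0 < plen a)%N, psrc a == prng a & uniq (map (@src E) (pedges a))].

Definition acyclic_graph := forall a : fpath, ~~ is_cycle a.

(* Infinite paths are indexed from 0: [mu i] is the edge usually written
   mu_(i+1), and the source of [mu] is [src (mu 0)]. *)
Definition infinite_path (mu : nat -> edge E) :=
  forall i, rng (mu i) = src (mu i.+1).

Definition acyclic_path (mu : nat -> edge E) :=
  forall (a : fpath) (i : nat),
    pedges a = mkseq (fun k => mu (i + k)%N) (plen a) -> ~~ is_cycle a.

Definition is_tail (mu : nat -> edge E) :=
  [/\ infinite_path mu,
      acyclic_path mu,
      forall i, @src E @^-1` [set src (mu i)] = [set mu i] &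
      forall i, @rng E @^-1` [set rng (mu i)] = [set mu i]].

Definition reaches v w := exists2 a : fpath, psrc a = v & prng a = w.

Definition set_reaches (U : {pred vert E}) w := exists2 u, u \in U & reaches u w.

End Graphs.

Section Contraction.
Variables (E : digraph) (G0 : {pred vert E}).

Definition comp_vert : countType := {v : vert E | v \notin G0}.
Definition comp_edge : countType :=
  {e : edge E | (src e \notin G0) && (rng e \notin G0)}.

Definition comp_src (e : comp_edge) : comp_vert :=
  Sub (src (val e)) (proj1 (andP (valP e))).
Definition comp_rng (e : comp_edge) : comp_vert :=
  Sub (rng (val e)) (proj2 (andP (valP e))).

Definition comp_graph : digraph := Digraph comp_src comp_rng.

Definition contr_vert : countType := {v : vert E | v \in G0}.

(* [take (plen b).-1] drops the last edge, whose range lies in G0. *)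
Definition is_contr_edge (b : fpath E) : bool :=
  [&& (0 < plen b)%N, psrc b \in G0, prng b \in G0 &
      all (fun e => rng e \notin G0) (take (plen b).-1 (pedges b))].

Definition contr_edge : countType := {b : fpath E | is_contr_edge b}.

Fact contr_srcP (b : contr_edge) : psrc (val b) \in G0.
Proof. by case/and4P: (valP b). Qed.

Fact contr_rngP (b : contr_edge) : prng (val b) \in G0.
Proof. by case/and4P: (valP b). Qed.

Definition contr_src (b : contr_edge) : contr_vert :=
  Sub (psrc (val b)) (contr_srcP b).
Definition contr_rng (b : contr_edge) : contr_vert :=
  Sub (prng (val b)) (contr_rngP b).

Definition contr_graph : digraph := Digraph contr_src contr_rng.

End Contraction.

(* C*-algebras over the complex numbers are the case K = R[i] with R a realType.
   MathComp rings are unital and C*-algebras need not be, so the product is a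
   new operation on a Banach space. *)
HB.mixin Record CompleteNormedModule_isCStar (K : numClosedFieldType) A
    of CompleteNormedModule K A := {
  cmul : A -> A -> A;
  adj : A -> A;
  cmulA : forall a b c, cmul a (cmul b c) = cmul (cmul a b) c;
  cmulDl : forall a b c, cmul (a + b) c = cmul a c + cmul b c;
  cmulDr : forall a b c, cmul a (b + c) = cmul a b + cmul a c;
  cmulZl : forall (k : K) a b, cmul (k *: a) b = k *: cmul a b;
  cmulZr : forall (k : K) a b, cmul a (k *: b) = k *: cmul a b;
  cadjD : forall a b, adj (a + b) = adj a + adj b;
  cadjZ : forall (k : K) a, adj (k *: a) = k^* *: adj a;
  cadjM : forall a b, adj (cmul a b) = cmul (adj b) (adj a);
  cadjK : forall a, adj (adj a) = a;
  cnormM : forall a b, `|cmul a b| <= `|a| * `|b|;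
  cnorm_adj_mul : forall a, `|cmul (adj a) a| = `|a| ^+ 2
}.

#[short(type="cstarType")]
HB.structure Definition CStar (K : numClosedFieldType) :=
  {A of CompleteNormedModule K A & CompleteNormedModule_isCStar K A}.

Notation "a *c b" := (cmul a b) (at level 40, left associativity) : ring_scope.

Section CStarNotions.
Variable K : numClosedFieldType.

Definition star_morphism (A B : cstarType K) (f : {linear A -> B}) :=
  (forall a b, f (a *c b) = f a *c f b) /\ (forall a, f (adj a) = adj (f a)).

Variable A : cstarType K.
Implicit Types (p q s : A) (D J : set A).

Definition is_proj p := adj p = p /\ p *c p = p.
Definition is_pisometry s := s *c adj s *c s = s.
Definition proj_orth p q := p *c q = 0.

(* The order is only used between projections, where p <= q means that p is a
   subprojection of q. *)
Definition proj_le p q := p *c q = p.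

Definition lin_subspace D :=
  D 0 /\ forall (k : K) a b, D a -> D b -> D (k *: a + b).

Definition star_subalgebra D :=
  [/\ lin_subspace D,
      forall a b, D a -> D b -> D (a *c b) &
      forall a, D a -> D (adj a)].

Definition closed_ideal J :=
  [/\ closed J,
      lin_subspace J,
      forall a b, J b -> J (a *c b) &
      forall a b, J a -> J (a *c b)].

(* Multipliers are double centralizers (L, R): an element m of the multiplier
   algebra is identified with the pair (a |-> m a, a |-> a m). *)
Definition is_multiplier (m : (A -> A) * (A -> A)) :=
  [/\ linear m.1 /\ linear m.2,
      continuous m.1 /\ continuous m.2,
      forall a b, m.1 (a *c b) = m.1 a *c b,
      forall a b, m.2 (a *c b) = a *c m.2 b &
      forall a b, m.2 a *c b = a *c m.1 b].

Definition mult_mul (m n : (A -> A) * (A -> A)) : (A -> A) * (A -> A) :=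
  (m.1 \o n.1, n.2 \o m.2).

Definition mult_adj (m : (A -> A) * (A -> A)) : (A -> A) * (A -> A) :=
  (fun a => adj (m.2 (adj a)), fun a => adj (m.1 (adj a))).

Definition mult_proj (m : (A -> A) * (A -> A)) :=
  [/\ is_multiplier m, mult_adj m = m & mult_mul m m = m].

(* The corner m A m. *)
Definition corner (m : (A -> A) * (A -> A)) : set A :=
  range (fun a => m.2 (m.1 a)).

Definition full_corner (C : set A) :=
  exists2 m, mult_proj m &
    C = corner m /\ forall J, closed_ideal J -> C `<=` J -> J = setT.

End CStarNotions.

Definition iso_to_full_corner (K : numClosedFieldType) (B A : cstarType K) :=
  exists2 C : set A, full_corner C &
    exists f : {linear B -> A}, [/\ star_morphism f, injective f & range f = C].

Record ck_family (K : numClosedFieldType) (E : digraph) (A : cstarType K)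
    (P : vert E -> A) (S : edge E -> A) : Prop := CKFamily {
  ck_proj : forall v, is_proj (P v);
  ck_orth : forall v w, v <> w -> proj_orth (P v) (P w);
  ck_pisometry : forall e, is_pisometry (S e);
  ck_ranges : forall e f, e <> f ->
    proj_orth (S e *c adj (S e)) (S f *c adj (S f));
  ck_source : forall e, adj (S e) *c S e = P (rng e);
  ck_le : forall e, proj_le (S e *c adj (S e)) (P (src e));
  ck_sum : forall v, ~ singularity v ->
    P v = \sum_(e \in @src E @^-1` [set v]) (S e *c adj (S e))
}.

(* C*(E) is determined up to isomorphism: it is generated, as a C*-algebra, by
   a Cuntz-Krieger E-family, and every such family is the image of this one
   under a *-homomorphism (unique, because the family generates). *)
Record graph_algebra (K : numClosedFieldType) (E : digraph) := GraphAlgebra {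
  ga_alg :> cstarType K;
  ga_proj : vert E -> ga_alg;
  ga_iso : edge E -> ga_alg;
  ga_family : ck_family ga_proj ga_iso;
  ga_generated : forall D : set ga_alg, star_subalgebra D -> closed D ->
    (forall v, D (ga_proj v)) -> (forall e, D (ga_iso e)) -> D = setT;
  ga_universal : forall (B : cstarType K) (Q : vert E -> B) (T : edge E -> B),
    ck_family Q T ->
    exists f : {linear ga_alg -> B}, [/\ star_morphism f,
      forall v, f (ga_proj v) = Q v & forall e, f (ga_iso e) = T e]
}.

(* Main.v *)
Require Import Defs.
From HB Require Import structures.
From mathcomp Require Import all_boot all_order all_algebra.
From mathcomp Require Import complex.
From mathcomp Require Import finmap lra.
From mathcomp Require Import all_classical all_reals all_analysis.

(* Sending [e_beta] to the product of the partial isometries along [beta] gives a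
   Cuntz-Krieger family of the contracted graph G in C*(E), hence [phi] from C*(G)
   to C*(E): a vertex of [G0] that starts an infinite path through T has infinitely
   many returns to [G0], since E has no tails, so no summation relation is required
   there.

   Injectivity of [phi] comes from a left inverse instead of a uniqueness theorem.
   For any Cuntz-Krieger G-family in a C*-algebra B one builds a Cuntz-Krieger
   E-family of matrices over B, acting on the Hilbert module l2(B): a vertex v of T
   from which all paths return to [G0] gets one coordinate for each such path, and a
   vertex on an infinite path through T gets a single coordinate carrying the
   projection [q_u] minus the ranges of the returns that leave the unique path from
   [G0] to v. With B = C*(G), the universal property of C*(E) yields [psi] such that
   [psi \o phi] is the embedding of B as the corner of index 0. The operators on
   l2(B) form a C*-algebra because positive elements [c^* c] form a cone on which the
   norm is monotone.

   The coordinates also exist inside C*(E), as elements k with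
   [p_v = sum_k k k^*], and the products [k^* s_e k'] lie in the range of [phi]; this
   identifies the range with the corner given by the sum of [p_v] over [G0]. *)

Set Implicit Arguments.
Unset Strict Implicit.
Unset Printing Implicit Defensive.

Import Order.TTheory GRing.Theory Num.Theory.
Import numFieldNormedType.Exports.

Local Open Scope classical_set_scope.
Local Open Scope ring_scope.
Local Open Scope complex_scope.

(** * Hilbert modules and their adjointable operators *)

(** The case distinction behind the coordinates is well-foundedness. Outside G0 every vertex emits
    finitely many edges, so from a [terminating] vertex only finitely many paths return, and
    iterating the summation relation exhausts P_v. From an [on_ray] vertex some path never returns
    and no such finite sum is available. There (b) and (c) provide a unique path from G0, with
    partial isometry g, and P_v = g^* g makes g^* a coordinate. What must be expressed in C*(G) is g
    g^*: by (d) each vertex that the path leaves is a finite emitter, and by (a) only the edge of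
    the path leads on to a ray, so the other edges contribute finitely many returns to be
    subtracted. On the analytic side neither units nor spectral theory are presupposed. A unit is
    borrowed from the adjointable operators on the algebra itself, square roots come from a norm
    convergent iteration, and positivity of a self-adjoint a is the inequality |t - a| <= t for some
    t > 0. *)

Section CStarAlgebra.
Variables (K : numClosedFieldType) (A : cstarType K).
Implicit Types a b c : A.

Lemma cmul0l a : 0 *c a = 0.
Proof. by have := cmulZl 0 0 a; rewrite !scale0r. Qed.

Lemma cmul0r a : a *c 0 = 0.
Proof. by have := cmulZr 0 a 0; rewrite !scale0r. Qed.

Lemma cmulNl a b : (- a) *c b = - (a *c b).
Proof. by apply: (addrI (a *c b)); rewrite -cmulDl !subrr cmul0l. Qed.

Lemma cmulNr a b : a *c (- b) = - (a *c b).
Proof. by apply: (addrI (a *c b)); rewrite -cmulDr !subrr cmul0r. Qed.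

Lemma cmulBl a b c : (a - b) *c c = a *c c - b *c c.
Proof. by rewrite cmulDl cmulNl. Qed.

Lemma cmulBr a b c : a *c (b - c) = a *c b - a *c c.
Proof. by rewrite cmulDr cmulNr. Qed.

Lemma cmul_suml (I : Type) (r : seq I) (P : pred I) (F : I -> A) a :
  (\sum_(i <- r | P i) F i) *c a = \sum_(i <- r | P i) F i *c a.
Proof. by apply: (big_morph (fun x => x *c a)) => [x y|]; rewrite ?cmulDl ?cmul0l. Qed.

Lemma cmul_sumr (I : Type) (r : seq I) (P : pred I) (F : I -> A) a :
  a *c (\sum_(i <- r | P i) F i) = \sum_(i <- r | P i) a *c F i.
Proof. by apply: (big_morph (fun x => a *c x)) => [x y|]; rewrite ?cmulDr ?cmul0r. Qed.

Lemma cadj0 : adj 0 = 0 :> A.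
Proof. by have := cadjZ 0 (0 : A); rewrite rmorph0 !scale0r. Qed.

Lemma cadjN a : adj (- a) = - adj a.
Proof. by rewrite -(scaleN1r a) -(scaleN1r (adj a)) cadjZ rmorphN1. Qed.

Lemma cadjB a b : adj (a - b) = adj a - adj b.
Proof. by rewrite cadjD cadjN. Qed.

Lemma cadj_sum (I : Type) (r : seq I) (P : pred I) (F : I -> A) :
  adj (\sum_(i <- r | P i) F i) = \sum_(i <- r | P i) adj (F i).
Proof. by apply: big_morph => [x y|]; rewrite ?cadjD ?cadj0. Qed.

Lemma cadj_inj : injective (@adj K A).
Proof. exact: can_inj (@cadjK K A). Qed.

Lemma cnorm_adj a : `|adj a| = `|a|.
Proof.
suff h b : `|b| <= `|adj b|.
  by apply/eqP; rewrite eq_le h andbT -[in X in _ <= X](cadjK a) h.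
have [->|b0] := eqVneq b 0; first by rewrite normr0.
rewrite -(ler_pM2r (x := `|b|)) ?normr_gt0//.
by rewrite -expr2 -cnorm_adj_mul cnormM.
Qed.

Lemma cnorm_mul_adj a : `|a *c adj a| = `|a| ^+ 2.
Proof. by rewrite -[X in X *c _]cadjK cnorm_adj_mul cnorm_adj. Qed.

Lemma cnorm_sa a : adj a = a -> `|a *c a| = `|a| ^+ 2.
Proof. by move=> h; rewrite -[X in X *c _]h cnorm_adj_mul. Qed.

Lemma cmul_adj_eq0 a : adj a *c a = 0 -> a = 0.
Proof.
move=> h; have := cnorm_adj_mul a; rewrite h normr0 => /esym/eqP.
by rewrite expf_eq0 normr_eq0 => /andP[_ /eqP].
Qed.

End CStarAlgebra.

(** * Estimates with norms in a partially ordered field *)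

Section NumFieldEps.
Variables (K : numFieldType) (V : normedModType K).

(* [K] is only partially ordered, hence the detour through a field inverse
   instead of the library lemma for real domains. *)
Lemma norm_eps_eq0 (v : V) (M : K) : 0 <= M ->
  (forall e, 0 < e -> `|v| <= e * M) -> v = 0.
Proof.
move=> M0 h; apply/eqP; rewrite -normr_le0; apply/negPn/negP => v0.
have {}v0 : 0 < `|v| by rewrite lt_neqAle normr_ge0 andbT eq_sym normr_eq0;
  apply: contraNneq v0 => ->; rewrite normr0.
have M1 : 0 < M + 1 by rewrite ltr_wpDl.
have e0 : 0 < `|v| / (M + 1) by rewrite divr_gt0.
have := h _ e0; rewrite mulrAC ler_pdivlMr// ler_pM2l// => h1.
have : M + 1 <= M + 0 by rewrite addr0.
by rewrite lerD2l ler10.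
Qed.

Lemma closed_epsP (D : set V) :
  closed D <-> (forall x, (forall e, 0 < e -> exists2 a, D a & `|x - a| <= e) -> D x).
Proof.
split=> [cD x h|h].
  apply: cD => B /nbhs_ballP[e /= e0 eB].
  have e2 : 0 < e / 2 by rewrite divr_gt0.
  have [a Da xa] := h _ e2; exists a; split=> //; apply: eB.
  rewrite -ball_normE /=; apply: (le_lt_trans xa).
  by rewrite ltr_pdivrMr// mulr_natr mulr2n ltrDl.
move=> x clx; apply: h => e e0.
have [a [Da ba]] := clx _ (nbhsx_ballx x e e0).
by exists a => //; move: ba; rewrite -ball_normE /= => /ltW.
Qed.

End NumFieldEps.

Section RealNorm.
Variable R : realType.
Local Notation K := R[i].
Implicit Type V : normedModType K.

(** Norms take values in the partially ordered field R[i]; suprema, as in [opnorm], have to be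
    formed in R. *)
Definition rnorm V (x : V) : R := complex.Re `|x|.

Lemma rnormE V (x : V) : `|x| = (rnorm x)%:C.
Proof.
have := normr_ge0 x; rewrite lecE /rnorm => /andP[/eqP h _].
by apply/eqP; rewrite eq_complex /= eqxx h /=.
Qed.

Lemma rnorm_ge0 V (x : V) : 0 <= rnorm x.
Proof. by move: (normr_ge0 x); rewrite rnormE lecE => /andP[]. Qed.

Lemma pos_complexE (e : K) : 0 <= e -> e = (complex.Re e)%:C.
Proof.
rewrite lecE => /andP[/eqP h _].
by apply/eqP; rewrite eq_complex /= eqxx h /=.
Qed.

End RealNorm.

(** Instead of positivity of the inner product, its two consequences [hip_le] (Cauchy-Schwarz) and
    [hip_norm] are recorded, so that operators can be treated before any order on A is available. *)
Record hilbert_module (K : numClosedFieldType) (A : cstarType K) := HilbertModule {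
  hm_sort :> completeNormedModType K;
  hip : hm_sort -> hm_sort -> A;
  hip_linear : forall k x y z, hip x (k *: y + z) = k *: hip x y + hip x z;
  hip_adj : forall x y, adj (hip x y) = hip y x;
  hip_le : forall x y, `|hip x y| <= `|x| * `|y|;
  hip_norm : forall x, `|hip x x| = `|x| ^+ 2
}.

Lemma ler_eps_complex (R : realType) (a b : R[i]) : 0 <= a -> 0 <= b ->
  (forall e, 0 < e -> a <= b + e) -> a <= b.
Proof.
move=> /pos_complexE -> /pos_complexE -> h; rewrite lecR.
apply/ler_addgt0Pr => e e0; rewrite -lecR rmorphD; apply: h.
by rewrite ltcE /= eqxx.
Qed.

Section HilbertModule.
Variables (R : realType).
Local Notation K := R[i].
Variables (A : cstarType K) (X : hilbert_module A).
Local Notation ip := (@hip K A X).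
Implicit Types (x y z : X) (S T : X -> X).

Lemma hipDr x y z : ip x (y + z) = ip x y + ip x z.
Proof. by have := hip_linear 1 x y z; rewrite !scale1r. Qed.

Lemma hip0r x : ip x 0 = 0.
Proof. by apply: (addrI (ip x 0)); rewrite -hipDr !addr0. Qed.

Lemma hipZr k x y : ip x (k *: y) = k *: ip x y.
Proof. by have := hip_linear k x y 0; rewrite hip0r !addr0. Qed.

Lemma hipNr x y : ip x (- y) = - ip x y.
Proof. by apply: (addrI (ip x y)); rewrite -hipDr !subrr hip0r. Qed.

Lemma hipBr x y z : ip x (y - z) = ip x y - ip x z.
Proof. by rewrite hipDr hipNr. Qed.

Lemma hipDl x y z : ip (x + y) z = ip x z + ip y z.
Proof. by rewrite -hip_adj hipDr cadjD !hip_adj. Qed.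

Lemma hipZl k x y : ip (k *: x) y = (k^*)%R *: ip x y.
Proof. by rewrite -hip_adj hipZr cadjZ hip_adj. Qed.

Lemma hipBl x y z : ip (x - y) z = ip x z - ip y z.
Proof. by rewrite -hip_adj hipBr cadjB !hip_adj. Qed.

Lemma hip_eq x y : (forall z, ip z x = ip z y) -> x = y.
Proof.
move=> h; have := hip_norm (x - y); rewrite hipBr h subrr normr0 => /esym/eqP.
by rewrite expf_eq0 normr_eq0 subr_eq0 => /andP[_ /eqP].
Qed.

Definition adjoint_of T T' := forall x y, ip (T x) y = ip x (T' y).
Definition bounded_map T := exists M : K, forall x, `|T x| <= M * `|x|.

Lemma adjoint_sym T T' : adjoint_of T T' -> adjoint_of T' T.
Proof. by move=> h x y; rewrite -hip_adj -h hip_adj. Qed.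

Lemma adjoint_linear T T' : adjoint_of T T' ->
  forall k x y, T (k *: x + y) = k *: T x + T y.
Proof.
move=> /adjoint_sym h k x y; apply: hip_eq => z.
by rewrite hip_linear -!h hip_linear.
Qed.

(* [M] is replaced by [|M|] since a bound need not be real when [X] is trivial. *)
Lemma adjoint_bound T T' (M : K) : adjoint_of T T' ->
  (forall x, `|T x| <= M * `|x|) -> forall x, `|T' x| <= `|M| * `|x|.
Proof.
move=> h hM x.
have [->|t0] := eqVneq (T' x) 0; first by rewrite normr0 mulr_ge0.
rewrite -(ler_pM2r (x := `|T' x|)) ?normr_gt0// -expr2 -hip_norm -h.
apply: le_trans (hip_le _ _) _; rewrite mulrAC ler_wpM2r//.
apply: le_trans (hM _) _.
have := hM (T' x) => /(le_trans (normr_ge0 _)) Mge.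
by rewrite -(ger0_norm Mge) normrM normr_id.
Qed.

(** Linearity is not recorded because it follows from the existence of an adjoint
    ([adjoint_linear]). *)
Definition adjointable_pred : pred (X -> X) :=
  fun T => `[< bounded_map T /\ exists T', adjoint_of T T' >].

Lemma adjointableP T :
  reflect (bounded_map T /\ exists T', adjoint_of T T') (T \in adjointable_pred).
Proof. exact: asboolP. Qed.

Lemma bounded_pos T : bounded_map T -> exists2 M : K, 0 <= M &
  forall x, `|T x| <= M * `|x|.
Proof.
move=> [M hM]; exists `|M| => // x.
have := hM x => /(le_trans (normr_ge0 _)) Mge.
by rewrite -(normr_id x) -normrM (ger0_norm Mge).
Qed.

Fact adjointable_closed : submod_closed adjointable_pred.
Proof.
split=> [|k S T].
  apply/adjointableP; split; first by exists 0 => x; rewrite mul0r normr0.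
  by exists 0 => x y; rewrite hip0r -hip_adj hip0r cadj0.
move=> /adjointableP[/bounded_pos[M M0 hM] [S' hS]].
move=> /adjointableP[/bounded_pos[N N0 hN] [T' hT]].
apply/adjointableP; split.
  exists (`|k| * M + N) => x; rewrite mulrDl; apply: le_trans (ler_normD _ _) _.
  by rewrite lerD// normrZ -mulrA ler_wpM2l.
exists (fun y => (k^*)%R *: S' y + T' y) => x y.
by rewrite hip_linear hipDl hipZl hS hT.
Qed.

HB.instance Definition _ := GRing.isSubmodClosed.Build K (X -> X) adjointable_pred
  adjointable_closed.

Definition adjointable := {T : X -> X | T \in adjointable_pred}.
HB.instance Definition _ := SubType.on adjointable.
HB.instance Definition _ := Choice.on adjointable.
HB.instance Definition _ := [SubChoice_isSubLmodule of adjointable by <:].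

Definition opfun (T : adjointable) : X -> X := val T.
Coercion opfun : adjointable >-> Funclass.
Implicit Types (U V W : adjointable).

Lemma adjointable_eq U V : (forall x, U x = V x) -> U = V.
Proof. by move=> h; apply/val_inj/funext. Qed.

Lemma opD U V x : opfun (U + V) x = U x + V x. Proof. by []. Qed.
Lemma opZ (k : K) U x : opfun (k *: U) x = k *: U x. Proof. by []. Qed.
Lemma opB U V x : opfun (U - V) x = U x - V x. Proof. by []. Qed.

Lemma op_exists_adj U : exists T', adjoint_of U T'.
Proof. by case: (adjointableP _ (valP U)). Qed.

Lemma op_linear U k x y : U (k *: x + y) = k *: U x + U y.
Proof. by have [T' h] := op_exists_adj U; exact: adjoint_linear h k x y. Qed.

Lemma op_at0 U : U 0 = 0.
Proof.
by apply: (addrI (U 0)); rewrite -[X in X + _ = _]scale1r -op_linear scale1r !addr0.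
Qed.

Lemma op_scale U (k : K) x : U (k *: x) = k *: U x.
Proof. by have := op_linear U k x 0; rewrite op_at0 !addr0. Qed.

Lemma op_add U x y : U (x + y) = U x + U y.
Proof. by have := op_linear U 1 x y; rewrite !scale1r. Qed.

Lemma op_bound U : exists2 M : K, 0 <= M & forall x, `|U x| <= M * `|x|.
Proof. by case: (adjointableP _ (valP U)) => /bounded_pos. Qed.

Definition opnorm U : R := sup [set rnorm (U x) | x in [set x : X | `|x| <= 1]].

Let opnorm_has_sup U : has_sup [set rnorm (U x) | x in [set x : X | `|x| <= 1]].
Proof.
split; first by exists (rnorm (U 0)), 0 => //=; rewrite normr0 ler01.
have [M M0 hM] := op_bound U; exists (complex.Re M) => _ [x /= x1 <-].
rewrite -lecR -rnormE -pos_complexE//; apply: le_trans (hM _) _.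
by rewrite ler_piMr.
Qed.

Lemma opnorm_le U x : `|U x| <= (opnorm U)%:C * `|x|.
Proof.
have [->|x0] := eqVneq x 0; first by rewrite op_at0 !normr0 mulr0.
have nx : 0 < `|x| by rewrite normr_gt0.
have ni : 0 <= `|x|^-1 by rewrite invr_ge0 ltW.
rewrite -ler_pdivrMr// mulrC -[X in X * _](ger0_norm ni).
rewrite -normrZ -op_scale rnormE lecR.
apply: sup_upper_bound (opnorm_has_sup U) _ _; exists (`|x|^-1 *: x) => //=.
by rewrite normfZV.
Qed.

Lemma opnorm_lub U (M : K) : 0 <= M -> (forall x, `|U x| <= M * `|x|) ->
  (opnorm U)%:C <= M.
Proof.
move=> M0 hM; rewrite (pos_complexE M0) lecR.
apply: ge_sup; first exact: (opnorm_has_sup U).1.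
move=> _ [x /= x1 <-]; rewrite -lecR -rnormE -pos_complexE//.
by apply: le_trans (hM _) _; rewrite ler_piMr.
Qed.

Lemma opnorm_ge0 U : 0 <= (opnorm U)%:C :> K.
Proof.
have -> : 0 = (0 : R)%:C by [].
rewrite lecR; apply: le_trans (rnorm_ge0 (U 0)) _.
by apply: sup_upper_bound (opnorm_has_sup U) _ _; exists 0 => //=; rewrite normr0 ler01.
Qed.

Fact opnormD U V : (opnorm (U + V))%:C <= (opnorm U)%:C + (opnorm V)%:C :> K.
Proof.
apply: opnorm_lub => [|x]; first by rewrite addr_ge0 ?opnorm_ge0.
rewrite opD mulrDl; apply: le_trans (ler_normD _ _) _.
by rewrite lerD ?opnorm_le.
Qed.

Fact opnormZ (k : K) U : (opnorm (k *: U))%:C = `|k| * (opnorm U)%:C.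
Proof.
apply/eqP; rewrite eq_le; apply/andP; split.
  apply: opnorm_lub => [|x]; first by rewrite mulr_ge0 ?opnorm_ge0.
  by rewrite opZ normrZ -mulrA ler_wpM2l ?opnorm_le.
have [->|k0] := eqVneq k 0; first by rewrite normr0 mul0r opnorm_ge0.
have nk : 0 < `|k| by rewrite normr_gt0.
rewrite mulrC -ler_pdivlMr//; apply: opnorm_lub => [|x].
  by rewrite divr_ge0 ?opnorm_ge0.
rewrite mulrAC ler_pdivlMr// mulrC -normrZ -opZ.
exact: opnorm_le.
Qed.

Fact opnorm_eq0 U : (opnorm U)%:C = 0 :> K -> U = 0.
Proof.
move=> h; apply: adjointable_eq => x; apply/eqP; rewrite -normr_le0.
by apply: le_trans (opnorm_le _ _) _; rewrite h mul0r.
Qed.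

HB.instance Definition _ := @Lmodule_isNormed.Build K adjointable
  (fun U => (opnorm U)%:C) opnormD opnormZ opnorm_eq0.

Lemma op_le U x : `|U x| <= `|U| * `|x|.
Proof. exact: opnorm_le. Qed.

Lemma op_lub U (M : K) : 0 <= M -> (forall x, `|U x| <= M * `|x|) -> `|U| <= M.
Proof. exact: opnorm_lub. Qed.

Fact op_adj_proof U : sval (cid (op_exists_adj U)) \in adjointable_pred.
Proof.
case: (cid _) => T' /= h; apply/adjointableP; split; last first.
  by exists U; exact: adjoint_sym.
have [M M0 hM] := op_bound U.
by exists `|M| => x; exact: adjoint_bound h hM x.
Qed.

Definition op_adj U : adjointable :=
  @exist _ (fun T => T \in adjointable_pred) _ (op_adj_proof U).

Lemma op_adjP U x y : ip (U x) y = ip x (op_adj U y).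
Proof. by rewrite /op_adj /opfun /=; case: (cid _) => T' /= h; exact: h. Qed.

Lemma op_adj_eq U V : (forall x y, ip (U x) y = ip x (V y)) -> op_adj U = V.
Proof.
move=> h; apply: adjointable_eq => y; apply: hip_eq => x.
by rewrite -h op_adjP.
Qed.

Fact op_mul_proof U V : (U : X -> X) \o V \in adjointable_pred.
Proof.
apply/adjointableP; split.
  exists (`|U| * `|V|) => x; rewrite -mulrA; apply: le_trans (op_le _ _) _.
  by rewrite ler_wpM2l ?op_le.
by exists (op_adj V \o op_adj U) => x y; rewrite /= !op_adjP.
Qed.

Definition op_mul U V : adjointable :=
  @exist _ (fun T => T \in adjointable_pred) _ (op_mul_proof U V).

Lemma op_mulE U V x : op_mul U V x = U (V x).
Proof. by []. Qed.

Lemma op_adjB_le U V y : `|op_adj U y - op_adj V y| <= `|U - V| * `|y|.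
Proof.
have h : adjoint_of (opfun (U - V)) (fun y => op_adj U y - op_adj V y).
  by move=> x z; rewrite opB hipBl hipBr !op_adjP.
have := adjoint_bound h (@op_le (U - V)) y.
by rewrite normr_id.
Qed.

(** Pointwise limits exist both for the operators and for their adjoints, and the second limit is
    the adjoint of the first. The error bound in [cvg_pt] is uniform in x, which turns pointwise
    convergence into convergence in norm. *)
Fact op_complete (F : set_system adjointable) : ProperFilter F -> cauchy F -> cvg F.
Proof.
move=> FF /cauchyP cF.
pose e_close (e : K) U0 := forall U, ball U0 e U -> `|U - U0| <= e.
have ballE e U0 : e_close e U0.
  by move=> U; rewrite -ball_normE /= distrC => /ltW.
have cvg_pt (f : adjointable -> X -> X) :
    (forall U V x, `|f U x - f V x| <= `|U - V| * `|x|) ->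
    exists T : X -> X, forall e U0, 0 < e -> F (ball U0 e) ->
      forall x, `|T x - f U0 x| <= e * `|x|.
  move=> hf.
  have cvx x : cvg (f U x @[U --> F]).
    apply/cauchy_cvgP/cauchyP => e e0.
    have e'0 : 0 < e / (`|x| + 1) by rewrite divr_gt0// ltr_wpDl.
    have [U0 hU0] := cF _ e'0; exists (f U0 x).
    suff : F [set U | ball (f U0 x) e (f U x)] by [].
    apply: filterS hU0 => U /ballE hU; rewrite -ball_normE /= distrC.
    apply: (le_lt_trans (hf _ _ _)); apply: le_lt_trans (ler_wpM2r _ hU) _ => //.
    by rewrite mulrAC ltr_pdivrMr ?ltr_wpDl// ltr_pM2l// ltrDl.
  exists (fun x => lim (f U x @[U --> F])) => e U0 e0 hU0 x.
  apply: ler_eps_complex => // [|e' e'0]; first by rewrite mulr_ge0// ltW.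
  have /cvgrPdist_le/(_ e' e'0) h := cvx x.
  have [U [hU1 hU2]] := filter_ex (filterI h hU0).
  rewrite -(subrKA (f U x)) addrC; apply: le_trans (ler_normD _ _) _.
  rewrite lerD//; apply: le_trans (hf _ _ _) _.
  by rewrite ler_wpM2r// ballE.
have [T hT] := cvg_pt (fun U => U) (fun U V x => op_le (U - V) x).
have [T' hT'] := cvg_pt (fun U => op_adj U) op_adjB_le.
have adjT : adjoint_of T T'.
  move=> x y; apply/eqP; rewrite -subr_eq0; apply/eqP.
  apply: (@norm_eps_eq0 _ _ _ (`|x| * `|y| *+ 2)) => [|e e0].
    by rewrite mulrn_wge0// mulr_ge0.
  have [U0 hU0] := cF e e0.
  have -> : ip (T x) y - ip x (T' y) =
      ip (T x - opfun U0 x) y - ip x (T' y - op_adj U0 y).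
    by rewrite hipBl hipBr op_adjP opprB addrA subrK.
  apply: le_trans (ler_normB _ _) _; rewrite mulr2n mulrDr lerD//.
    apply: le_trans (hip_le _ _) _; rewrite mulrA ler_wpM2r//.
    exact: hT.
  apply: le_trans (hip_le _ _) _; rewrite mulrCA ler_wpM2l//.
  exact: hT'.
have Tin : T \in adjointable_pred.
  apply/adjointableP; split; last by exists T'.
  have [U0 hU0] := cF 1 ltr01; exists (1 + `|U0|) => x.
  rewrite -[X in `|X|](subrK (opfun U0 x)); apply: le_trans (ler_normD _ _) _.
  by rewrite mulrDl lerD ?op_le ?hT.
apply/cvg_ex; exists (@exist _ (fun T => T \in adjointable_pred) T Tin); apply/cvgrPdist_le => e e0.
have e20 : 0 < e / 2 by rewrite divr_gt0.
have [U0 hU0] := cF _ e20.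
apply: filterS (hU0) => U /ballE hU.
rewrite -(subrKA (U0 : adjointable)); apply: le_trans (ler_normD _ _) _.
rewrite [leRHS]splitr; apply: lerD; last by rewrite distrC.
apply: (@op_lub (_ - (U0 : adjointable))) => [|x]; first exact: ltW.
rewrite opB; exact: hT.
Qed.

HB.instance Definition _ := Uniform_isComplete.Build adjointable op_complete.

Lemma op_adjK U : op_adj (op_adj U) = U.
Proof. by apply: op_adj_eq => x y; rewrite -hip_adj -op_adjP hip_adj. Qed.

Fact op_cnormM U V : `|op_mul U V| <= `|U| * `|V|.
Proof.
apply: op_lub => [|x]; first by rewrite mulr_ge0.
rewrite op_mulE -mulrA; apply: le_trans (op_le _ _) _.
by rewrite ler_wpM2l ?op_le.
Qed.

Lemma op_adj_norm_le U : `|op_adj U| <= `|U|.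
Proof.
apply: op_lub => // x; have := op_adjB_le U 0 x.
suff -> : op_adj 0 = 0 by rewrite !subr0.
by apply: op_adj_eq => z y; rewrite hip0r -hip_adj hip0r cadj0.
Qed.

Fact op_cstar U : `|op_mul (op_adj U) U| = `|U| ^+ 2.
Proof.
apply/eqP; rewrite eq_le; apply/andP; split.
  apply: le_trans (op_cnormM _ _) _.
  by rewrite expr2 ler_wpM2r// op_adj_norm_le.
(* From |U x|^2 = |<x, U^* U x>| the square root of |U^* U| is a bound for U. *)
rewrite -(@sqrtCK _ `|op_mul (op_adj U) U|) ler_pXn2r ?nnegrE ?sqrtC_ge0//.
apply: op_lub => [|x]; first by rewrite sqrtC_ge0.
rewrite -(@ler_pXn2r _ 2) ?nnegrE ?mulr_ge0 ?sqrtC_ge0// exprMn sqrtCK.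
rewrite -hip_norm op_adjP; apply: le_trans (hip_le _ _) _.
rewrite mulrC expr2 mulrA ler_wpM2r//.
exact: (op_le (op_mul (op_adj U) U)).
Qed.

Fact op_mulA U V W : op_mul U (op_mul V W) = op_mul (op_mul U V) W.
Proof. exact: adjointable_eq. Qed.

Fact op_mulDl U V W : op_mul (U + V) W = op_mul U W + op_mul V W.
Proof. exact: adjointable_eq. Qed.

Fact op_mulDr U V W : op_mul U (V + W) = op_mul U V + op_mul U W.
Proof. by apply: adjointable_eq => x; rewrite opD !op_mulE opD op_add. Qed.

Fact op_mulZl (k : K) U V : op_mul (k *: U) V = k *: op_mul U V.
Proof. exact: adjointable_eq. Qed.

Fact op_mulZr (k : K) U V : op_mul U (k *: V) = k *: op_mul U V.
Proof. by apply: adjointable_eq => x; rewrite opZ !op_mulE opZ op_scale. Qed.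

Fact op_adjD U V : op_adj (U + V) = op_adj U + op_adj V.
Proof. by apply: op_adj_eq => x y; rewrite !opD hipDl hipDr !op_adjP. Qed.

Fact op_adjZ (k : K) U : op_adj (k *: U) = (k^*)%R *: op_adj U.
Proof. by apply: op_adj_eq => x y; rewrite !opZ hipZl hipZr !op_adjP. Qed.

Fact op_adjM U V : op_adj (op_mul U V) = op_mul (op_adj V) (op_adj U).
Proof. by apply: op_adj_eq => x y; rewrite !op_mulE !op_adjP. Qed.

HB.instance Definition _ := @CompleteNormedModule_isCStar.Build K adjointable
  op_mul op_adj op_mulA op_mulDl op_mulDr op_mulZl op_mulZr
  op_adjD op_adjZ op_adjM op_adjK op_cnormM op_cstar.

Lemma op_cmulE U V x : opfun (U *c V) x = U (V x).
Proof. by []. Qed.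

Lemma op_cadj_eq U V : (forall x y, ip (U x) y = ip x (V y)) -> adj U = V.
Proof. exact: op_adj_eq. Qed.

End HilbertModule.

(** * The algebra as a Hilbert module over itself, and its embedding in a unital algebra *)

Section SelfModule.
Variables (K : numClosedFieldType) (A : cstarType K).
Implicit Types x y z : A.

Let self_ip x y : A := adj x *c y.

Fact self_ip_linear (k : K) x y z :
  self_ip x (k *: y + z) = k *: self_ip x y + self_ip x z.
Proof. by rewrite /self_ip cmulDr cmulZr. Qed.

Fact self_ip_adj x y : adj (self_ip x y) = self_ip y x.
Proof. by rewrite /self_ip cadjM cadjK. Qed.

Fact self_ip_le x y : `|self_ip x y| <= `|x| * `|y|.
Proof. by apply: le_trans (cnormM _ _) _; rewrite cnorm_adj. Qed.

Definition self_module : hilbert_module A :=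
  HilbertModule self_ip_linear self_ip_adj self_ip_le (@cnorm_adj_mul K A).

End SelfModule.

Section Multiplier.
Variables (R : realType) (A : cstarType R[i]).
Local Notation M := (adjointable (self_module A)).

Fact lmult_proof (a : A) :
  (fun x : self_module A => a *c x) \in @adjointable_pred R A (self_module A).
Proof.
apply/adjointableP; split; first by exists `|a| => x; exact: cnormM.
by exists (fun x => adj a *c x) => x y; rewrite /= cadjM cmulA.
Qed.

(** This isometric embedding in an algebra with unit [op_id] takes the place of adjoining a unit. *)
Definition lmult (a : A) : M := @exist _ (fun T => T \in @adjointable_pred _ _ _) _ (lmult_proof a).

Lemma lmultE a x : opfun (lmult a) x = a *c x.
Proof. by []. Qed.

Lemma lmultD a b : lmult (a + b) = lmult a + lmult b.
Proof. by apply: adjointable_eq => x; rewrite opD !lmultE cmulDl. Qed.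

Lemma lmult0 : lmult 0 = 0.
Proof. by apply: adjointable_eq => x; rewrite lmultE cmul0l. Qed.

Lemma lmultM a b : lmult (a *c b) = lmult a *c lmult b.
Proof. by apply: adjointable_eq => x; rewrite op_cmulE !lmultE cmulA. Qed.

Lemma lmult_adj a : lmult (adj a) = adj (lmult a).
Proof.
by apply/esym/op_cadj_eq => x y; rewrite !lmultE /= cadjM cmulA.
Qed.

(** The vector [adj a] attains the norm, since |a a^*| = |a|^2. *)
Lemma lmult_norm a : `|lmult a| = `|a|.
Proof.
apply/eqP; rewrite eq_le op_lub/=; last by move=> x; exact: cnormM.
2: by [].
have [->|a0] := eqVneq a 0; first by rewrite normr0.
rewrite -(ler_pM2r (x := `|a|)) ?normr_gt0// -expr2 -cnorm_mul_adj -lmultE.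
by rewrite -[in leRHS](cnorm_adj a); exact: op_le.
Qed.

Fact id_adjointable : id \in @adjointable_pred R A (self_module A).
Proof.
by apply/adjointableP; split; [exists 1 => x; rewrite mul1r|exists id => x y].
Qed.

Definition op_id : M := @exist _ (fun T => T \in @adjointable_pred _ _ _) _ id_adjointable.

Lemma op_id_mull U : op_id *c U = U. Proof. exact: adjointable_eq. Qed.
Lemma op_id_mulr U : U *c op_id = U. Proof. exact: adjointable_eq. Qed.
Lemma op_id_adj : adj op_id = op_id. Proof. exact: op_cadj_eq. Qed.

End Multiplier.

(** * Square roots of contractions *)

Section Limits.
Variables (R : realType).
Local Notation K := R[i].

Lemma cvg_lipschitz (V W : normedModType K) (f : V -> W) (M : K) (T : Type)
    (F : set_system T) {FF : Filter F} (u : T -> V) (a : V) :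
  (forall x y, `|f x - f y| <= M * `|x - y|) ->
  u x @[x --> F] --> a -> f (u x) @[x --> F] --> f a.
Proof.
move=> hf /cvgrPdist_le ua; apply/cvgrPdist_le => e e0.
have M1 : 0 < `|M| + 1 by rewrite ltr_wpDl.
have e'0 : 0 < e / (`|M| + 1) by rewrite divr_gt0.
apply: filterS (ua _ e'0) => x hx.
apply: le_trans (hf _ _) _.
rewrite -[leLHS]ger0_norm ?(le_trans _ (hf a (u x)))// normrM normr_id.
apply: le_trans (_ : (`|M| + 1) * (e / (`|M| + 1)) <= _).
  by rewrite ler_pM// lerDl.
by rewrite mulrC divfK// gt_eqF.
Qed.

Lemma cvg_seq_dominated (V : completeNormedModType K) (u : nat -> V) (x : nat -> R) :
  cvgn x -> (forall n m, (n <= m)%N -> `|u m - u n| <= (x m - x n)%:C) -> cvgn u.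
Proof.
move=> cx hux; apply/cauchy_cvgP/cauchyP => e e0.
have er := pos_complexE (ltW e0).
have er0 : 0 < complex.Re e by move: e0; rewrite er ltcR.
have /cauchy_cvgP/cauchyP/(_ _ er0)[l] := cx.
have er20 : 0 < complex.Re e / 2 by rewrite divr_gt0.
have /cvgrPdist_lt/(_ _ er20)[N _ hN] := cx => _.
exists (u N); exists N => // n /= Nn; rewrite -ball_normE /= distrC.
apply: le_lt_trans (hux _ _ Nn) _; rewrite er ltcR.
apply: le_lt_trans (ler_norm _) _.
rewrite -(subrKA (limn x)); apply: le_lt_trans (ler_normD _ _) _.
rewrite [ltRHS]splitr ltrD//; last by apply: hN => /=.
by rewrite distrC; apply: hN.
Qed.

End Limits.

Section CStarLimits.
Variables (R : realType) (A : cstarType R[i]).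
Local Notation K := R[i].

Lemma cvg_adj (T : Type) (F : set_system T) {FF : Filter F} (u : T -> A) (a : A) :
  u x @[x --> F] --> a -> adj (u x) @[x --> F] --> adj a.
Proof.
apply: (cvg_lipschitz (M := 1)) => x y.
by rewrite mul1r -cadjB cnorm_adj.
Qed.

Lemma cvg_cmull (T : Type) (F : set_system T) {FF : Filter F} (u : T -> A) (a b : A) :
  u x @[x --> F] --> a -> b *c u x @[x --> F] --> b *c a.
Proof.
by apply: (cvg_lipschitz (M := `|b|)) => x y; rewrite -cmulBr cnormM.
Qed.

Lemma cvg_cmulr (T : Type) (F : set_system T) {FF : Filter F} (u : T -> A) (a b : A) :
  u x @[x --> F] --> a -> u x *c b @[x --> F] --> a *c b.
Proof.
by apply: (cvg_lipschitz (f := fun x => x *c b) (M := `|b|)) => x y;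
  rewrite -cmulBl mulrC cnormM.
Qed.

Lemma cvg_cmul (T : Type) (F : set_system T) {FF : Filter F} (u v : T -> A) (a b : A) :
  u x @[x --> F] --> a -> v x @[x --> F] --> b -> u x *c v x @[x --> F] --> a *c b.
Proof.
move=> ua vb.
have -> : (fun x => u x *c v x) = (fun x => (u x - a) *c (v x - b) + (u x *c b + a *c v x - a *c b)).
  apply/funext => x; rewrite cmulBr !cmulBl opprB.
  by rewrite [RHS](AC ((2*2)*3) (1*(2*6)*(3*7)*(4*5)))/= subrr !addNr !addr0.
rewrite -[X in _ --> X]add0r; apply: cvgD; last first.
  rewrite -[X in _ --> X](addrK (a *c b)).
  apply: cvgB; last exact: cvg_cst.
  by apply: cvgD; [exact: cvg_cmulr|exact: cvg_cmull].
have /cvgrPdist_le h1 : u x - a @[x --> F] --> 0 by rewrite -(subrr a); apply: cvgB => //; exact: cvg_cst.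
have /cvgrPdist_le h2 : v x - b @[x --> F] --> 0 by rewrite -(subrr b); apply: cvgB => //; exact: cvg_cst.
apply/cvgrPdist_le => e e0.
apply: filterS2 (h1 _ e0) (h2 1 ltr01) => x; rewrite !sub0r !normrN => ha hb.
by apply: le_trans (cnormM _ _) _; rewrite -[e]mulr1 ler_pM.
Qed.

(** A fixed point x of x |-> (h + x^2)/2 satisfies (1 - x)^2 = 1 - h. Started at 0, the iterates are
    polynomials in h without constant term, so no unit enters. *)
Fixpoint root_iter (h : A) (n : nat) : A :=
  if n is m.+1 then 2^-1 *: (h + root_iter h m *c root_iter h m) else 0.

(** The same iteration in R for h = 1. It is monotone and bounded, and it dominates both the
    iterates and their increments when |h| <= 1. *)
Fixpoint root_bound (n : nat) : R :=
  if n is m.+1 then 2^-1 * (1 + root_bound m * root_bound m) else 0.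

Lemma root_iterS h n :
  root_iter h n.+1 = 2^-1 *: (h + root_iter h n *c root_iter h n).
Proof. by []. Qed.

Lemma root_boundS n :
  root_bound n.+1 = 2^-1 * (1 + root_bound n * root_bound n).
Proof. by []. Qed.

Lemma root_bound01 n : 0 <= root_bound n <= 1.
Proof.
elim: n => [|n /andP[h0 h1]] /=; first by rewrite lexx ler01.
rewrite mulr_ge0 ?addr_ge0 ?mulr_ge0//=.
rewrite mulrC ler_pdivrMr// mul1r mulr2n lerD//.
by rewrite -[1]mulr1 ler_pM.
Qed.

Lemma root_bound_mono n : root_bound n <= root_bound n.+1.
Proof.
elim: n => [|n h]; first by rewrite /= mulr0 addr0 mulr1 invr_ge0.
have /andP[h0 _] := root_bound01 n.
by rewrite /= ler_wpM2l// lerD2l ler_pM.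
Qed.

Lemma root_bound_cvg : cvgn root_bound.
Proof.
apply: nondecreasing_is_cvgn.
  exact/nondecreasing_seqP/root_bound_mono.
by exists 1 => _ [n _ <-]; case/andP: (root_bound01 n).
Qed.

Lemma root_iter_norm h n : `|h| <= 1 -> `|root_iter h n| <= (root_bound n)%:C.
Proof.
move=> h1; elim: n => [|n IH]; first by rewrite normr0.
rewrite root_iterS root_boundS. rewrite rmorphM fmorphV rmorph_nat rmorphD rmorphM rmorph1.
rewrite normrZ ger0_norm ?invr_ge0//.
rewrite ler_wpM2l ?invr_ge0//; apply: le_trans (ler_normD _ _) _.
rewrite lerD//; apply: le_trans (cnormM _ _) _.
by rewrite ler_pM.
Qed.

(** The case h1 = h2 yields commutation; two different elements are needed to carry square roots
    across g in an identity G^2 g = g q^2. *)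
Lemma root_iter_intertwine h1 h2 g n : h1 *c g = g *c h2 ->
  root_iter h1 n *c g = g *c root_iter h2 n.
Proof.
move=> hg; elim: n => [|n IH] /=; first by rewrite cmul0l cmul0r.
by rewrite cmulZl cmulZr cmulDl cmulDr hg -cmulA IH cmulA IH cmulA.
Qed.

Lemma root_iter_comm h m n : root_iter h m *c root_iter h n = root_iter h n *c root_iter h m.
Proof. by apply: root_iter_intertwine; apply/esym/root_iter_intertwine. Qed.

(** Successive iterates commute, so the difference of their squares factors, and each factor is
    dominated by the corresponding scalar one. *)
Lemma root_iter_step h n : `|h| <= 1 ->
  `|root_iter h n.+1 - root_iter h n| <= (root_bound n.+1 - root_bound n)%:C.
Proof.
move=> h1; elim: n => [|n IH].
  by rewrite !subr0; exact: root_iter_norm.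
have -> : root_iter h n.+2 - root_iter h n.+1 = 2^-1 *:
   ((root_iter h n.+1 - root_iter h n) *c (root_iter h n.+1 + root_iter h n)).
  rewrite [X in X - _]root_iterS [X in _ - X]root_iterS.
  rewrite -scalerBr opprD addrACA subrr add0r cmulBl !cmulDr.
  by rewrite (root_iter_comm h n n.+1) opprD addrA addrK.
have -> : root_bound n.+2 - root_bound n.+1 = 2^-1 *
   ((root_bound n.+1 - root_bound n) * (root_bound n.+1 + root_bound n)).
  rewrite [X in X - _]root_boundS [X in _ - X]root_boundS.
  by rewrite -mulrBr opprD addrACA subrr add0r -subr_sqr !expr2.
rewrite normrZ ger0_norm ?invr_ge0// rmorphM fmorphV rmorph_nat.
rewrite ler_wpM2l ?invr_ge0//; apply: le_trans (cnormM _ _) _.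
rewrite rmorphM ler_pM//; apply: le_trans (ler_normD _ _) _.
by rewrite rmorphD lerD ?root_iter_norm.
Qed.

Lemma root_iter_cvg h : `|h| <= 1 -> cvgn (root_iter h).
Proof.
move=> h1; apply: cvg_seq_dominated root_bound_cvg _ => n m /subnKC <-.
elim: (m - n)%N => [|k IH]; first by rewrite addn0 !subrr normr0.
rewrite addnS -(subrKA (root_iter h (n + k))) -(subrKA (root_bound (n + k))).
apply: le_trans (ler_normD _ _) _.
by rewrite rmorphD lerD// root_iter_step.
Qed.

(* [1 - root_compl h] is the positive square root of [1 - h], computed without a unit. *)
Definition root_compl (h : A) : A := limn (root_iter h).

Lemma root_compl_norm h : `|h| <= 1 -> `|root_compl h| <= 1.
Proof.
move=> h1; apply: ler_eps_complex => // e e0.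
have /cvgrPdist_le/(_ _ e0)[N _ /(_ N (leqnn N)) hN] := root_iter_cvg h1.
rewrite -[X in `|X|](subrK (root_iter h N)).
apply: le_trans (ler_normD _ _) _; rewrite addrC lerD//.
apply: le_trans (root_iter_norm _ h1) _.
by have -> : 1 = (1 : R)%:C by []; rewrite lecR; case/andP: (root_bound01 N).
Qed.

Lemma root_compl_intertwine h1 h2 g : `|h1| <= 1 -> `|h2| <= 1 ->
  h1 *c g = g *c h2 -> root_compl h1 *c g = g *c root_compl h2.
Proof.
move=> n1 n2 hg.
have c1 : root_iter h1 n *c g @[n --> \oo] --> root_compl h1 *c g.
  by apply: cvg_cmulr; exact: root_iter_cvg.
have c2 : g *c root_iter h2 n @[n --> \oo] --> g *c root_compl h2.
  by apply: cvg_cmull; exact: root_iter_cvg.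
apply: cvg_unique c1 _ => //.
by rewrite (eq_fun (fun n => root_iter_intertwine n hg)).
Qed.

Lemma root_compl_sa h : `|h| <= 1 -> adj h = h -> adj (root_compl h) = root_compl h.
Proof.
move=> n1 sh.
have c1 : adj (root_iter h n) @[n --> \oo] --> adj (root_compl h).
  by apply: cvg_adj; exact: root_iter_cvg.
apply: cvg_unique c1 _ => //.
suff -> : (fun n => adj (root_iter h n)) = root_iter h by exact: root_iter_cvg.
apply/funext; elim=> [|n IH] /=; first exact: cadj0.
by rewrite cadjZ cadjD sh cadjM IH fmorphV rmorph_nat.
Qed.

Lemma root_complE h : `|h| <= 1 ->
  h + root_compl h *c root_compl h = root_compl h + root_compl h.
Proof.
move=> n1; have c1 := root_iter_cvg n1.
have c2 : 2^-1 *: (h + root_iter h n *c root_iter h n) @[n --> \oo] -->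
    2^-1 *: (h + root_compl h *c root_compl h).
  apply: cvgZr; apply: cvgD; first exact: cvg_cst.
  by apply: cvg_cmul.
have c3 : root_iter h n.+1 @[n --> \oo] --> root_compl h by rewrite cvg_shiftS.
have : root_compl h = 2^-1 *: (h + root_compl h *c root_compl h).
  by apply: cvg_unique c3 c2 => //.
move=> e; rewrite -mulr2n -scaler_nat [in RHS]e scalerA.
by rewrite mulfV ?pnatr_eq0// scale1r.
Qed.

End CStarLimits.

(** * Positivity *)

Section UnitalCStar.
Variables (R : realType) (A : cstarType R[i]) (e : A).
Local Notation K := R[i].
Hypotheses (e_mull : forall a, e *c a = a) (e_mulr : forall a, a *c e = a).
Implicit Types (a b c g k r s x y : A) (t : K).

Lemma cadj_unit : adj e = e.
Proof. by rewrite -[LHS]e_mulr -[RHS]cadjK -[in RHS](e_mulr (adj e)) cadjM cadjK. Qed.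

Lemma cnorm_unit : `|e| <= 1.
Proof.
have [->|e0] := eqVneq e 0; first by rewrite normr0.
have := cnorm_adj_mul e; rewrite cadj_unit e_mull expr2 -{1}[ `|e|]mulr1.
by move/(mulfI _); rewrite normr_eq0 => /(_ e0) <-.
Qed.

(* [x + i y] is a multiple of a unitary. *)
Lemma sum_sq_norm x y t : 0 <= t -> adj x = x -> adj y = y -> x *c y = y *c x ->
  x *c x + y *c y = t *: e -> `|x| ^+ 2 <= t.
Proof.
move=> t0 sx sy xy hxy; pose u := x + 'i *: y.
have su : adj u = x - 'i *: y by rewrite /u cadjD cadjZ sx sy conjCi scaleNr.
have nu : `|u| ^+ 2 <= t.
  rewrite -cnorm_adj_mul su /u cmulBl !cmulDr !cmulZl !cmulZr scalerA -xy.
  rewrite -expr2 sqrCi scaleN1r opprD opprK addrA addrK hxy normrZ ger0_norm//.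
  by rewrite ler_piMr// cnorm_unit.
apply: le_trans nu; rewrite ler_pXn2r ?nnegrE//.
rewrite -(ler_pM2l (ltr0n _ 2 : 0 < 2%:R)) -[X in X * `|x|]normr_nat -normrZ scaler_nat.
have -> : x *+ 2 = u + adj u by rewrite su /u mulr2n addrACA subrr addr0.
by apply: le_trans (ler_normD _ _) _; rewrite cnorm_adj mulr_natl mulr2n.
Qed.

(** The square root of [a] when |t - a| <= t: then 1 - a/t is a contraction, and a/t is its
    complement. *)
Definition sqrt_scaled t a : A := sqrtC t *: (e - root_compl (e - t^-1 *: a)).

Lemma scaled_norm t a : 0 < t -> `|t *: e - a| <= t -> `|e - t^-1 *: a| <= 1.
Proof.
move=> t0 h; rewrite -(ler_pM2l t0) mulr1 -[X in X * _](gtr0_norm t0) -normrZ.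
by rewrite scalerBr scalerA mulfV ?gt_eqF// scale1r.
Qed.

Lemma sqrt_scaled_sa t a : 0 < t -> adj a = a -> `|t *: e - a| <= t ->
  adj (sqrt_scaled t a) = sqrt_scaled t a.
Proof.
move=> t0 sa h; rewrite /sqrt_scaled cadjZ cadjB cadj_unit root_compl_sa.
- by rewrite conj_Creal// realE sqrtC_ge0 ltW.
- exact: scaled_norm.
by rewrite cadjB cadj_unit cadjZ sa conj_Creal// realE invr_ge0 ltW.
Qed.

Lemma sqrt_scaled_sq t a : 0 < t -> `|t *: e - a| <= t ->
  sqrt_scaled t a *c sqrt_scaled t a = a.
Proof.
move=> t0 h; rewrite /sqrt_scaled cmulZl cmulZr scalerA -expr2 sqrtCK.
rewrite cmulBl !cmulBr !e_mull e_mulr.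
have := root_complE (scaled_norm t0 h); set w := root_compl _ => hw.
have -> : w - w *c w = e - t^-1 *: a - w.
  by apply/eqP; rewrite subr_eq addrAC hw addrK.
rewrite opprB addrA subrK opprB addrC subrK scalerA mulfV ?gt_eqF//.
by rewrite scale1r.
Qed.

Lemma sqrt_scaled_norm t a : 0 < t -> `|t *: e - a| <= t ->
  `|sqrtC t *: e - sqrt_scaled t a| <= sqrtC t.
Proof.
move=> t0 h; rewrite /sqrt_scaled -scalerBr opprB addrC subrK normrZ.
have st0 : 0 <= sqrtC t by rewrite sqrtC_ge0 ltW.
rewrite ger0_norm// ler_piMr//.
by apply: root_compl_norm; exact: scaled_norm.
Qed.

Lemma sqrt_scaled_intertwine t a b g : 0 < t ->
  `|t *: e - a| <= t -> `|t *: e - b| <= t -> a *c g = g *c b ->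
  sqrt_scaled t a *c g = g *c sqrt_scaled t b.
Proof.
move=> t0 na nb hg; rewrite /sqrt_scaled cmulZl cmulZr cmulBl cmulBr e_mull e_mulr.
congr (_ *: (_ - _)); apply: root_compl_intertwine; try exact: scaled_norm.
by rewrite cmulBl cmulBr e_mull e_mulr cmulZl cmulZr hg.
Qed.

(** For self-adjoint [a] such a t exists exactly when the spectrum is nonnegative; in this form
    stability under sums is the triangle inequality. *)
Definition psd a := adj a = a /\ exists2 t, 0 < t & `|t *: e - a| <= t.

Lemma psd_ge a t t' : t <= t' -> `|t *: e - a| <= t -> `|t' *: e - a| <= t'.
Proof.
move=> tt' h; rewrite -(subrK t t') scalerDl -addrA.
apply: le_trans (ler_normD _ _) _; rewrite lerD// normrZ ger0_norm ?subr_ge0//.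
by rewrite ler_piMr ?subr_ge0// cnorm_unit.
Qed.

Lemma psdI a t : adj a = a -> 0 <= t -> `|t *: e - a| <= t -> psd a.
Proof.
move=> sa t0 h; split=> //; exists (t + 1); first by rewrite ltr_wpDl.
by apply: psd_ge h; rewrite lerDl.
Qed.

Lemma psd0 : psd 0.
Proof. by apply: (@psdI _ 0); rewrite ?cadj0// scale0r subr0 normr0. Qed.

Lemma psdD a b : psd a -> psd b -> psd (a + b).
Proof.
move=> [sa [t t0 ta]] [sb [t' t'0 tb]]; apply: (@psdI _ (t + t')).
- by rewrite cadjD sa sb.
- by rewrite addr_ge0 ?ltW.
rewrite scalerDl opprD addrACA.
by apply: le_trans (ler_normD _ _) _; rewrite lerD.
Qed.

Lemma psdZ a t : 0 <= t -> psd a -> psd (t *: a).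
Proof.
move=> t0 [sa [t' t'0 ta]]; apply: (@psdI _ (t * t')).
- by rewrite cadjZ sa conj_Creal// realE t0.
- by rewrite mulr_ge0// ltW.
by rewrite -scalerA -scalerBr normrZ ger0_norm// ler_wpM2l.
Qed.

Lemma psd_compl a t : adj a = a -> 0 <= t -> `|a| <= t -> psd (t *: e - a).
Proof.
move=> sa t0 ha; apply: (@psdI _ t) => //.
  by rewrite cadjB sa cadjZ cadj_unit conj_Creal// realE t0.
by rewrite opprB addrC subrK.
Qed.

Lemma psd_sqrt a : psd a -> exists r, [/\ adj r = r, r *c r = a, psd r &
  forall g, a *c g = g *c a -> r *c g = g *c r].
Proof.
move=> [sa [t t0 ta]]; exists (sqrt_scaled t a); split.
- exact: sqrt_scaled_sa.
- exact: sqrt_scaled_sq.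
- apply: (@psdI _ (sqrtC t)); first exact: sqrt_scaled_sa.
    by rewrite sqrtC_ge0 ltW.
  exact: sqrt_scaled_norm.
- by move=> g; exact: sqrt_scaled_intertwine.
Qed.

(** The square root r of t - k^2 commutes with k and r^2 + k^2 = t, so [sum_sq_norm] bounds |r|^2 =
    |t - k^2|. *)
Lemma sq_psd_norm k t : adj k = k -> `|k| ^+ 2 <= t -> `|t *: e - k *c k| <= t.
Proof.
move=> sk kt; have t0 := le_trans (exprn_ge0 2 (normr_ge0 k)) kt.
have sk2 : adj (k *c k) = k *c k by rewrite cadjM sk.
have nk : `|k *c k| <= t by rewrite cnorm_sa.
have [r [sr rr _ rc]] := psd_sqrt (psd_compl sk2 t0 nk).
rewrite -rr cnorm_sa//; apply: (@sum_sq_norm r k) => //.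
  by apply: rc; rewrite cmulBl cmulBr cmulZl cmulZr e_mull e_mulr cmulA.
by rewrite rr subrK.
Qed.

Lemma psd_sq k : adj k = k -> psd (k *c k).
Proof.
move=> sk; apply: (@psdI _ (`|k| ^+ 2)); first by rewrite cadjM sk.
  by rewrite exprn_ge0.
exact: sq_psd_norm.
Qed.

(** The square roots r of a and s of -a commute and r^2 + s^2 = 0, so [sum_sq_norm] applies with t =
    0. *)
Lemma psd_opp_eq0 a : psd a -> psd (- a) -> a = 0.
Proof.
move=> /psd_sqrt[r [sr rr _ rc]] /psd_sqrt[s [ss hs _ sc]].
have r0 : `|r| ^+ 2 <= 0.
  apply: (@sum_sq_norm r s) => //; last by rewrite rr hs subrr scale0r.
  apply: rc; apply/esym/sc; rewrite cmulNl cmulNr//.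
by rewrite -rr; apply/eqP; rewrite -normr_le0 cnorm_sa.
Qed.

(** With t = |a + b| the element t - a is the sum of t - (a + b) and b, hence positive; a and t - a
    have commuting square roots whose squares sum to t. *)
Lemma psd_norm_mono a b : psd a -> psd b -> `|a| <= `|a + b|.
Proof.
move=> pa pb; pose t := `|a + b|.
have sab : adj (a + b) = a + b by rewrite cadjD pa.1 pb.1.
have pc : psd (t *: e - a).
  have -> : t *: e - a = t *: e - (a + b) + b by rewrite opprD addrA subrK.
  by apply: psdD => //; apply: psd_compl; rewrite ?/t.
have [r [sr rr _ rc]] := psd_sqrt pa; have [s [ss hs _ sc]] := psd_sqrt pc.
rewrite -rr cnorm_sa//; apply: (@sum_sq_norm r s) => //; last first.
  by rewrite rr hs addrC subrK.
apply: rc; apply/esym/sc.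
by rewrite cmulBl cmulBr cmulZl cmulZr e_mull e_mulr.
Qed.

Lemma psd_conj a g : psd a -> adj g = g -> a *c g = g *c a -> psd (g *c a *c g).
Proof.
move=> /psd_sqrt[r [sr rr _ rc]] sg /rc hg.
have -> : g *c a *c g = (r *c g) *c (r *c g).
  by rewrite -rr {1}hg !cmulA.
by apply: psd_sq; rewrite cadjM sr sg hg.
Qed.

Lemma sa_sq_eq0 a : adj a = a -> a *c a = 0 -> a = 0.
Proof. by move=> sa h; apply: cmul_adj_eq0; rewrite sa. Qed.

(** For d = k - g the positive elements d k d and d g d add up to d (k + g) d = 0. Both therefore
    vanish, so d^3 = 0, and a self-adjoint nilpotent element is 0. *)
Lemma psd_sqrt_unique k g : psd k -> psd g -> k *c g = g *c k ->
  k *c k = g *c g -> k = g.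
Proof.
move=> pk pg kg hkg; pose d := k - g.
have sd : adj d = d by rewrite cadjB pk.1 pg.1.
have kd : k *c d = d *c k by rewrite cmulBl cmulBr kg.
have gd : g *c d = d *c g by rewrite cmulBl cmulBr kg.
have d0 : d *c k + d *c g = 0.
  by rewrite -kd -gd !cmulBr hkg kg addrA subrK subrr.
have h0 : d *c k *c d + d *c g *c d = 0 by rewrite -cmulDl d0 cmul0l.
have h1 : d *c k *c d = 0.
  apply: psd_opp_eq0; first exact: psd_conj.
  have -> : - (d *c k *c d) = d *c g *c d.
    by apply/eqP; rewrite eq_sym -addr_eq0 addrC h0.
  exact: psd_conj.
have h2 : d *c g *c d = 0 by move: h0; rewrite h1 add0r.
have d3 : d *c d *c d = 0 by rewrite {2}/d cmulBr cmulBl h1 h2 subrr.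
apply/eqP; rewrite -subr_eq0 -/d; apply/eqP.
apply: sa_sq_eq0 => //; apply: sa_sq_eq0; first by rewrite cadjM sd.
by rewrite cmulA d3 cmul0l.
Qed.

(** This replaces the comparison of the spectra of g^* g and g g^*. Real and imaginary parts show
    that G = g g^* is positive. From G g = - g q follows G^2 g = g q^2, and taking square roots
    gives G g = g q; hence g q = 0 and q^2 = 0. *)
Lemma psd_adj_mul_neg g q : psd q -> adj g *c g = - q -> g = 0.
Proof.
move=> pq hq.
pose u := g + adj g; pose v := 'i *: (g - adj g).
have su : adj u = u by rewrite /u cadjD cadjK addrC.
have sv : adj v = v.
  by rewrite /v cadjZ cadjB cadjK conjCi scaleNr -scalerN opprB.
pose G := g *c adj g.
have hG : 2 *: G = u *c u + v *c v + 2 *: q.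
  rewrite /v cmulZl cmulZr scalerA -expr2 sqrCi scaleN1r.
  rewrite -[q]opprK -hq /u /G !(cmulDl, cmulDr, cmulNl, cmulNr).
  rewrite scalerN !scaler_nat (opprB (_ - _)) (opprB (g *c g)) !mulr2n.
  rewrite [X in _ = X - _](AC ((2*2)*(2*2)) ((2*7)*(3*5)*(1*8)*(4*6)))/=.
  by rewrite !subrr !addr0 addrK.
have pG : psd G.
  rewrite -[G]scale1r -(mulVf (x := 2 : K)) ?pnatr_eq0// -scalerA hG.
  by apply: psdZ; rewrite ?invr_ge0//; apply: psdD; [apply: psdD; exact: psd_sq|exact: psdZ].
have Gg : G *c g = - (g *c q) by rewrite /G -cmulA hq cmulNr.
have G2g : (G *c G) *c g = g *c (q *c q).
  by rewrite -cmulA Gg cmulNr cmulA Gg cmulNl opprK cmulA.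
(* A single scale that fits both squares, as the intertwining of [sqrt_scaled] requires; the summand
   1 makes it positive. *)
pose t := `|G| ^+ 2 + `|q| ^+ 2 + 1.
have t0 : 0 < t by rewrite ltr_wpDl// addr_ge0 ?exprn_ge0.
have tG : `|t *: e - G *c G| <= t.
  by apply: sq_psd_norm pG.1 _; rewrite /t -addrA lerDl addr_ge0 ?exprn_ge0.
have tq : `|t *: e - q *c q| <= t.
  apply: sq_psd_norm pq.1 _; rewrite /t -addrA addrCA lerDl addr_ge0 ?exprn_ge0//.
have st0 : 0 <= sqrtC t by rewrite sqrtC_ge0 ltW.
have root_eq b : psd b -> `|t *: e - b *c b| <= t -> sqrt_scaled t (b *c b) = b.
  move=> pb tb; have sb2 : adj (b *c b) = b *c b by rewrite cadjM pb.1.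
  apply: psd_sqrt_unique => //.
  - by apply: psdI st0 _; [exact: sqrt_scaled_sa|exact: sqrt_scaled_norm].
  - by apply: sqrt_scaled_intertwine => //; rewrite cmulA.
  - exact: sqrt_scaled_sq.
have := sqrt_scaled_intertwine t0 tG tq G2g.
rewrite !root_eq// Gg => /eqP; rewrite eq_sym -addr_eq0 -mulr2n -scaler_nat.
rewrite scaler_eq0 pnatr_eq0 /= => /eqP gq0.
have q0 : q = 0.
  apply: sa_sq_eq0; first exact: pq.1.
  by rewrite -[q in q *c _]opprK -hq cmulNl -cmulA gq0 cmul0r oppr0.
by apply: cmul_adj_eq0; rewrite hq q0 oppr0.
Qed.

(* Kelley and Vaught: with [n] (twice) the negative part of [c^* c], the element [(c n)^* (c n)]
   is both negative and of the form [g^* g]. *)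
Lemma psd_adj_mul c : psd (adj c *c c).
Proof.
pose a := adj c *c c; have sa : adj a = a by rewrite /a cadjM cadjK.
have [b [sb bb pb bc]] := psd_sqrt (psd_sq sa).
have ba : b *c a = a *c b by apply: bc; rewrite cmulA.
pose n := b - a.
have sn : adj n = n by rewrite cadjB sb sa.
have bn : b *c n = n *c b by rewrite cmulBl cmulBr ba.
have nba : n *c a = - (n *c b).
  apply/eqP; rewrite -addr_eq0 -cmulDr /n cmulBl !cmulDr bb ba.
  by rewrite [X in _ - X]addrC subrr.
have pq := psd_conj pb sn bn.
have cn : c *c n = 0.
  apply: (psd_adj_mul_neg pq).
  rewrite cadjM sn cmulA -(cmulA n) -/a nba cmulNl//.
have an : a *c n = 0 by rewrite -cmulA cn cmul0r.
have na : n *c a = 0 by apply: cadj_inj; rewrite cadjM sn sa an cadj0.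
have nb : n *c b = 0 by apply/eqP; rewrite -oppr_eq0 -nba na.
have n0 : n = 0 by apply: sa_sq_eq0 => //; rewrite {2}/n cmulBr na nb subrr.
by rewrite -/a (_ : a = b)//; apply/esym/eqP; rewrite -subr_eq0 -/n n0.
Qed.

End UnitalCStar.

(** * Monotonicity of the norm and contractivity of star morphisms *)

Section Contractions.
Variables (R : realType).
Local Notation K := R[i].

(** Positivity is tested among the adjointable operators on A, where a unit exists and [lmult]
    preserves the norm. *)
Lemma sum_adj_mul_norm_mono (A : cstarType K) (I J : Type) (r : seq I) (q : seq J)
    (c : I -> A) (d : J -> A) :
  `|\sum_(i <- r) adj (c i) *c c i| <=
  `|\sum_(i <- r) adj (c i) *c c i + \sum_(j <- q) adj (d j) *c d j|.
Proof.
have e1 := @op_id_mull R A; have e2 := @op_id_mulr R A.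
rewrite -(lmult_norm (\sum_(i <- r) _)) -(lmult_norm (_ + _)) lmultD.
have psd_sum (L : Type) (p : seq L) (f : L -> A) :
    psd (op_id A) (lmult (\sum_(i <- p) adj (f i) *c f i)).
  elim: p => [|i p IH]; first by rewrite big_nil lmult0; exact: psd0.
  rewrite big_cons lmultD; apply: psdD => //.
  by rewrite lmultM lmult_adj; exact: (psd_adj_mul e1 e2).
exact: (psd_norm_mono e1 e2).
Qed.

Lemma adj_mul_norm_mono (A : cstarType K) (c : A) (I : Type) (r : seq I) (d : I -> A) :
  `|c| ^+ 2 <= `|adj c *c c + \sum_(i <- r) adj (d i) *c d i|.
Proof.
have := sum_adj_mul_norm_mono [:: tt] r (fun=> c) d.
by rewrite big_seq1 cnorm_adj_mul.
Qed.

(** For self-adjoint h in the unit ball, w = [root_compl] of h^2 lies in A itself, and h^2 + (1 -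
    w)^2 = 1 can be written without the unit. After applying f, the unit is restored in the
    operators on B, where [sum_sq_norm] gives |f h| <= 1. The general case is that of a^* a,
    normalized. *)
Lemma star_morphism_contractive (A B : cstarType K) (f : {linear A -> B}) (a : A) :
  star_morphism f -> `|f a| <= `|a|.
Proof.
move=> [fM fadj].
have e1 := @op_id_mull R B; have e2 := @op_id_mulr R B.
have unit_ball h : adj h = h -> `|h| <= 1 -> `|f h| <= 1.
  move=> sh nh; have nhh : `|h *c h| <= 1 by rewrite cnorm_sa// exprn_ile1.
  have shh : adj (h *c h) = h *c h by rewrite cadjM sh.
  pose w := root_compl (h *c h).
  have sw : adj w = w by exact: root_compl_sa.
  have wh : w *c h = h *c w by apply: root_compl_intertwine => //; rewrite cmulA.
  have hw : h *c h + w *c w = w + w by exact: root_complE.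
  rewrite -(lmult_norm (f h)) -(@ler_pXn2r _ 2) ?nnegrE// expr1n.
  apply: (@sum_sq_norm R _ (op_id B) e1 e2 (lmult (f h)) (op_id B - lmult (f w))).
  - exact: ler01.
  - by rewrite -lmult_adj -fadj sh.
  - by rewrite cadjB op_id_adj -lmult_adj -fadj sw.
  - by rewrite cmulBr cmulBl e1 e2 -!lmultM -!fM wh.
  rewrite scale1r cmulBl !cmulBr !e1 e2 -!lmultM -!fM.
  have hW : lmult (f (h *c h)) + lmult (f (w *c w)) = lmult (f w) + lmult (f w).
    by rewrite -!lmultD -!raddfD hw.
  rewrite opprB [LHS](AC (1*(2*2)) (2*((1*4)*(3*5))))/=.
  by rewrite -opprD hW subrr addr0.
have [->|a0] := eqVneq a 0; first by rewrite linear0 !normr0.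
have na : 0 < `|a| ^+ 2 by rewrite exprn_gt0// normr_gt0.
rewrite -(@ler_pXn2r _ 2) ?nnegrE// -cnorm_adj_mul -fadj -fM.
have := unit_ball ((`|a| ^+ 2)^-1 *: (adj a *c a)).
have ni : 0 <= (`|a| ^+ 2)^-1 by rewrite invr_ge0 ltW.
rewrite linearZ !normrZ !(ger0_norm ni) cnorm_adj_mul mulVf ?gt_eqF//.
rewrite cadjZ cadjM cadjK conj_Creal ?realE ?ni// => /(_ erefl (lexx _)).
by rewrite mulrC ler_pdivrMr// mul1r.
Qed.

End Contractions.

(** * Square summable sequences *)

Section FiniteColumns.
Variables (R : realType) (A : cstarType R[i]).
Local Notation K := R[i].

Definition fin_ip (I : Type) (r : seq I) (x y : I -> A) : A :=
  \sum_(i <- r) adj (x i) *c y i.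

Variables (I : Type) (r : seq I).
Implicit Types x y : I -> A.

Lemma fin_ip_adj x y : adj (fin_ip r x y) = fin_ip r y x.
Proof. by rewrite cadj_sum; apply: eq_bigr => i _; rewrite cadjM cadjK. Qed.

Lemma fin_ipDr x y z : fin_ip r x (y + z) = fin_ip r x y + fin_ip r x z.
Proof. by rewrite -big_split; apply: eq_bigr => i _; rewrite cmulDr. Qed.

Lemma fin_ipDl x y z : fin_ip r (x + y) z = fin_ip r x z + fin_ip r y z.
Proof. by rewrite -big_split; apply: eq_bigr => i _; rewrite cadjD cmulDl. Qed.

Lemma fin_ipZr (k : K) x y : fin_ip r x (k *: y) = k *: fin_ip r x y.
Proof. by rewrite scaler_sumr; apply: eq_bigr => i _; rewrite cmulZr. Qed.

Lemma fin_ipZl (k : K) x y : fin_ip r (k *: x) y = (k^*)%R *: fin_ip r x y.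
Proof. by rewrite scaler_sumr; apply: eq_bigr => i _; rewrite cadjZ cmulZl. Qed.

(* With [b = <y, x>] and [1 - <y, y> = (1 - w)^2], the positive element [<x, x> - b^* b] is
   [<x - y b, x - y b> + ((1 - w) b)^* ((1 - w) b)]. *)
Lemma fin_ip_le_unit x y : `|fin_ip r y y| <= 1 -> `|fin_ip r x y| ^+ 2 <= `|fin_ip r x x|.
Proof.
move=> hy; have sy : adj (fin_ip r y y) = fin_ip r y y by rewrite fin_ip_adj.
set w := root_compl (fin_ip r y y).
have sw : adj w = w by exact: root_compl_sa.
have hw : fin_ip r y y + w *c w = w + w by exact: root_complE.
pose b := fin_ip r y x.
have sb : adj b = fin_ip r x y by rewrite fin_ip_adj.
pose d i := if i is Some j then x j - y j *c b else b - w *c b.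
have -> : fin_ip r x x = adj b *c b + \sum_(i <- None :: map Some r) adj (d i) *c d i.
  rewrite big_cons big_map /=.
  have -> : \sum_(j <- r) adj (x j - y j *c b) *c (x j - y j *c b) =
      fin_ip r x x - adj b *c b - adj b *c b + adj b *c fin_ip r y y *c b.
    transitivity (\sum_(j <- r) (adj (x j) *c x j - adj (x j) *c y j *c b
        - adj b *c (adj (y j) *c x j) + adj b *c (adj (y j) *c y j) *c b)).
      apply: eq_bigr => j _; rewrite cadjB cadjM cmulBl !cmulBr opprB addrA.
      by rewrite !cmulA -!addrA; congr (_ + (_ + _)); rewrite addrC.
    rewrite big_split /= !sumrB -!cmul_suml -!cmul_sumr -/(fin_ip r x y) -sb.
    by [].
  rewrite cadjB cadjM sw cmulBl !cmulBr opprB.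
  have -> : adj b *c fin_ip r y y *c b = adj b *c w *c b + adj b *c w *c b - adj b *c w *c w *c b.
    by rewrite -[fin_ip r y y](addrK (w *c w)) hw cmulBr cmulDr cmulBl cmulDl !cmulA.
  rewrite !cmulA; set bb := adj b *c b; set bw := _ *c w *c b; set bww := _ *c w *c b.
  rewrite [RHS](AC (1*((2*2)*(3*3))) (6*((1*7)*(2*8)*(3*9)*(4*11)*(5*10))))/=.
  by rewrite !subrr !addNr !addr0.
by rewrite -sb cnorm_adj; exact: adj_mul_norm_mono.
Qed.

Lemma fin_ip_le x y : `|fin_ip r x y| ^+ 2 <= `|fin_ip r x x| * `|fin_ip r y y|.
Proof.
apply: ler_eps_complex => [||e e0]; rewrite ?exprn_ge0 ?mulr_ge0//.
(* The second summand keeps the scale positive when <y, y> = 0, and after multiplication by |<x, x>|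
   it costs at most e. *)
pose t := `|fin_ip r y y| + e / (`|fin_ip r x x| + 1).
have X1 : 0 < `|fin_ip r x x| + 1 by rewrite ltr_wpDl.
have t0 : 0 < t by rewrite ltr_wpDl// divr_gt0.
have s0 : 0 < sqrtC t by rewrite sqrtC_gt0.
have si : 0 <= (sqrtC t)^-1 by rewrite invr_ge0 ltW.
have st : (((sqrtC t)^-1)^*)%R = (sqrtC t)^-1 by rewrite conj_Creal// realE si.
have := @fin_ip_le_unit x ((sqrtC t)^-1 *: y).
rewrite fin_ipZl !fin_ipZr st !normrZ !(ger0_norm si) mulrA -expr2.
rewrite exprMn !exprVn sqrtCK.
rewrite ler_pdivrMl// mulr1 ler_pdivrMl// => h.
apply: le_trans (h _) _; first by rewrite lerDl ltW// divr_gt0.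
rewrite mulrC mulrDr lerD2l mulrA ler_pdivrMr// mulrC ler_wpM2l//; first exact: ltW.
by rewrite lerDl.
Qed.

Definition fnorm x : K := sqrtC `|fin_ip r x x|.

Lemma fnorm_ge0 x : 0 <= fnorm x. Proof. by rewrite sqrtC_ge0. Qed.

Lemma fin_ip_le_fnorm x y : `|fin_ip r x y| <= fnorm x * fnorm y.
Proof.
rewrite -(@ler_pXn2r _ 2) ?nnegrE ?mulr_ge0 ?fnorm_ge0//.
by rewrite exprMn !sqrtCK fin_ip_le.
Qed.

Lemma fnormD x y : fnorm (x + y) <= fnorm x + fnorm y.
Proof.
rewrite -(@ler_pXn2r _ 2) ?nnegrE ?addr_ge0 ?fnorm_ge0// sqrtCK.
rewrite fin_ipDl !fin_ipDr addrA; apply: le_trans (ler_normD _ _) _.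
rewrite sqrrD mulr2n sqrtCK addrA lerD ?sqrtCK//.
apply: le_trans (ler_normD _ _) _.
rewrite lerD//; last by rewrite mulrC fin_ip_le_fnorm.
by apply: le_trans (ler_normD _ _) _; rewrite lerD// fin_ip_le_fnorm.
Qed.

Lemma fnormZ (k : K) x : fnorm (k *: x) = `|k| * fnorm x.
Proof.
rewrite /fnorm fin_ipZl fin_ipZr scalerA normrZ normrM norm_conjC -expr2.
by rewrite sqrtCM ?nnegrE ?exprn_ge0// sqrCK.
Qed.

Lemma fnorm_le_sum x : fnorm x <= \sum_(i <- r) `|x i|.
Proof.
rewrite -(@ler_pXn2r _ 2) ?nnegrE ?fnorm_ge0 ?sumr_ge0// sqrtCK.
rewrite /fin_ip; elim: r => [|i s IH]; first by rewrite !big_nil normr0 expr0n.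
rewrite !big_cons; apply: le_trans (ler_normD _ _) _.
rewrite cnorm_adj_mul sqrrD -addrA lerD2l; apply: le_trans IH _.
by rewrite lerDr mulrn_wge0// mulr_ge0// sumr_ge0.
Qed.

End FiniteColumns.

Section SquareSummable.
Variables (R : realType) (A : cstarType R[i]).
Local Notation K := R[i].

Lemma cvg_norm_le (V : normedModType K) (T : Type) (F : set_system T)
  {FF : ProperFilter F} (u : T -> V) (l : V) (M : K) : 0 <= M ->
  u t @[t --> F] --> l -> (\forall t \near F, `|u t| <= M) -> `|l| <= M.
Proof.
move=> M0 /cvgrPdist_le ul uM; apply: ler_eps_complex => // e e0.
have [t [h1 h2]] := filter_ex (filterI uM (ul _ e0)).
rewrite -(subrK (u t) l) addrC; apply: le_trans (ler_normD _ _) _.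
by rewrite lerD.
Qed.

Lemma cvg_norm_ge (V : normedModType K) (T : Type) (F : set_system T)
  {FF : ProperFilter F} (u : T -> V) (l : V) (M : K) : 0 <= M ->
  u t @[t --> F] --> l -> (\forall t \near F, M <= `|u t|) -> M <= `|l|.
Proof.
move=> M0 /cvgrPdist_le ul uM; apply: ler_eps_complex => // e e0.
have [t [h1 h2]] := filter_ex (filterI uM (ul _ e0)).
apply: le_trans h1 _; rewrite -(subrK l (u t)) addrC.
by apply: le_trans (ler_normD _ _) _; rewrite lerD// distrC.
Qed.

Local Notation pip x y := (fun n => fin_ip (index_iota 0 n) x y).

Lemma pip_diff (x y : nat -> A) n m : (n <= m)%N ->
  fin_ip (index_iota 0 m) x y = fin_ip (index_iota 0 n) x y + fin_ip (index_iota n m) x y.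
Proof. by move=> nm; rewrite /fin_ip (big_cat_nat (n := n)). Qed.

(** A Cauchy condition on blocks, because bounded partial sums of x_i^* x_i need not converge in
    norm in a general A. *)
Definition l2 : pred (nat -> A) := fun x =>
  `[< forall e : K, 0 < e -> exists N, forall n m, (N <= n)%N ->
        fnorm (index_iota n m) x <= e >].

Lemma l2P x : reflect (forall e : K, 0 < e -> exists N, forall n m, (N <= n)%N ->
        fnorm (index_iota n m) x <= e) (x \in l2).
Proof. exact: asboolP. Qed.

Fact l2_submod : submod_closed l2.
Proof.
split=> [|k x y /l2P hx /l2P hy].
  apply/l2P => e e0; exists 0%N => n m _.
  by rewrite -(scale0r 0) fnormZ normr0 mul0r ltW.
apply/l2P => e e0.
have k1 : 0 < `|k| + 1 by rewrite ltr_wpDl.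
have e1 : 0 < e / 2 / (`|k| + 1) by rewrite !divr_gt0.
have e2 : 0 < e / 2 by rewrite divr_gt0.
have [N1 h1] := hx _ e1; have [N2 h2] := hy _ e2.
exists (maxn N1 N2) => n m; rewrite geq_max => /andP[n1 n2].
apply: le_trans (fnormD _ _ _) _; rewrite [leRHS]splitr lerD ?h2//.
rewrite fnormZ; apply: le_trans (_ : (`|k| + 1) * (e / 2 / (`|k| + 1)) <= _).
  by rewrite ler_pM ?fnorm_ge0 ?lerDl ?h1.
by rewrite mulrC divfK// gt_eqF.
Qed.

Lemma pip_cvg (x y : nat -> A) : x \in l2 -> y \in l2 -> cvgn (pip x y).
Proof.
move=> /l2P hx /l2P hy; apply/cauchy_cvgP/cauchyP => e e0.
have [N1 h1] := hx 1 ltr01.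
have e2 : 0 < e / 2 by rewrite divr_gt0.
have [N2 h2] := hy _ e2.
exists (fin_ip (index_iota 0 (maxn N1 N2)) x y); exists (maxn N1 N2) => // n /= Nn.
rewrite -ball_normE /= distrC (pip_diff _ _ Nn) addrAC subrr add0r.
apply: le_lt_trans (fin_ip_le_fnorm _ _ _) _.
apply: le_lt_trans (_ : 1 * (e / 2) < _).
  by rewrite ler_pM ?fnorm_ge0 ?h1 ?h2 ?leq_maxl ?leq_maxr.
by rewrite mul1r ltr_pdivrMr// mulr_natr mulr2n ltrDl.
Qed.

HB.instance Definition _ := GRing.isSubmodClosed.Build K (nat -> A) l2 l2_submod.

Definition l2seq := {x : nat -> A | x \in l2}.
HB.instance Definition _ := SubType.on l2seq.
HB.instance Definition _ := Choice.on l2seq.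
HB.instance Definition _ := [SubChoice_isSubLmodule of l2seq by <:].

Definition l2fun (x : l2seq) : nat -> A := val x.
Coercion l2fun : l2seq >-> Funclass.
Implicit Types x y z : l2seq.

Lemma l2_eq (x y : l2seq) : (forall i, x i = y i) -> x = y.
Proof. by move=> h; apply/val_inj/funext. Qed.

Definition l2ip (x y : l2seq) : A := limn (pip x y).

Lemma l2ip_cvg (x y : l2seq) : fin_ip (index_iota 0 n) x y @[n --> \oo] --> l2ip x y.
Proof. exact: pip_cvg (valP x) (valP y). Qed.

Lemma l2ip_linear (k : K) (x y z : l2seq) :
  l2ip x (k *: y + z) = k *: l2ip x y + l2ip x z.
Proof.
have h : fin_ip (index_iota 0 n) x (k *: y + z : l2seq) @[n --> \oo] --> k *: l2ip x y + l2ip x z.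
  rewrite (_ : (fun n => _) = (fun n => k *: fin_ip (index_iota 0 n) x y + fin_ip (index_iota 0 n) x z)).
    by apply: cvgD; [apply: cvgZr|]; exact: l2ip_cvg.
  by apply/funext => n; rewrite -fin_ipZr -fin_ipDr.
by apply: cvg_unique (@l2ip_cvg x (k *: y + z)) h.
Qed.

Lemma l2ip_adj (x y : l2seq) : adj (l2ip x y) = l2ip y x.
Proof.
have h : adj (fin_ip (index_iota 0 n) x y) @[n --> \oo] --> adj (l2ip x y).
  by apply: cvg_adj; exact: l2ip_cvg.
apply: cvg_unique h _ => //.
rewrite (_ : (fun n => _) = (fun n => fin_ip (index_iota 0 n) y x)); first exact: l2ip_cvg.
by apply/funext => n; rewrite fin_ip_adj.
Qed.

Definition l2norm (x : l2seq) : K := sqrtC `|l2ip x x|.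

Lemma l2norm_ge0 x : 0 <= l2norm x. Proof. by rewrite sqrtC_ge0. Qed.

(** Monotonicity of the norm on positive elements enters here: a block is dominated by every initial
    partial sum that contains it. *)
Lemma fnorm_le_l2norm (x : l2seq) n m : fnorm (index_iota n m) x <= l2norm x.
Proof.
rewrite ler_sqrtC ?nnegrE//.
apply: (cvg_norm_ge (V := A) _ (@l2ip_cvg x x)) => //.
exists m => // p /= mp; case: (leqP n m) => nm; last first.
  by rewrite {1}/fin_ip /index_iota (_ : (m - n = 0)%N) ?big_nil ?normr0//; apply/eqP; rewrite subn_eq0 ltnW.
have -> : fin_ip (index_iota 0 p) x x = fin_ip (index_iota n m) x x +
   \sum_(i <- index_iota 0 n ++ index_iota m p) adj (x i) *c x i.
  rewrite (pip_diff _ _ mp) (pip_diff _ _ nm) big_cat.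
  by rewrite [fin_ip (index_iota 0 n) x x + _]addrC addrA.
exact: sum_adj_mul_norm_mono.
Qed.

Lemma l2norm_le (x : l2seq) (M : K) : 0 <= M ->
  (forall n, fnorm (index_iota 0 n) x <= M) -> l2norm x <= M.
Proof.
move=> M0 h; rewrite -(@ler_pXn2r _ 2) ?nnegrE ?l2norm_ge0// /l2norm sqrtCK.
apply: (cvg_norm_le (V := A) _ (@l2ip_cvg x x)); first exact: exprn_ge0.
exists 0%N => // n _ /=; rewrite -(sqrtCK `|_|) ler_pXn2r ?nnegrE ?sqrtC_ge0//.
exact: h.
Qed.

Lemma l2ip_le (x y : l2seq) : `|l2ip x y| <= l2norm x * l2norm y.
Proof.
apply: (cvg_norm_le (V := A) _ (@l2ip_cvg x y)); first by rewrite mulr_ge0 ?l2norm_ge0.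
exists 0%N => // n _ /=; apply: le_trans (fin_ip_le_fnorm _ _ _) _.
by rewrite ler_pM ?fnorm_ge0 ?fnorm_le_l2norm.
Qed.

Lemma coord_le_l2norm (x : l2seq) i : `|x i| <= l2norm x.
Proof.
apply: le_trans (fnorm_le_l2norm x i i.+1).
by rewrite /fnorm /fin_ip big_nat1 cnorm_adj_mul sqrCK.
Qed.

Fact l2normD x y : l2norm (x + y) <= l2norm x + l2norm y.
Proof.
apply: l2norm_le => [|n]; first by rewrite addr_ge0 ?l2norm_ge0.
by apply: le_trans (fnormD _ x y) _; rewrite lerD ?fnorm_le_l2norm.
Qed.

Fact l2normZ (k : K) x : l2norm (k *: x) = `|k| * l2norm x.
Proof.
rewrite /l2norm; have l2ipZ (a b : l2seq) : l2ip a (k *: b) = k *: l2ip a b.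
  have a0 : l2ip a 0 = 0.
    apply: (addrI (l2ip a 0)).
    by rewrite -[X in X + _]scale1r -l2ip_linear scale1r !addr0.
  by rewrite -[k *: b](addr0 (k *: b)) l2ip_linear a0 addr0.
rewrite l2ipZ -l2ip_adj l2ipZ cadjZ scalerA normrZ normrM norm_conjC l2ip_adj -expr2.
by rewrite sqrtCM ?nnegrE ?exprn_ge0// sqrCK.
Qed.

Fact l2norm_eq0 x : l2norm x = 0 -> x = 0.
Proof.
move=> h; apply: l2_eq => i; apply/eqP; rewrite -normr_le0 -h.
exact: coord_le_l2norm.
Qed.

HB.instance Definition _ := @Lmodule_isNormed.Build K l2seq l2norm l2normD l2normZ l2norm_eq0.

Fact l2_complete (F : set_system l2seq) : ProperFilter F -> cauchy F -> cvg F.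
Proof.
move=> FF /cauchyP cF.
have ballE (e : K) (U0 U : l2seq) : ball U0 e U -> `|U - U0| <= e.
  by rewrite -ball_normE /= distrC => /ltW.
have cvx i : cvg ((U : l2seq) i @[U --> F]).
  apply/cauchy_cvgP/cauchyP => e e0.
  have [U0 hU0] := cF _ e0; exists ((U0 : l2seq) i).
  suff : F [set U | ball ((U0 : l2seq) i) e ((U : l2seq) i)] by [].
  apply: filterS hU0 => U; rewrite -!ball_normE /=; apply: le_lt_trans.
  exact: coord_le_l2norm (U0 - U) i.
pose x i := lim ((U : l2seq) i @[U --> F]).
have near_x (r : seq nat) (e : K) : 0 < e ->
    F [set U : l2seq | forall i, i \in r -> `|x i - U i| <= e].
  move=> e0; elim: r => [|i r IH]; first by apply: filterS filterT => U _ i.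
  have /cvgrPdist_le/(_ e e0) h := cvx i.
  apply: filterS2 IH h => U h1 h2 j; rewrite inE => /orP[/eqP->//|]; exact: h1.
(* On a fixed block the coordinates converge uniformly, so the bound for U - U0 passes to the limit
   up to d; the bound does not depend on the block. *)
have dist_x (e : K) (U0 : l2seq) : 0 < e -> F (ball U0 e) ->
    forall n m, fnorm (index_iota n m) (x - l2fun U0) <= e.
  move=> e0 hU0 n m; apply: ler_eps_complex => [||d d0]; [exact: fnorm_ge0|exact: ltW|].
  pose N : K := (size (index_iota n m))%:R + 1.
  have N0 : 0 < N by rewrite ltr_wpDl.
  have d'0 : 0 < d / N by rewrite divr_gt0.
  have [U [h1 h2]] := filter_ex (filterI hU0 (near_x (index_iota n m) _ d'0)).
  have -> : x - l2fun U0 = (x - l2fun U) + l2fun (U - U0).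
    by apply/funext => i; rewrite !fctE addrA subrK.
  apply: le_trans (fnormD _ _ _) _; rewrite [leRHS]addrC lerD//; last first.
    exact: le_trans (fnorm_le_l2norm _ _ _) (ballE _ _ _ h1).
  apply: le_trans (fnorm_le_sum _ _) _.
  apply: le_trans (_ : \sum_(i <- index_iota n m) d / N <= _).
    by rewrite big_seq_cond [leRHS]big_seq_cond ler_sum// => i; rewrite andbT => /h2.
  rewrite big_const_seq count_predT iter_addr_0 -mulr_natl mulrCA mulrC -[leRHS]mulr1.
  by rewrite mulr1 ler_piMl ?(ltW d0)// ler_pdivrMr// mul1r lerDl ler01.
have xl2 : x \in l2.
  apply/l2P => e e0; have e2 : 0 < e / 2 by rewrite divr_gt0.
  have [U0 hU0] := cF _ e2; have /l2P/(_ _ e2)[N hN] := valP (U0 : l2seq).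
  exists N => n m Nn; rewrite -(subrK (l2fun U0) x) [leRHS]splitr.
  by apply: le_trans (fnormD _ _ _) _; rewrite lerD ?dist_x ?hN.
apply/cvg_ex; exists (@exist _ (fun u => u \in l2) x xl2); apply/cvgrPdist_le => e e0.
have e20 : 0 < e / 2 by rewrite divr_gt0.
have [U0 hU0] := cF _ e20.
apply: filterS (hU0) => U /ballE hU.
rewrite -(subrKA (U0 : l2seq)); apply: le_trans (ler_normD _ _) _.
rewrite [leRHS]splitr; apply: lerD; last by rewrite distrC.
apply: l2norm_le => [|n]; first exact: ltW.
exact: dist_x.
Qed.

HB.instance Definition _ := Uniform_isComplete.Build l2seq l2_complete.

Fact l2ip_norm (x : l2seq) : `|l2ip x x| = `|x| ^+ 2.
Proof. by rewrite sqrtCK. Qed.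

Definition l2_module : hilbert_module A :=
  HilbertModule l2ip_linear l2ip_adj l2ip_le l2ip_norm.

Fact delta_l2 (i : nat) (a : A) : (fun k => if k == i then a else 0) \in l2.
Proof.
apply/l2P => e e0; exists i.+1 => n m ni.
rewrite /fnorm /fin_ip big_nat big1 ?normr0 ?sqrtC0 ?ltW// => k /andP[nk _].
by rewrite gtn_eqF ?cmul0r// (leq_trans ni).
Qed.

Definition l2delta (i : nat) (a : A) : l2seq :=
  @exist _ (fun u => u \in l2) _ (delta_l2 i a).

Lemma l2deltaE i a k : l2delta i a k = if k == i then a else 0.
Proof. by []. Qed.

Lemma l2ip_delta x i a : l2ip x (l2delta i a) = adj (x i) *c a.
Proof.
apply: cvg_unique (@l2ip_cvg x (l2delta i a)) _ => //.
apply/cvgrPdist_le => e e0; exists i.+1 => // n /= ni.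
rewrite /fin_ip (bigD1_seq i) ?mem_index_iota ?iota_uniq//= l2deltaE eqxx.
rewrite big1 => [|k ki]; first by rewrite addr0 subrr normr0 ltW.
by rewrite l2deltaE (negPf ki) cmul0r.
Qed.

Lemma l2norm_delta i a : l2norm (l2delta i a) = `|a|.
Proof. by rewrite /l2norm l2ip_delta l2deltaE eqxx cnorm_adj_mul sqrCK. Qed.

(** * Matrix units with entries in the algebra *)

Let unit_fun (i j : nat) (b : A) : l2_module -> l2_module :=
  fun x => l2delta i (b *c l2fun x j).

Lemma unit_fun_adjoint i j b : adjoint_of (unit_fun i j b) (unit_fun j i (adj b)).
Proof.
move=> x y; rewrite -hip_adj /= /unit_fun !l2ip_delta.
by rewrite !cadjM cadjK cmulA.
Qed.

Lemma unit_fun_le i j b (x : l2_module) : `|unit_fun i j b x| <= `|b| * `|x|.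
Proof.
apply: le_trans (_ : `|b *c l2fun x j| <= _); first by rewrite -(l2norm_delta i).
by apply: le_trans (cnormM _ _) _; rewrite ler_wpM2l// coord_le_l2norm.
Qed.

Fact unit_fun_proof i j b : unit_fun i j b \in @adjointable_pred R A l2_module.
Proof.
apply/adjointableP; split; first by exists `|b|; exact: unit_fun_le.
by exists (unit_fun j i (adj b)); exact: unit_fun_adjoint.
Qed.

Definition mx_unit i j b : adjointable l2_module :=
  @exist _ (fun T => T \in @adjointable_pred _ _ _) _ (unit_fun_proof i j b).

Lemma mx_unitE i j b (x : l2_module) k :
  l2fun (mx_unit i j b x) k = if k == i then b *c l2fun x j else 0.
Proof. by []. Qed.

Lemma mx_unit_eq (U V : adjointable l2_module) :
  (forall (x : l2_module) k, l2fun (U x) k = l2fun (V x) k) -> U = V.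
Proof. by move=> h; apply: adjointable_eq => x; apply: l2_eq => k. Qed.

Lemma mx_unitD i j a b : mx_unit i j (a + b) = mx_unit i j a + mx_unit i j b.
Proof.
apply: mx_unit_eq => x k; rewrite opD mx_unitE.
transitivity (l2fun (mx_unit i j a x) k + l2fun (mx_unit i j b x) k); last by [].
by rewrite !mx_unitE; case: eqP => _; rewrite ?cmulDl ?addr0.
Qed.

Lemma mx_unit0 i j : mx_unit i j 0 = 0.
Proof. by apply: (addrI (mx_unit i j 0)); rewrite -mx_unitD !addr0. Qed.

Lemma mx_unitN i j a : mx_unit i j (- a) = - mx_unit i j a.
Proof. by apply: (addrI (mx_unit i j a)); rewrite -mx_unitD !subrr mx_unit0. Qed.

Lemma mx_unitB i j a b : mx_unit i j (a - b) = mx_unit i j a - mx_unit i j b.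
Proof. by rewrite mx_unitD mx_unitN. Qed.

Lemma mx_unitZ i j (k : K) a : mx_unit i j (k *: a) = k *: mx_unit i j a.
Proof.
apply: mx_unit_eq => x l; rewrite opZ mx_unitE.
transitivity (k *: l2fun (mx_unit i j a x) l); last by [].
by rewrite mx_unitE; case: eqP => _; rewrite ?cmulZl ?scaler0.
Qed.

Lemma mx_unit_sum i j (I : Type) (r : seq I) (P : pred I) (F : I -> A) :
  mx_unit i j (\sum_(k <- r | P k) F k) = \sum_(k <- r | P k) mx_unit i j (F k).
Proof. by apply: big_morph => [x y|]; rewrite ?mx_unitD ?mx_unit0. Qed.

Lemma mx_unitM i j k l a b :
  mx_unit i j a *c mx_unit k l b = if j == k then mx_unit i l (a *c b) else 0.
Proof.
apply: mx_unit_eq => x m; rewrite op_cmulE !mx_unitE.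
case: (j == k); rewrite ?mx_unitE; case: eqP => // _; rewrite ?cmulA ?cmul0r//.
Qed.

Lemma mx_unit_adj i j a : adj (mx_unit i j a) = mx_unit j i (adj a).
Proof. by apply: op_cadj_eq => x y; exact: unit_fun_adjoint. Qed.

Lemma mx_unit_norm_le i j a : `|mx_unit i j a| <= `|a|.
Proof. by apply: op_lub => // x; exact: unit_fun_le. Qed.

Lemma mx_unit_norm i a : `|mx_unit i i a| = `|a|.
Proof.
apply/eqP; rewrite eq_le mx_unit_norm_le /=.
have [->|a0] := eqVneq a 0; first by rewrite normr0.
have := @op_le _ _ _ (mx_unit i i a) (l2delta i (adj a)).
have -> : mx_unit i i a (l2delta i (adj a)) = l2delta i (a *c adj a).
  by apply: l2_eq => k; rewrite mx_unitE !l2deltaE eqxx.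
have hn c : `|l2delta i c : l2_module| = `|c| by exact: l2norm_delta.
by rewrite !hn cnorm_mul_adj cnorm_adj expr2 ler_pM2r ?normr_gt0.
Qed.

End SquareSummable.

(** * Paths through a contractible subgraph *)

Section HittingPaths.
Variables (E : digraph) (G0 : {pred vert E}).
Implicit Types (u v w : vert E) (e f : edge E) (p q g : seq (edge E)).

Definition path_end v p := last v (map (@rng E) p).

Lemma path_end_cat v p q : path_end v (p ++ q) = path_end (path_end v p) q.
Proof. by rewrite /path_end map_cat last_cat. Qed.

Lemma path_end_cons v e p : path_end v (e :: p) = path_end (rng e) p. Proof. by []. Qed.

Lemma path_end_rcons v p e : path_end v (rcons p e) = rng e.
Proof. by rewrite /path_end map_rcons last_rcons. Qed.

Lemma is_path_cat v p q : is_path v (p ++ q) = is_path v p && is_path (path_end v p) q.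
Proof. by elim: p v => [|e p IH] v //=; rewrite IH andbA. Qed.

Lemma is_path_rcons v p e : is_path v (rcons p e) = is_path v p && (src e == path_end v p).
Proof. by rewrite -cats1 is_path_cat /= andbT. Qed.

(** The paths that meet G0 for the first time at their end. None is a proper prefix of another
    ([hit_prefix_free]), which makes the ranges of their partial isometries orthogonal. *)
Fixpoint hit v p : bool :=
  match p with
  | [::] => v \in G0
  | e :: q => [&& v \notin G0, src e == v & hit (rng e) q]
  end.

Definition first_return v p : bool :=
  if p is e :: q then (src e == v) && hit (rng e) q else false.

Lemma hit_path v p : hit v p -> is_path v p.
Proof. by elim: p v => //= e p IH v /and3P[_ -> /IH]. Qed.

Lemma hit_end v p : hit v p -> path_end v p \in G0.
Proof. by elim: p v => //= e p IH v /and3P[_ _ /IH]. Qed.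

Lemma hit_G0 v p : v \in G0 -> hit v p = (p == [::]).
Proof. by case: p => [|e p] /= ->. Qed.

Lemma first_return_path v p : first_return v p -> is_path v p.
Proof. by case: p => //= e p /andP[-> /hit_path]. Qed.

Lemma first_return_cat v g f p : is_path v g -> all (fun e => rng e \notin G0) g ->
  src f = path_end v g -> hit (rng f) p -> first_return v (g ++ f :: p).
Proof.
have hit_cat w q : w \notin G0 -> is_path w q -> all (fun e => rng e \notin G0) q ->
    src f = path_end w q -> hit (rng f) p -> hit w (q ++ f :: p).
  elim: q w => [|e q IH] w w0 /=; first by rewrite /path_end /= => _ _ ->; rewrite w0 eqxx.
  by move=> /andP[-> qp] /andP[e0 q0] sf hp; rewrite w0 IH.
case: g => [|e g] /=; first by move=> _ _ -> ->; rewrite eqxx.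
by move=> /andP[-> gp] /andP[e0 g0] sf hp; exact: hit_cat.
Qed.

Lemma hit_prefix_free v p q : hit v p -> hit v (p ++ q) -> q = [::].
Proof.
elim: p v => [|e p IH] v /=; first by move=> v0; rewrite hit_G0// => /eqP.
by move=> /and3P[_ _ hp] /and3P[_ _]; exact: IH.
Qed.

Lemma first_return_contr (b : Defs.fpath E) :
  is_contr_edge G0 b = (psrc b \in G0) && first_return (psrc b) (pedges b).
Proof.
case: b => [[v p] bp]; rewrite /is_contr_edge /psrc /pedges /prng /plen /pedges /psrc /=.
move: bp => /=.
have hitE e q : hit (rng e) q = [&& is_path (rng e) q,
   last (rng e) (map (@rng E) q) \in G0 & all (fun e => rng e \notin G0) (take (size q) (e :: q))].
  elim: q e => [|f q IH] e /=; first by rewrite andbT.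
  rewrite IH /=; case: (rng e \in G0) => /=; first by rewrite !andbF.
  by case: (src f == _) => //=; case: is_path.
case: p => [|e q] /=; first by rewrite andbF.
by rewrite hitE => /andP[-> ->].
Qed.

Lemma contr_edge_exists v p : v \in G0 -> first_return v p ->
  exists2 b : contr_edge G0, psrc (val b) = v & pedges (val b) = p.
Proof.
move=> v0 fp; pose a : Defs.fpath E := exist _ (v, p) (first_return_path fp).
have ha : is_contr_edge G0 a by rewrite first_return_contr v0.
by exists (exist _ a ha).
Qed.

(** As an inductive predicate it supports induction along all paths up to their first visit to G0,
    while its classical negation lets one build a ray vertex by vertex. *)
Inductive terminating : vert E -> Prop :=
  Terminating v : (v \notin G0 -> forall e, src e = v -> terminating (rng e)) -> terminating v.

Lemma terminating_G0 v : v \in G0 -> terminating v.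
Proof. by move=> v0; constructor; rewrite v0. Qed.

Lemma terminating_rng v e : v \notin G0 -> src e = v -> terminating v -> terminating (rng e).
Proof. by move=> v0 ev wv; case: wv v0 ev => w h w0; exact: h. Qed.

Definition on_ray v : bool := `[< ~ terminating v >].

Lemma on_rayP v : reflect (~ terminating v) (on_ray v). Proof. exact: asboolP. Qed.

Lemma on_rayN v : ~~ on_ray v -> terminating v.
Proof. by move/asboolPn => /contrapT. Qed.

Lemma on_ray_notin v : on_ray v -> v \notin G0.
Proof. by move/on_rayP => h; apply/negP => /terminating_G0. Qed.

Lemma on_ray_next v : on_ray v -> exists2 e, src e = v & on_ray (rng e).
Proof.
move=> /on_rayP nv; apply: contrapT => h; apply: nv; constructor => v0 e ev.
by apply: on_rayN; apply/negP => ie; apply: h; exists e.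
Qed.

Lemma on_ray_src e : on_ray (rng e) -> src e \notin G0 -> on_ray (src e).
Proof. by move=> /on_rayP ne s0; apply/on_rayP => ws; apply: ne; exact: terminating_rng ws. Qed.

Definition is_ray v (rho : nat -> edge E) :=
  [/\ infinite_path rho, src (rho 0%N) = v & forall i, rng (rho i) \notin G0].

Lemma on_ray_ray v : on_ray v ->
  exists2 mu, is_ray v mu & forall i, on_ray (src (mu i)) /\ on_ray (rng (mu i)).
Proof.
move=> iv.
have [f fP] : {f : vert E -> edge E & forall w, on_ray w -> src (f w) = w /\ on_ray (rng (f w))}.
  have [e0 _ _] := cid2 (on_ray_next iv).
  apply: (@choice _ _ (fun w e => on_ray w -> src e = w /\ on_ray (rng e))) => w.
  have [iw|_] := boolP (on_ray w); last by exists e0.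
  by have [e e1 e2] := on_ray_next iw; exists e.
pose vs i := iter i (fun w => rng (f w)) v.
have ivs i : on_ray (vs i) by elim: i => //= i IH; exact: (fP _ IH).2.
exists (fun i => f (vs i)).
  split=> [i||i]; first by rewrite (fP _ (ivs i.+1)).1.
    by rewrite (fP _ iv).1.
  by apply: on_ray_notin; exact: (ivs i.+1).
by move=> i; rewrite (fP _ (ivs i)).1; split; [exact: ivs|exact: (ivs i.+1)].
Qed.

Lemma lift_path (mu : nat -> edge E) : infinite_path mu ->
  (forall i, src (mu i) \notin G0) ->
  exists2 nu : nat -> edge (comp_graph G0), infinite_path nu & forall i, val (nu i) = mu i.
Proof.
move=> mup mu0.
have h i : (src (mu i) \notin G0) && (rng (mu i) \notin G0) by rewrite mup !mu0.
exists (fun i => exist _ (mu i) (h i)) => // i.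
by apply: val_inj => /=; exact: mup.
Qed.

(** For an infinite emitter this is the default value of [fset_set], the empty set; hence [out_src]
    always holds while [mem_out] asks for finiteness. *)
Definition out v : {fset edge E} := fset_set (@src E @^-1` [set v]).

Lemma out_src v e : e \in out v -> src e = v.
Proof.
rewrite /out; have [fv|nfv] := pselect (finite_set (@src E @^-1` [set v])).
  by rewrite in_fset_set// inE.
by rewrite /fset_set; case: pselect.
Qed.

Lemma mem_out v e : finite_set (@src E @^-1` [set v]) -> (e \in out v) = (src e == v).
Proof. by move=> fv; rewrite in_fset_set//; apply/idP/eqP => [|h]; rewrite inE. Qed.

Definition hit_set v : {fset seq (edge E)} := fset_set [set p | hit v p].

Section Finiteness.
Hypothesis sing_G0 : forall v, singularity v -> v \in G0.

Lemma emit_finite v : v \notin G0 -> finite_set (@src E @^-1` [set v]).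
Proof. by move=> v0; apply: contrapT => h; move: v0; rewrite sing_G0//; right. Qed.

Lemma emit_nonempty v : v \notin G0 -> exists e, src e = v.
Proof.
move=> v0; apply: contrapT => h; move: v0; rewrite sing_G0//; left.
by rewrite /sink -subset0 => e /= ev; apply: h; exists e.
Qed.

Lemma hit_set_finite v : terminating v -> finite_set [set p | hit v p].
Proof.
elim=> {}v _ IH; have [v0|v0] := boolP (v \in G0).
  apply: (@sub_finite_set _ _ [set [::]]); last exact: finite_set1.
  by move=> p /=; rewrite hit_G0// => /eqP.
apply: (@sub_finite_set _ _ (\bigcup_(e in @src E @^-1` [set v])
    ((cons e) @` [set p | hit (rng e) p]))).
  by case=> [|e p] /=; [rewrite (negPf v0)|case/and3P => _ /eqP ev hp; exists e => //; exists p].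
apply: bigcup_finite; first exact: emit_finite.
by move=> e ev; apply: finite_image; exact: IH.
Qed.

Lemma mem_hit_set v p : terminating v -> (p \in hit_set v) = hit v p.
Proof.
by move=> wv; rewrite in_fset_set; [apply/idP/idP; rewrite inE|exact: hit_set_finite].
Qed.

Lemma terminating_hit v : terminating v -> exists p, hit v p.
Proof.
elim=> {}v _ IH; have [v0|v0] := boolP (v \in G0); first by exists [::].
have [e ev] := emit_nonempty v0; have [p hp] := IH v0 e ev.
by exists (e :: p); rewrite /= v0 ev eqxx.
Qed.

Lemma hit_set_perm v : v \notin G0 -> terminating v ->
  perm_eq (hit_set v) [seq e :: p | e <- out v, p <- hit_set (rng e)].
Proof.
move=> v0 wv; apply: uniq_perm; first exact: fset_uniq.
  apply: allpairs_uniq_dep => [|e _|[e p] [f q] _ _ /= [-> ->]]//; exact: fset_uniq.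
move=> p; rewrite mem_hit_set//; apply/idP/allpairsPdep.
  case: p => [|e p] /=; first by rewrite (negPf v0).
  move=> /and3P[_ /eqP ev hp]; exists e, p.
  have wr : terminating (rng e) by exact: terminating_rng wv.
  by rewrite (mem_out _ (emit_finite v0)) ev eqxx (mem_hit_set _ wr).
move=> [e [q [eo qh ->]]] /=; rewrite v0 (out_src eo) eqxx /=.
have wr : terminating (rng e) by apply: terminating_rng wv => //; exact: out_src.
by rewrite -(mem_hit_set _ wr).
Qed.

End Finiteness.
End HittingPaths.

(** * Vertices on rays and the paths that lead to them from G0 *)

Record contractible (E : digraph) (G0 : {pred vert E}) : Prop := Contractible {
  contr_no_tails : ~ exists mu : nat -> edge E, is_tail mu;
  contr_sing : forall v : vert E, singularity v -> v \in G0;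
  contr_acyclic : acyclic_graph (comp_graph G0);
  contr_a : forall v : vert E, v \in G0 ->
    forall rho rho' : nat -> edge E,
      infinite_path rho -> src (rho 0%N) = v -> (forall i, rng (rho i) \notin G0) ->
      infinite_path rho' -> src (rho' 0%N) = v -> (forall i, rng (rho' i) \notin G0) ->
      rho = rho';
  contr_b : forall mu : nat -> edge (comp_graph G0), infinite_path mu ->
    set_reaches G0 (val (src (mu 0%N)));
  contr_c : forall mu : nat -> edge (comp_graph G0), infinite_path mu ->
    forall i, exists e : edge E, @rng E @^-1` [set val (src (mu i))] = [set e];
  contr_d : forall mu : nat -> edge (comp_graph G0), infinite_path mu ->
    forall e : edge E, rng e = val (src (mu 0%N)) -> finite_set (@src E @^-1` [set src e])
}.

Section Anchors.
Variables (E : digraph) (G0 : {pred vert E}).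
Implicit Types (u v w : vert E) (e f : edge E) (p q g : seq (edge E)).
Local Notation on_ray := (on_ray G0).
Local Notation hit_set := (hit_set G0).
Local Notation hit := (hit G0).
Local Notation first_return := (first_return G0).

Hypothesis H : contractible G0.
Let sing_G0 := contr_sing H.
Let cond_a := contr_a H.
Let cond_b := contr_b H.
Let cond_c := contr_c H.
Let cond_d := contr_d H.
Let no_tails := contr_no_tails H.
Let acyclic_T := contr_acyclic H.

Lemma on_ray_comp_path v : on_ray v ->
  exists2 nu : nat -> edge (comp_graph G0), infinite_path nu & val (src (nu 0%N)) = v.
Proof.
move=> /on_ray_ray[mu [mup mu0 _] mui].
have [nu nup nuE] := lift_path mup (fun i => on_ray_notin (mui i).1).
by exists nu => //; rewrite -mu0 -nuE.
Qed.

Lemma on_ray_reached v : on_ray v -> set_reaches G0 v.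
Proof. by move=> /on_ray_comp_path[nu nup <-]; exact: cond_b. Qed.

Lemma on_ray_rng_inj e f : on_ray (rng e) -> rng e = rng f -> e = f.
Proof.
move=> /on_ray_comp_path[nu nup nu0] ef; have [c hc] := cond_c nup 0%N.
have : [set c] e by rewrite -hc nu0.
have : [set c] f by rewrite -hc nu0 /= ef.
by move=> -> ->.
Qed.

Lemma on_ray_finite e : on_ray (rng e) -> finite_set (@src E @^-1` [set src e]).
Proof. by move=> /on_ray_comp_path[nu nup nu0]; apply: (cond_d nup); rewrite nu0. Qed.

(** Every edge must end on a ray, so that condition (c) determines each edge from its range. *)
Definition anchor v (ug : vert E * seq (edge E)) :=
  [/\ ug.1 \in G0, is_path ug.1 ug.2, path_end ug.1 ug.2 = v &
      all (fun e => on_ray (rng e)) ug.2].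

Lemma anchor_G0 v : v \in G0 -> anchor v (v, [::]). Proof. by []. Qed.

Lemma anchor_rcons e u g : on_ray (rng e) -> anchor (src e) (u, g) ->
  anchor (rng e) (u, rcons g e).
Proof.
move=> ie [u0 /= gp ge gi]; split=> //=; first by rewrite is_path_rcons gp ge eqxx.
  by rewrite path_end_rcons.
by rewrite all_rcons ie.
Qed.

(** Condition (b) gives a path from G0; the part after its last visit to G0 is an anchor, because a
    predecessor of a ray vertex lies in G0 or on a ray. *)
Lemma anchor_exists v : on_ray v -> exists ug, anchor v ug.
Proof.
move=> iv; have [u u0 [[[a p] ap]]] := on_ray_reached iv.
rewrite /prng /psrc /pedges /= -/(path_end a p) => eu; rewrite -eu in u0; move: ap => /=.
elim/last_ind: p v iv => [|p e IH] v iv; first by move=> _ ev; move: (on_ray_notin iv); rewrite -ev u0.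
rewrite is_path_rcons path_end_rcons => /andP[pp /eqP se] ev.
have {iv}ie : on_ray (rng e) by rewrite ev.
have [s0|s0] := boolP (src e \in G0).
  by exists (src e, [:: e]); rewrite -ev; exact: (anchor_rcons ie (anchor_G0 s0)).
have [[w g] wg] := IH _ (on_ray_src ie s0) pp (esym se).
by exists (w, rcons g e); rewrite -ev; exact: anchor_rcons.
Qed.

(** Read backwards, the edges are forced by (c), and both paths have to stop as soon as they meet
    G0. *)
Lemma anchor_unique v ug ug' : anchor v ug -> anchor v ug' -> ug = ug'.
Proof.
case: ug ug' => [u g] [u' g'].
elim/last_ind: g v g' => [|g e IH] v g'.
  case/lastP: g' => [|g' e'] [u0 /= _ uv _] [u'0 /= _ uv' gi'].
    by rewrite -[u]/(path_end u [::]) uv -uv'.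
  move: gi' uv'; rewrite all_rcons path_end_rcons => /andP[/on_ray_notin i' _] e'v.
  by move: i'; rewrite e'v -uv /= u0.
case/lastP: g' => [|g' e'] [u0 /= gp uv gi] [u'0 /= gp' uv' gi'].
  move: gi uv; rewrite all_rcons path_end_rcons => /andP[/on_ray_notin i _] ev.
  by move: i; rewrite ev -uv' /= u'0.
move: gi gi' uv uv' gp gp'; rewrite !all_rcons !path_end_rcons !is_path_rcons.
move=> /andP[ie gi] /andP[ie' gi'] ev ev' /andP[gp /eqP se] /andP[gp' /eqP se'].
have ee : e = e' by apply: on_ray_rng_inj => //; rewrite ev ev'.
have [-> ->] : (u, g) = (u', g') by apply: (IH (src e)); split=> //=; rewrite ?ee.
by rewrite ee.
Qed.

(** Vertices of G0 are included with the empty path as anchor, so that one formula serves them and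
    the ray vertices. *)
Definition anchored v := (v \in G0) || on_ray v.

Lemma anchoredE v : anchored v = (v \in G0) || on_ray v.
Proof. by []. Qed.

Lemma on_ray_anchored v : on_ray v -> anchored v.
Proof. by rewrite anchoredE orbC => ->. Qed.

Lemma anchored_src e : on_ray (rng e) -> anchored (src e).
Proof.
move=> ie; rewrite /anchored; have [//|s0] := boolP (src e \in G0).
exact: on_ray_src ie s0.
Qed.

Definition anchor_path v : vert E * seq (edge E) :=
  if pselect (exists ug, anchor v ug) is left h then sval (cid h) else (v, [::]).

Lemma anchor_pathP v : anchored v -> anchor v (anchor_path v).
Proof.
move=> va; rewrite /anchor_path; case: pselect => [h|]; first by case: cid.
case; have [v0|v0] := boolP (v \in G0); first by exists (v, [::]).
by apply: anchor_exists; move: va; rewrite /anchored (negPf v0).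
Qed.

Definition anchor_base v := (anchor_path v).1.
Definition anchor_edges v := (anchor_path v).2.

Lemma anchor_path_G0 v : v \in G0 -> (anchor_base v = v) * (anchor_edges v = [::]).
Proof.
move=> v0; rewrite /anchor_base /anchor_edges (@anchor_unique v (anchor_path v) (v, [::]))//.
by apply: anchor_pathP; rewrite /anchored v0.
Qed.

Lemma anchor_path_rng e : on_ray (rng e) ->
  (anchor_base (rng e) = anchor_base (src e)) * (anchor_edges (rng e) = rcons (anchor_edges (src e)) e).
Proof.
move=> ie; rewrite /anchor_base /anchor_edges.
rewrite (@anchor_unique (rng e) (anchor_path (rng e))
  (anchor_base (src e), rcons (anchor_edges (src e)) e))//.
  by apply: anchor_pathP; rewrite /anchored ie orbT.
apply: anchor_rcons => //; rewrite /anchor_base /anchor_edges -surjective_pairing.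
by apply: anchor_pathP; exact: anchored_src.
Qed.

Lemma anchored_base v : anchored v -> anchor_base v \in G0.
Proof. by case/anchor_pathP. Qed.

Lemma anchored_path v : anchored v -> is_path (anchor_base v) (anchor_edges v).
Proof. by case/anchor_pathP. Qed.

Lemma anchored_end v : anchored v -> path_end (anchor_base v) (anchor_edges v) = v.
Proof. by case/anchor_pathP. Qed.

Lemma anchored_notin v : anchored v -> all (fun e => rng e \notin G0) (anchor_edges v).
Proof.
case/anchor_pathP => _ _ _ gi; apply: sub_all gi => e; exact: on_ray_notin.
Qed.

(* Uniqueness of rays propagates from the vertex of G0 along the anchoring path. *)
Lemma ray_unique v rho rho' : anchored v -> is_ray G0 v rho -> is_ray G0 v rho' -> rho = rho'.
Proof.
move=> va; have [u0 gp <- _] := anchor_pathP va.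
move: (anchored_notin va) u0 gp rho rho'; rewrite /anchor_edges.
case: (anchor_path v) => [u g] /= gi u0.
have uu rho rho' : is_ray G0 u rho -> is_ray G0 u rho' -> rho = rho'.
  by move=> [r1 r2 r3] [s1 s2 s3]; exact: (cond_a u0).
elim: g u {u0} uu gi => [|e g IH] u uu //= /andP[e0 gi] /andP[/eqP se gp] rho rho'.
apply: IH => // r r' [r1 r2 r3] [s1 s2 s3].
pose c (x : nat -> edge E) i := if i is j.+1 then x j else e.
suff h : c r = c r' by apply/funext => i; exact: (congr1 (fun x => x i.+1) h).
by apply: uu; split=> //; case.
Qed.

(** Both edges prolong to rays with the same source, and these coincide by [ray_unique]. *)
Lemma on_ray_edge_unique e f : on_ray (rng e) -> on_ray (rng f) -> src e = src f -> e = f.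
Proof.
move=> ie jf ef.
have [mu [m1 m2 m3] _] := on_ray_ray ie; have [nu [n1 n2 n3] _] := on_ray_ray jf.
pose c e0 (x : nat -> edge E) i := if i is j.+1 then x j else e0.
suff h : c e mu = c f nu by exact: (congr1 (fun x => x 0%N) h).
apply: (ray_unique (anchored_src ie)); split=> //; case=> //=; exact: on_ray_notin.
Qed.

Lemma terminating_sibling e f : on_ray (rng e) -> f \in out (src e) -> f != e -> terminating G0 (rng f).
Proof.
move=> ie fo fe; apply: on_rayN; apply: contra fe => jf; apply/eqP.
by apply: on_ray_edge_unique => //; exact: out_src.
Qed.

Definition exits_at g e : seq (seq (edge E)) :=
  [seq g ++ f :: p | f <- [seq f <- out (src e) | f != e], p <- hit_set (rng f)].

Fixpoint off_path g0 g : seq (seq (edge E)) :=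
  if g is e :: g' then exits_at g0 e ++ off_path (rcons g0 e) g' else [::].

Lemma off_path_rcons g0 g e :
  off_path g0 (rcons g e) = off_path g0 g ++ exits_at (g0 ++ g) e.
Proof.
elim: g g0 => [|f g IH] g0 /=; first by rewrite !cats0.
by rewrite IH catA cat_rcons.
Qed.

(* The paths of [first_return (anchor_base v)] that leave the anchoring path of [v]. *)
Definition anchor_exits v := off_path [::] (anchor_edges v).

Lemma anchor_exits_G0 v : v \in G0 -> anchor_exits v = [::].
Proof. by move=> v0; rewrite /anchor_exits anchor_path_G0. Qed.

Lemma anchor_exits_rng e : on_ray (rng e) ->
  anchor_exits (rng e) = anchor_exits (src e) ++ exits_at (anchor_edges (src e)) e.
Proof. by move=> ie; rewrite /anchor_exits anchor_path_rng// off_path_rcons. Qed.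

Lemma mem_exits_at g e b : on_ray (rng e) -> b \in exits_at g e ->
  exists f p, [/\ b = g ++ f :: p, src f = src e, f != e & hit (rng f) p].
Proof.
move=> ie /allpairsPdep[f [p [+ hp ->]]]; rewrite mem_filter => /andP[fe fo].
exists f, p; split=> //; first exact: out_src.
by rewrite -(mem_hit_set sing_G0 _ (terminating_sibling ie fo fe)).
Qed.

Lemma prefix_cat2 g e f p : prefix (rcons g e) (g ++ f :: p) -> e = f.
Proof. by elim: g => [|h g IH] /=; rewrite ?eqxx //= prefix0s andbT => /eqP. Qed.

Lemma prefix_rcons_l g e q : prefix (rcons g e) q -> prefix g q.
Proof. by move=> /prefixP[s ->]; rewrite cat_rcons; exact: prefix_prefix. Qed.

(** The prefix clause drives the induction: the exits added at the last edge e extend the anchor of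
    [src e], the earlier ones do not, so the two lists are disjoint. *)
Lemma anchor_exits_spec v : anchored v -> uniq (anchor_exits v) /\
  forall b, b \in anchor_exits v -> first_return (anchor_base v) b && ~~ prefix (anchor_edges v) b.
Proof.
move=> va; have [n sz] := ubnP (size (anchor_edges v)).
elim: n v va sz => // n IH v va sz.
have [v0|v0] := boolP (v \in G0); first by rewrite anchor_exits_G0.
have iv : on_ray v by move: va; rewrite /anchored (negPf v0).
have [e ev] : exists e, rng e = v.
  move: (anchored_end va) (anchored_base va); case/lastP: (anchor_edges v) => [|g e].
    by rewrite /path_end /= => ->; rewrite (negPf v0).
  by rewrite path_end_rcons => ? _; exists e.
rewrite -ev in iv sz *; have sa := anchored_src iv.
rewrite anchor_exits_rng// !anchor_path_rng//.
have [|un h] := IH (src e) sa.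
  by move: sz; rewrite anchor_path_rng// size_rcons ltnS.
split.
  rewrite cat_uniq un /=; apply/andP; split.
    apply/hasPn => b /(mem_exits_at iv)[f [p [-> _ _ _]]].
    by apply/negP => /h /andP[_]; rewrite prefix_prefix.
  apply: allpairs_uniq_dep.
  - by rewrite filter_uniq// fset_uniq.
  - by move=> f _; exact: fset_uniq.
  - move=> [f p] [f' p'] _ _ /= /eqP.
    by rewrite eqseq_cat// eqxx /= => /eqP[-> ->].
move=> b; rewrite mem_cat => /orP[/h/andP[-> hb]|/(mem_exits_at iv)].
  by apply: contra hb; exact: prefix_rcons_l.
move=> [f [p [-> fs fe hp]]]; apply/andP; split.
  apply: first_return_cat => //; first exact: anchored_path.
    exact: anchored_notin.
  by rewrite anchored_end.
by apply: contra fe => /prefix_cat2 ->.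
Qed.

Lemma is_path_mkseq (F : digraph) (mu : nat -> edge F) n : infinite_path mu ->
  is_path (src (mu 0%N)) (mkseq mu n).
Proof.
move=> mup; rewrite /mkseq; move: 0%N => i.
by elim: n i => //= n IH i; rewrite eqxx mup IH.
Qed.

Lemma comp_path_acyclic (mu : nat -> edge E) : infinite_path mu ->
  (forall i, src (mu i) \notin G0) -> acyclic_path mu.
Proof.
move=> mup /(lift_path mup)[nu nup nuE] a i ha.
have nui : infinite_path (fun k => nu (i + k)%N) by move=> k; rewrite addnS; exact: nup.
apply/negP => /and3P[n0 ac au_]; pose b : Defs.fpath (comp_graph G0) :=
  exist _ (src (nu (i + 0)%N), mkseq (fun k => nu (i + k)%N) (plen a)) (is_path_mkseq (plen a) nui).
have bE : map val (pedges b) = pedges a.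
  by rewrite ha -map_comp; apply: eq_map => k /=; rewrite nuE.
have srcE : map val (map (@src (comp_graph G0)) (pedges b)) = map (@src E) (pedges a).
  by rewrite -bE -!map_comp.
have rngE : map val (map (@rng (comp_graph G0)) (pedges b)) = map (@rng E) (pedges a).
  by rewrite -bE -!map_comp.
have psrcE : val (psrc b) = psrc a.
  rewrite [LHS](_ : _ = src (mu i)); last by rewrite -nuE /psrc /= addn0.
  move: (valP a) n0 ha; rewrite /plen /psrc /pedges; case: (val a) => [v [|e p]] //=.
  by move=> /andP[/eqP <- _] _ [-> _]; rewrite addn0.
have := acyclic_T b; rewrite /is_cycle => /negP; apply; apply/and3P; split.
- by rewrite /plen size_mkseq.
- apply/eqP/val_inj; rewrite psrcE (eqP ac) /prng -psrcE -rngE.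
  by rewrite last_map.
- by rewrite -(map_inj_uniq val_inj) srcE.
Qed.

Definition return_set v : {fset seq (edge E)} := fset_set [set p | first_return v p].

(* Otherwise the ray starting with [e] has only finitely many exits, hence a tail. *)
Lemma infinite_returns e : src e \in G0 -> on_ray (rng e) ->
  infinite_set [set p | first_return (src e) p].
Proof.
move=> s0 ie fin; have [mu [mup mu0 mun] mui] := on_ray_ray ie.
pose rho i := if i is j.+1 then mu j else e.
have rp : infinite_path rho by case.
have ri i : on_ray (rng (rho i)) by case: i => //= i; exact: (mui i).2.
have rs i : anchored (src (rho i)) by exact: anchored_src.
have [N hN] : exists N, forall p, first_return (src e) p -> (size p <= N)%N.
  exists (\max_(p <- return_set (src e)) size p) => p fp.
  by apply: (@leq_bigmax_seq _ _ xpredT) => //; rewrite in_fset_set// inE.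
have end_rho i : path_end (src e) (mkseq rho i) = src (rho i).
  case: i => [|i]; first by [].
  by rewrite mkseqS path_end_rcons rp.
(* Another edge f would end at a terminating vertex and complete to a return with more than N
   edges. *)
have one i f : (N <= i)%N -> src f = src (rho i) -> f = rho i.
  move=> Ni fs; apply/eqP/negPn/negP => fn.
  have wfr : terminating G0 (rng f).
    apply: on_rayN; apply/negP => jf; move/eqP: fn; apply.
    by apply: on_ray_edge_unique.
  have [p hp] := terminating_hit sing_G0 wfr.
  have : first_return (src e) (mkseq rho i ++ f :: p).
    apply: first_return_cat => //; first exact: (is_path_mkseq i rp).
      by apply/allP => _ /mapP[k _ ->]; exact: on_ray_notin.
    by rewrite end_rho.
  move=> /hN; rewrite size_cat size_mkseq /= addnS leqNgt => /negP; apply.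
  by rewrite ltnS (leq_trans Ni)// leq_addr.
(* The shift is [N.+1] and not N, so that all sources lie outside G0 even for N = 0 and acyclicity
   of T applies. *)
apply: no_tails; exists (fun i => rho (N.+1 + i)%N); split.
- by move=> i; rewrite addnS; exact: rp.
- apply: comp_path_acyclic => i; first by rewrite addnS; exact: rp.
  by rewrite addSn -rp; exact: on_ray_notin.
- move=> i; apply/seteqP; split=> f /=; last by move=> ->.
  by apply: (one (N.+1 + i)%N); rewrite addSn ltnW// ltnS leq_addr.
- move=> i; apply/seteqP; split=> f /=; last by move=> ->.
  by move=> ef; apply/esym/on_ray_rng_inj => //; exact: (ri (N.+1 + i)%N).
Qed.

(** A nonsingular vertex of G has finitely many returns, so by [infinite_returns] none of its edges
    in E leads to a ray. Each edge then begins some return, which bounds the number of edges. *)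
Lemma contr_nonsingular_out v (w : vert (contr_graph G0)) : val w = v ->
  ~ singularity w ->
  [/\ finite_set [set p | first_return v p], finite_set (@src E @^-1` [set v]) ,
     (exists e, src e = v) & forall e, src e = v -> terminating G0 (rng e)].
Proof.
move=> wv nsing; have v0 : v \in G0 by rewrite -wv; exact: (valP w).
have fin : finite_set [set p | first_return v p].
  apply: contrapT => inf; apply: nsing; right => finw; apply: inf.
  apply: (@sub_finite_set _ _ ((fun b : contr_edge G0 => pedges (val b)) @`
    (@src (contr_graph G0) @^-1` [set w]))); last exact: finite_image.
  move=> p fp; have [b bv bp] := contr_edge_exists v0 fp.
  by exists b => //=; apply: val_inj; rewrite /= bv wv.
have wfe e : src e = v -> terminating G0 (rng e).
  move=> ev; apply: on_rayN; apply/negP => ie; move: fin; rewrite -ev.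
  by apply: infinite_returns => //; rewrite ev.
split=> //.
  have [[e0 _]|nex] := pselect (exists e0, src e0 = v); last first.
    by apply: (@sub_finite_set _ _ set0) => // e ev; apply: nex; exists e.
  apply: (@sub_finite_set _ _ (head e0 @` [set p | first_return v p])).
    move=> e ev; have [p hp] := terminating_hit sing_G0 (wfe e ev).
    by exists (e :: p) => //=; rewrite ev eqxx.
  exact: finite_image.
apply: contrapT => nex; apply: nsing; left; rewrite /sink -subset0 => b /= bw.
move: (valP b); rewrite first_return_contr => /andP[_].
case hb : (pedges (val b)) => [|e p] //= /andP[/eqP es _]; apply: nex.
by exists e; rewrite es -wv -bw.
Qed.

Lemma return_set_perm v : finite_set [set p | first_return v p] ->
  finite_set (@src E @^-1` [set v]) -> (forall e, src e = v -> terminating G0 (rng e)) ->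
  perm_eq (return_set v) [seq e :: p | e <- out v, p <- hit_set (rng e)].
Proof.
move=> fr fo we; apply: uniq_perm; first exact: fset_uniq.
  by apply: allpairs_uniq_dep => [|e _|[e p] [f q] _ _ /= [-> ->]]//; exact: fset_uniq.
move=> p; rewrite in_fset_set//; apply/idP/allpairsPdep.
  rewrite inE; case: p => [|e p] //= /andP[/eqP ev hp]; exists e, p.
  by rewrite (mem_out _ fo) ev eqxx (mem_hit_set sing_G0 _ (we e ev)).
move=> [e [q [eo qh ->]]]; rewrite inE /=; have ev := out_src eo.
by rewrite ev eqxx -(mem_hit_set sing_G0 _ (we e ev)).
Qed.

End Anchors.

(** * Cuntz-Krieger families and paths *)

Section CKFamily.
Variables (K : numClosedFieldType) (F : digraph) (A : cstarType K).
Variables (P : vert F -> A) (S : edge F -> A).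

(** Orthogonality is asked only for edges with a common source, the vertex projections separating
    the others. That [S e] is a partial isometry follows because S_e - S_e P vanishes for P = S_e^*
    S_e. *)
Lemma ck_familyI :
  (forall v, is_proj (P v)) -> (forall v w, v <> w -> P v *c P w = 0) ->
  (forall e, adj (S e) *c S e = P (rng e)) ->
  (forall e f, e <> f -> src e = src f -> adj (S e) *c S f = 0) ->
  (forall e, P (src e) *c S e = S e) ->
  (forall v, ~ singularity v ->
     P v = \sum_(e <- fset_set (@src F @^-1` [set v])) S e *c adj (S e)) ->
  ck_family P S.
Proof.
move=> hp ho hs hr hl hsum.
have orth e f : e <> f -> adj (S e) *c S f = 0.
  move=> ef; have [sef|/eqP sef] := eqVneq (src e) (src f); first exact: hr.
  by rewrite -(hl e) -(hl f) cadjM (hp _).1 -cmulA (cmulA (P _)) ho// cmul0l cmul0r.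
split=> //.
- move=> e; rewrite /is_pisometry -cmulA hs; apply/eqP; rewrite -subr_eq0; apply/eqP.
  apply: cmul_adj_eq0; have [sp pp] := hp (rng e).
  rewrite cadjB cadjM sp cmulBl !cmulBr -!cmulA (cmulA (adj _) _ (P _)) hs !pp.
  by rewrite !subrr.
- by move=> e f ef; rewrite /proj_orth -cmulA (cmulA (adj _)) orth// cmul0l cmul0r.
- move=> e; rewrite /proj_le; apply: cadj_inj.
  by rewrite !cadjM cadjK (hp _).1 cmulA hl.
- move=> v nv; rewrite hsum// fsbig_finite//; apply: contrapT => inf; apply: nv.
  by right.
Qed.

Hypothesis ck : ck_family P S.

Lemma ckP_adj v : adj (P v) = P v. Proof. by case: (ck_proj ck v). Qed.
Lemma ckPP v : P v *c P v = P v. Proof. by case: (ck_proj ck v). Qed.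
Lemma ckP_orth v w : v <> w -> P v *c P w = 0. Proof. exact: (ck_orth ck). Qed.

Lemma ckS_rng e : S e *c P (rng e) = S e.
Proof. by rewrite -(ck_source ck) cmulA; exact: (ck_pisometry ck). Qed.

Lemma ckS_src e : P (src e) *c S e = S e.
Proof.
have := ck_le ck e; rewrite /proj_le => /(congr1 (@adj _ _)).
rewrite !cadjM cadjK ckP_adj => h.
by rewrite -{1}(ck_pisometry ck e) cmulA h; exact: (ck_pisometry ck).
Qed.

Lemma ckS_orth e f : e <> f -> adj (S e) *c S f = 0.
Proof.
move=> ef; rewrite -(ckS_rng f) -(ck_source ck f) -[S e](ckS_rng e) -(ck_source ck e).
rewrite !cadjM cadjK.
rewrite (_ : _ *c _ = adj (S e) *c (S e *c adj (S e) *c (S f *c adj (S f))) *c S f).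
  by rewrite (ck_ranges ck ef) cmul0r cmul0l.
by rewrite !cmulA.
Qed.

Lemma ck_sum_seq v : ~ singularity v ->
  P v = \sum_(e <- out v) S e *c adj (S e).
Proof.
move=> nv; rewrite (ck_sum ck nv) fsbig_finite//; apply: contrapT => inf; apply: nv.
by right.
Qed.

Fixpoint path_elt (v : vert F) (p : seq (edge F)) : A :=
  if p is e :: q then S e *c path_elt (rng e) q else P v.

Lemma path_elt_src v p : is_path v p -> P v *c path_elt v p = path_elt v p.
Proof.
case: p => [|e p] /=; first by rewrite ckPP.
by move=> /andP[/eqP <- _]; rewrite cmulA ckS_src.
Qed.

Lemma path_elt_end v p : path_elt v p *c P (path_end v p) = path_elt v p.
Proof. by elim: p v => [|e p IH] v /=; rewrite ?ckPP// -cmulA path_end_cons IH. Qed.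

Lemma path_elt_cat v p q : is_path (path_end v p) q ->
  path_elt v (p ++ q) = path_elt v p *c path_elt (path_end v p) q.
Proof.
elim: p v => [|e p IH] v /=; first by move=> ?; rewrite path_elt_src.
by rewrite path_end_cons => h; rewrite IH// cmulA.
Qed.

Lemma path_elt_rcons v p e : is_path v (rcons p e) ->
  path_elt v (rcons p e) = path_elt v p *c S e.
Proof.
rewrite is_path_rcons => /andP[_ /eqP se].
by rewrite -cats1 path_elt_cat/= ?se ?eqxx// ckS_rng.
Qed.

Lemma path_elt_adj_mul v p : is_path v p ->
  adj (path_elt v p) *c path_elt v p = P (path_end v p).
Proof.
elim: p v => [|e p IH] v /=; first by rewrite ckP_adj ckPP.
move=> /andP[_ hp]; rewrite cadjM -cmulA (cmulA (adj (S e))) (ck_source ck).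
by rewrite path_elt_src// IH.
Qed.

Lemma path_elt_orth v p q : is_path v p -> is_path v q ->
  ~~ prefix p q -> ~~ prefix q p -> adj (path_elt v p) *c path_elt v q = 0.
Proof.
elim: p v q => [|e p IH] v [|f q] //= /andP[_ pp] /andP[_ pq].
have [ef|/eqP nef] := eqVneq e f => /= h1 h2; last first.
  by rewrite cadjM -cmulA (cmulA (adj (S e))) ckS_orth// cmul0l cmul0r.
rewrite -ef in pq *.
by rewrite cadjM -cmulA (cmulA (adj (S e))) (ck_source ck) path_elt_src ?IH.
Qed.

End CKFamily.

(** * The family of the contracted graph *)

Section ContractionFamily.
Variables (K : numClosedFieldType) (E : digraph) (G0 : {pred vert E}).
Hypothesis H : contractible G0.
Variables (A : cstarType K) (P : vert E -> A) (S : edge E -> A).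
Hypothesis ck : ck_family P S.
Local Notation sp := (path_elt P S).
Local Notation hit_set := (hit_set G0).

Lemma nonsing_notin v : v \notin G0 -> ~ singularity v.
Proof. by move=> v0 sv; move: v0; rewrite (contr_sing H). Qed.

Lemma hit_set_G0 v : v \in G0 -> perm_eq (hit_set v) [:: [::]].
Proof.
move=> v0; apply: uniq_perm; [exact: fset_uniq|by []|] => p.
by rewrite (mem_hit_set (contr_sing H) _ (terminating_G0 v0)) hit_G0// inE.
Qed.

Lemma path_elt_hit_orth v p q : hit G0 v p -> hit G0 v q -> p <> q ->
  adj (sp v p) *c sp v q = 0.
Proof.
move=> hp hq pq; apply: (path_elt_orth ck); [exact: hit_path hp|exact: hit_path hq| |].
  apply/negP => /prefixP[r qr]; apply: pq; rewrite qr (@hit_prefix_free _ G0 v p r) ?cats0//.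
  by rewrite -qr.
apply/negP => /prefixP[r pr]; apply: pq; rewrite pr (@hit_prefix_free _ G0 v q r) ?cats0//.
by rewrite -pr.
Qed.

Lemma path_elt_return_orth v p q : first_return G0 v p -> first_return G0 v q -> p <> q ->
  adj (sp v p) *c sp v q = 0.
Proof.
case: p q => [|e p] [|f q] //= /andP[_ hp] /andP[_ hq] pq.
rewrite cadjM -cmulA (cmulA (adj (S e))).
have [ef|/eqP nef] := eqVneq e f; last by rewrite (ckS_orth ck)// cmul0l cmul0r.
rewrite -ef in hq pq *; rewrite (ck_source ck) (path_elt_src ck) ?(hit_path hq)//.
by apply: path_elt_hit_orth => // pq'; apply: pq; rewrite pq'.
Qed.

(** The summation relation is iterated until every path has reached G0; the vertices expanded on the
    way lie outside G0 and are therefore nonsingular. *)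
Lemma terminating_sum v : terminating G0 v -> P v = \sum_(p <- hit_set v) sp v p *c adj (sp v p).
Proof.
elim=> {}v wr IH; have [v0|v0] := boolP (v \in G0).
  have -> : \sum_(p <- hit_set v) sp v p *c adj (sp v p) = \sum_(p <- [:: [::]]) sp v p *c adj (sp v p).
    by apply: perm_big; exact: hit_set_G0.
  by rewrite big_seq1 /= (ckP_adj ck) (ckPP ck).
have wv' : terminating G0 v by constructor.
rewrite (perm_big _ (hit_set_perm (contr_sing H) v0 wv')) big_allpairs_dep /=.
rewrite (ck_sum_seq ck (nonsing_notin v0)) big_seq [RHS]big_seq.
apply: eq_bigr => e eo; have ev := out_src eo.
rewrite -[S e in LHS](ckS_rng ck) cadjM (ckP_adj ck) -cmulA (cmulA (P _)) (ckPP ck).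
rewrite {1}(IH v0 e ev) cmulA cmul_sumr cmul_suml; apply: eq_bigr => p _.
by rewrite cadjM !cmulA.
Qed.

Definition cproj (w : vert (contr_graph G0)) : A := P (val w).
Definition ciso (b : edge (contr_graph G0)) : A := sp (psrc (val b)) (pedges (val b)).

Lemma contr_return (b : contr_edge G0) :
  [/\ psrc (val b) \in G0, first_return G0 (psrc (val b)) (pedges (val b)) &
      prng (val b) = path_end (psrc (val b)) (pedges (val b))].
Proof. by move: (valP b); rewrite first_return_contr => /andP[]. Qed.

Lemma contr_edge_eq (b c : contr_edge G0) :
  psrc (val b) = psrc (val c) -> pedges (val b) = pedges (val c) -> b = c.
Proof.
move=> h1 h2; apply: val_inj; apply: val_inj.
by rewrite [LHS]surjective_pairing [RHS]surjective_pairing -/(psrc _) -/(pedges _) h1 h2.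
Qed.

(** Edges of G are regrouped by the first edge of the path. An arbitrary f lets this serve both
    C*(E) and the algebra B of the inflation. *)
Lemma contr_sum (B : nmodType) (f : seq (edge E) -> B) (w : vert (contr_graph G0)) :
  ~ singularity w ->
  \sum_(b <- out w) f (pedges (val b)) =
  \sum_(e <- out (val w)) \sum_(p <- hit_set (rng e)) f (e :: p).
Proof.
move=> nw; have [fr fo _ we] := contr_nonsingular_out H erefl nw.
transitivity (\sum_(p <- [seq e :: p | e <- out (val w), p <- hit_set (rng e)]) f p); last first.
  by rewrite big_allpairs_dep.
rewrite -(perm_big _ (return_set_perm H fr fo we)).
rewrite -(big_map (fun b : contr_edge G0 => pedges (val b)) xpredT f).
have fw : finite_set (@src (contr_graph G0) @^-1` [set w]).
  by apply: contrapT => inf; apply: nw; right.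
apply: perm_big; apply: uniq_perm; last 1 first.
- move=> p; rewrite in_fset_set//; apply/mapP/idP.
    move=> [b]; rewrite (mem_out _ fw) => /eqP bw ->; rewrite inE /=.
    by have [_ + _] := contr_return b; rewrite -bw.
  rewrite inE => fp; have [b b1 b2] := contr_edge_exists (valP w) fp.
  by exists b => //; rewrite (mem_out _ fw); apply/eqP/val_inj.
- rewrite map_inj_in_uniq ?fset_uniq// => b c.
  rewrite !(mem_out _ fw) => /eqP bw /eqP cw h; apply: contr_edge_eq => //.
  by have := congr1 val bw; rewrite -cw.
exact: fset_uniq.
Qed.

(** A converse of [contr_nonsingular_out]: it makes the summation relation of a given G-family
    available where the inflated family has to satisfy one. *)
Lemma contr_nonsingular (w : vert (contr_graph G0)) :
  finite_set (@src E @^-1` [set val w]) -> (exists e, src e = val w) ->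
  (forall e, src e = val w -> terminating G0 (rng e)) -> ~ singularity w.
Proof.
move=> fo [e0 he0] we [sk|inf].
  have [p hp] := terminating_hit (contr_sing H) (we _ he0).
  have fp : first_return G0 (val w) (e0 :: p) by rewrite /= he0 eqxx.
  have [b bw _] := contr_edge_exists (valP w) fp.
  by have : set0 b by rewrite -sk; exact: val_inj.
apply: inf; pose f (b : contr_edge G0) := pedges (val b).
rewrite -(eq_finite_set (inj_card_eq (f := f) _)).
  apply: (@sub_finite_set _ _ [set` [seq e :: p | e <- out (val w), p <- hit_set (rng e)]]) => //.
  move=> _ [b /= bw <-]; rewrite /f; have [_ + _] := contr_return b.
  rewrite (_ : psrc (val b) = val w); last by rewrite -bw.
  case: (pedges _) => [|e p] //= /andP[/eqP ev hp]; apply/allpairsPdep; exists e, p.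
  by rewrite (mem_out _ fo) ev eqxx (mem_hit_set (contr_sing H) _ (we e ev)).
move=> b c; rewrite !inE => bw cw; apply: contr_edge_eq.
by have := congr1 val bw; rewrite -cw.
Qed.

Lemma ck_contr : ck_family cproj ciso.
Proof.
apply: ck_familyI.
- by move=> w; exact: (ck_proj ck).
- move=> v w vw; apply: (ck_orth ck) => h; apply: vw; exact: val_inj.
- move=> b; have [_ fb rb] := contr_return b.
  by rewrite (path_elt_adj_mul ck) ?(first_return_path fb)// -rb.
- move=> b c bc sbc; have [_ fb _] := contr_return b; have [_ fc _] := contr_return c.
  have sbc' : psrc (val b) = psrc (val c) by exact: (congr1 val sbc).
  rewrite /ciso -sbc' in fc *; apply: path_elt_return_orth => // h.
  by apply: bc; exact: contr_edge_eq.
- move=> b; have [_ fb _] := contr_return b.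
  by rewrite /cproj /ciso (path_elt_src ck) ?(first_return_path fb).
move=> w nw; have [fr fo [e0 he0] we] := contr_nonsingular_out H erefl nw.
pose f p := sp (val w) p *c adj (sp (val w) p).
transitivity (\sum_(b <- out w) f (pedges (val b))); last first.
  rewrite big_seq [RHS]big_seq; apply: eq_bigr => b bo.
  by rewrite /ciso /f (_ : psrc (val b) = val w)// -(out_src bo).
rewrite contr_sum// /cproj (ck_sum_seq ck).
  rewrite big_seq [RHS]big_seq; apply: eq_bigr => e eo; have ev := out_src eo.
  rewrite -[S e in LHS](ckS_rng ck) cadjM (ckP_adj ck) -cmulA (cmulA (P _)) (ckPP ck).
  rewrite {1}(terminating_sum (we e ev)) cmulA cmul_sumr cmul_suml; apply: eq_bigr => p _.
  by rewrite /f /= cadjM !cmulA.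
case=> [sv|//].
by have : set0 e0 by rewrite -sv.
Qed.

End ContractionFamily.

(** * Inflating a family of the contracted graph *)

Section Inflation.
Variables (R : realType) (E : digraph) (G0 : {pred vert E}).
Local Notation K := R[i].
Hypothesis H : contractible G0.
Variables (B : cstarType K).
Variables (Q : vert (contr_graph G0) -> B) (T : edge (contr_graph G0) -> B).
Hypothesis ckT : ck_family Q T.
Local Notation hit_set := (hit_set G0).
Local Notation on_ray := (on_ray G0).
Local Notation anchored := (anchored G0).
Local Notation anchor_base := (anchor_base G0).
Local Notation anchor_edges := (anchor_edges G0).
Local Notation anchor_exits := (anchor_exits G0).
Implicit Types (u v w : vert E) (e f : edge E) (p q : seq (edge E)).

(** The given family is extended by 0, here and in [ext_iso], so that paths can be cut and joined
    without carrying membership proofs. *)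
Definition ext_proj v : B := if insub v : option (contr_vert G0) is Some w then Q w else 0.

Definition ext_iso v p : B :=
  if insub (v, p) : option (Defs.fpath E) is Some a then
    if insub a : option (contr_edge G0) is Some b then T b else 0
  else 0.

Lemma ext_proj_val (w : contr_vert G0) : ext_proj (val w) = Q w.
Proof. by rewrite /ext_proj valK. Qed.

Lemma ext_iso_val (b : contr_edge G0) : ext_iso (psrc (val b)) (pedges (val b)) = T b.
Proof.
rewrite /ext_iso /psrc /pedges -surjective_pairing.
by rewrite (valK (val b)) (valK b).
Qed.

Lemma ext_proj_adj v : adj (ext_proj v) = ext_proj v.
Proof. by rewrite /ext_proj; case: insub => [w|]; rewrite ?(ckP_adj ckT)// cadj0. Qed.

Lemma ext_proj_idem v : ext_proj v *c ext_proj v = ext_proj v.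
Proof. by rewrite /ext_proj; case: insub => [w|]; rewrite ?(ckPP ckT)// cmul0l. Qed.

Lemma ext_proj_orth v w : v <> w -> ext_proj v *c ext_proj w = 0.
Proof.
move=> vw; rewrite /ext_proj; case: insubP => [x _ xv|]; last by rewrite cmul0l.
case: insubP => [y _ yw|]; last by rewrite cmul0r.
by apply: (ckP_orth ckT) => xy; apply: vw; rewrite -xv -yw xy.
Qed.

Section Returns.
Variable u : vert E.
Hypothesis u0 : u \in G0.
Local Notation fr := (first_return G0 u).

Lemma returnP p : fr p -> exists b : contr_edge G0,
  [/\ psrc (val b) = u, pedges (val b) = p, ext_iso u p = T b,
      ext_proj u = Q (contr_src b) & ext_proj (path_end u p) = Q (contr_rng b)].
Proof.
move=> fp; have [b bu bp] := contr_edge_exists u0 fp; exists b; split=> //.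
- by rewrite -bu -bp ext_iso_val.
- by rewrite -ext_proj_val /= bu.
- by rewrite -ext_proj_val /= /prng bu bp.
Qed.

Lemma ext_iso_adj_mul p : fr p -> adj (ext_iso u p) *c ext_iso u p = ext_proj (path_end u p).
Proof. by move=> /returnP[b [_ _ -> _ ->]]; rewrite (ck_source ckT). Qed.

Lemma ext_iso_orth p q : fr p -> fr q -> p <> q -> adj (ext_iso u p) *c ext_iso u q = 0.
Proof.
move=> /returnP[b [_ bp -> _ _]] /returnP[c [_ cq -> _ _]] pq.
by apply: (ckS_orth ckT) => bc; apply: pq; rewrite -bp -cq bc.
Qed.

Lemma ext_proj_ext_iso p : fr p -> ext_proj u *c ext_iso u p = ext_iso u p.
Proof. by move=> /returnP[b [_ _ -> -> _]]; exact: (ckS_src ckT b). Qed.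

Lemma ext_iso_ext_proj p : fr p -> ext_iso u p *c ext_proj (path_end u p) = ext_iso u p.
Proof. by move=> /returnP[b [_ _ -> _ ->]]; exact: (ckS_rng ckT b). Qed.

Definition range_sum (s : seq (seq (edge E))) : B := \sum_(b <- s) ext_iso u b *c adj (ext_iso u b).

Lemma range_sum_adj s : adj (range_sum s) = range_sum s.
Proof. by rewrite cadj_sum; apply: eq_bigr => b _; rewrite cadjM cadjK. Qed.

Lemma range_sum_ext_iso s p : uniq s -> {in s, forall b, fr b} -> fr p ->
  range_sum s *c ext_iso u p = if p \in s then ext_iso u p else 0.
Proof.
move=> us hs fp; rewrite cmul_suml.
have h b : b \in s -> ext_iso u b *c adj (ext_iso u b) *c ext_iso u p = if b == p then ext_iso u p else 0.
  move=> bs; rewrite -cmulA; have [->|/eqP bp] := eqVneq b p.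
    by rewrite ext_iso_adj_mul// ext_iso_ext_proj.
  by rewrite ext_iso_orth ?cmul0r//; exact: hs.
rewrite big_seq (eq_bigr _ h) -big_seq -big_mkcond /=.
have [ps|ps] := boolP (p \in s); first by rewrite -big_filter filter_pred1_uniq// big_seq1.
by rewrite big_seq_cond big1// => b /andP[bs /eqP bp]; move: ps; rewrite -bp bs.
Qed.

Lemma ext_proj_range_sum s : {in s, forall b, fr b} -> ext_proj u *c range_sum s = range_sum s.
Proof.
move=> hs; rewrite cmul_sumr big_seq [RHS]big_seq; apply: eq_bigr => b bs.
by rewrite cmulA ext_proj_ext_iso//; exact: hs.
Qed.

Lemma range_sum_ext_proj s : {in s, forall b, fr b} -> range_sum s *c ext_proj u = range_sum s.
Proof.
by move=> hs; apply: cadj_inj; rewrite cadjM range_sum_adj ext_proj_adj ext_proj_range_sum.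
Qed.

Lemma range_sum_mul s s' : uniq s -> {in s, forall b, fr b} -> {in s', forall b, fr b} ->
  {subset s' <= s} -> range_sum s *c range_sum s' = range_sum s'.
Proof.
move=> us hs hs' ss; rewrite cmul_sumr big_seq [RHS]big_seq; apply: eq_bigr => b bs.
by rewrite cmulA range_sum_ext_iso ?ss//; exact: hs'.
Qed.

End Returns.

(** Stands for g g^* with g the anchor of [v], although B contains no such g; [anchor_range]
    confirms this inside C*(E). *)
Definition anchor_proj v : B := ext_proj (anchor_base v) - range_sum (anchor_base v) (anchor_exits v).

Lemma anchor_proj_G0 v : v \in G0 -> anchor_proj v = ext_proj v.
Proof.
move=> v0; rewrite /anchor_proj (anchor_exits_G0 H v0) (anchor_path_G0 H v0).
by rewrite /range_sum big_nil subr0.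
Qed.

Lemma anchor_exits_return v : anchored v -> {in anchor_exits v, forall b, first_return G0 (anchor_base v) b}.
Proof. by move=> va b bv; have [_ /(_ b bv)/andP[]] := anchor_exits_spec H va. Qed.

Lemma anchor_exits_uniq v : anchored v -> uniq (anchor_exits v).
Proof. by move=> va; have [] := anchor_exits_spec H va. Qed.

Lemma anchor_proj_adj v : adj (anchor_proj v) = anchor_proj v.
Proof. by rewrite /anchor_proj cadjB ext_proj_adj range_sum_adj. Qed.

Lemma anchor_proj_idem v : anchored v -> anchor_proj v *c anchor_proj v = anchor_proj v.
Proof.
move=> va; have u0 := anchored_base H va.
have hv := anchor_exits_return va; have uv := anchor_exits_uniq va.
rewrite {1 2}/anchor_proj cmulBl !cmulBr ext_proj_idem ext_proj_range_sum// range_sum_ext_proj//.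
by rewrite range_sum_mul// subrr subr0.
Qed.

Lemma anchor_proj_ext_iso v b : anchored v -> first_return G0 (anchor_base v) b ->
  anchor_proj v *c ext_iso (anchor_base v) b = if b \in anchor_exits v then 0 else ext_iso (anchor_base v) b.
Proof.
move=> va fb; have u0 := anchored_base H va.
have hv := anchor_exits_return va; have uv := anchor_exits_uniq va.
by rewrite /anchor_proj cmulBl ext_proj_ext_iso// range_sum_ext_iso//; case: ifP => _; rewrite ?subrr ?subr0.
Qed.

Lemma anchor_proj_rng e : on_ray (rng e) ->
  anchor_proj (rng e) = anchor_proj (src e)
    - range_sum (anchor_base (src e)) (exits_at G0 (anchor_edges (src e)) e).
Proof.
move=> ie; rewrite /anchor_proj (anchor_exits_rng H ie) (anchor_path_rng H ie) /range_sum big_cat.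
by rewrite opprD addrA.
Qed.

Lemma exits_at_mem v f e p : anchored v -> src f = v -> src e = v -> f != e ->
  hit G0 (rng f) p -> terminating G0 (rng f) -> finite_set (@src E @^-1` [set v]) ->
  anchor_edges v ++ f :: p \in exits_at G0 (anchor_edges v) e.
Proof.
move=> va fv ev fe hp wfr fin; apply/allpairsPdep; exists f, p; split=> //.
  by rewrite mem_filter fe ev (mem_out _ fin) fv eqxx.
by rewrite (mem_hit_set (contr_sing H) _ wfr).
Qed.

Lemma anchor_proj_src_rng e : on_ray (rng e) ->
  anchor_proj (src e) *c anchor_proj (rng e) = anchor_proj (rng e).
Proof.
move=> ie; have sa := anchored_src ie; have u0 := anchored_base H sa.
have ra : anchored (rng e) by exact: on_ray_anchored.
have hr := anchor_exits_return ra; have ur := anchor_exits_uniq ra.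
rewrite (anchor_path_rng H ie) (anchor_exits_rng H ie) in hr; rewrite (anchor_exits_rng H ie) cat_uniq in ur.
case/and3P: ur => _ /hasPn dis _.
rewrite anchor_proj_rng// cmulBr anchor_proj_idem// /range_sum cmul_sumr; congr (_ - _).
rewrite big_seq [RHS]big_seq; apply: eq_bigr => b bb.
rewrite cmulA anchor_proj_ext_iso//; last by apply: hr; rewrite mem_cat bb orbT.
by rewrite (negPf (dis _ bb)).
Qed.

Lemma anchored_return v e p : anchored v -> src e = v -> hit G0 (rng e) p ->
  first_return G0 (anchor_base v) (anchor_edges v ++ e :: p).
Proof.
move=> va ev hp; apply: first_return_cat => //.
- exact: (anchored_path H va).
- exact: (anchored_notin H va).
- by rewrite (anchored_end H va).
Qed.

Lemma anchor_proj_ext_exit v e p : anchored v -> src e = v -> hit G0 (rng e) p ->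
  anchor_proj v *c ext_iso (anchor_base v) (anchor_edges v ++ e :: p)
  = ext_iso (anchor_base v) (anchor_edges v ++ e :: p).
Proof.
move=> va ev hp; rewrite anchor_proj_ext_iso//; last exact: anchored_return.
case: ifP => // bv; have [_ /(_ _ bv)/andP[_]] := anchor_exits_spec H va.
by rewrite prefix_prefix.
Qed.

Lemma anchor_proj_tr_off e f p : on_ray (rng e) -> src f = src e -> f != e -> hit G0 (rng f) p ->
  terminating G0 (rng f) ->
  anchor_proj (rng e) *c ext_iso (anchor_base (src e)) (anchor_edges (src e) ++ f :: p) = 0.
Proof.
move=> ie fe nfe hp wfr; have sa := anchored_src ie.
have ra : anchored (rng e) by exact: on_ray_anchored.
have := anchored_return sa fe hp; rewrite -(anchor_path_rng H ie).1 => fr.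
rewrite anchor_proj_ext_iso// (anchor_exits_rng H ie) mem_cat exits_at_mem ?orbT//.
exact: (on_ray_finite H ie).
Qed.

(* All vertices of [G0] share the index 0, since their projections are already
   orthogonal in [B]; thus [B] itself sits in the corner [mx_unit 0 0]. *)
Definition idx v p : nat := if v \in G0 then 0%N else (choice.pickle (v, p)).+1.

Lemma idx_inj v w p q : v \notin G0 -> idx v p = idx w q -> v = w /\ p = q.
Proof.
rewrite /idx => /negPf ->; case: ifP => // _ [] /(pcan_inj choice.pickleK) [-> ->].
by [].
Qed.

Local Notation Mx := (adjointable (l2_module B)).
Local Notation mu := (@mx_unit R B).

Definition infl_proj v : Mx :=
  if anchored v then mu (idx v [::]) (idx v [::]) (anchor_proj v)
  else \sum_(p <- hit_set v) mu (idx v p) (idx v p) (ext_proj (path_end v p)).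

(** A cell is the part of S_e on the coordinate p of [rng e]. At an unanchored source, e merely
    relabels p as e :: p. An anchored source has a single coordinate, where the return made of the
    anchor, e and p acts through T. *)
Definition infl_cell_row e p := if anchored (src e) then idx (src e) [::] else idx (src e) (e :: p).

Definition infl_cell_elt e p :=
  if anchored (src e) then ext_iso (anchor_base (src e)) (anchor_edges (src e) ++ e :: p)
  else ext_proj (path_end (rng e) p).

Definition infl_cell e p : Mx := mu (infl_cell_row e p) (idx (rng e) p) (infl_cell_elt e p).

(** Along a ray, S_e includes the projection of [rng e] in that of [src e]; [anchor_proj_src_rng]
    states that it is a subprojection. *)
Definition infl_iso e : Mx :=
  if on_ray (rng e) then mu (idx (src e) [::]) (idx (rng e) [::]) (anchor_proj (rng e))
  else \sum_(p <- hit_set (rng e)) infl_cell e p.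

Lemma unanchored v : ~~ anchored v -> v \notin G0 /\ terminating G0 v.
Proof. by rewrite negb_or => /andP[v0 /on_rayN]. Qed.

(** The two clauses of [infl_proj] agree on G0, where the only hitting path is empty and there are
    no exits. *)
Lemma infl_proj_terminating v : terminating G0 v ->
  infl_proj v = \sum_(p <- hit_set v) mu (idx v p) (idx v p) (ext_proj (path_end v p)).
Proof.
move=> wv; rewrite /infl_proj; case: ifP => // /orP[v0|/on_rayP//].
by rewrite (perm_big _ (hit_set_G0 H v0)) big_seq1 anchor_proj_G0.
Qed.

Lemma infl_cell_adj_mul e p f q : src e = src f -> terminating G0 (rng e) -> terminating G0 (rng f) ->
  hit G0 (rng e) p -> hit G0 (rng f) q ->
  adj (infl_cell e p) *c infl_cell f q = if e :: p == f :: q then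
    mu (idx (rng e) p) (idx (rng e) p) (ext_proj (path_end (rng e) p)) else 0.
Proof.
move=> ef we wfr hp hq; rewrite /infl_cell mx_unit_adj mx_unitM /infl_cell_row /infl_cell_elt -ef.
have [sa|/unanchored[s0 _]] := boolP (anchored (src e)).
  rewrite eqxx; case: eqP => [[<- <-]|ne].
    rewrite ext_iso_adj_mul ?(anchored_base H sa)//; last exact: anchored_return.
    by rewrite path_end_cat path_end_cons.
  rewrite ext_iso_orth ?mx_unit0 ?(anchored_base H sa)//; try exact: anchored_return.
  by move=> /eqP; rewrite eqseq_cat// eqxx /= => /eqP.
case: eqP => [/(idx_inj s0)[_ h]|ni].
  by rewrite h eqxx; case: h => -> ->; rewrite ext_proj_adj ext_proj_idem.
by case: eqP => // h; case: ni; rewrite h.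
Qed.

Lemma diag_sum (I : eqType) (V : nmodType) (r : seq I) (F : I -> I -> V) (G : I -> V) :
  uniq r -> {in r &, forall i j, F i j = if i == j then G i else 0} ->
  \sum_(i <- r) \sum_(j <- r) F i j = \sum_(i <- r) G i.
Proof.
move=> ur h; rewrite big_seq [RHS]big_seq; apply: eq_bigr => i ir.
rewrite big_seq (eq_bigr (fun j => if i == j then G i else 0)) => [|j jr]; last exact: h.
rewrite -big_seq -big_mkcond /= (eq_bigl (pred1 i)) => [|j]; last by rewrite eq_sym.
by rewrite -big_filter filter_pred1_uniq// big_seq1.
Qed.

Lemma infl_proj_is_proj v : is_proj (infl_proj v).
Proof.
split; rewrite /infl_proj; case: ifP => va.
- by rewrite mx_unit_adj anchor_proj_adj.
- by rewrite cadj_sum; apply: eq_bigr => p _; rewrite mx_unit_adj ext_proj_adj.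
- by rewrite mx_unitM eqxx anchor_proj_idem.
rewrite cmul_suml -[RHS](@diag_sum _ _ (hit_set v) (fun p q =>
  mu (idx v p) (idx v p) (ext_proj (path_end v p)) *c mu (idx v q) (idx v q) (ext_proj (path_end v q)))).
- by apply: eq_bigr => p _; rewrite cmul_sumr.
- exact: fset_uniq.
have [v0 _] := unanchored (negbT va).
move=> p q _ _; rewrite mx_unitM; have [->|pq] := eqVneq p q; first by rewrite eqxx ext_proj_idem.
by case: eqP => // /(idx_inj v0)[_ h]; rewrite h eqxx in pq.
Qed.

(** Indices separate distinct vertices unless both lie in G0, where the projections in B are
    orthogonal. *)
Lemma infl_proj_orth v w : v <> w -> infl_proj v *c infl_proj w = 0.
Proof.
move=> vw; pose idx_support x (U : Mx) := exists (r : seq (seq (edge E))) (b : seq (edge E) -> B),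
  U = \sum_(p <- r) mu (idx x p) (idx x p) (b p) /\ (x \in G0 -> forall p, b p = ext_proj x).
have sup x : idx_support x (infl_proj x).
  rewrite /idx_support /infl_proj; case: ifP => [|/negbT/unanchored[x0 _]].
    move=> xa; exists [:: [::]], (fun=> anchor_proj x); rewrite big_seq1; split=> // x0 _.
    exact: anchor_proj_G0.
  by exists (hit_set x), (fun p => ext_proj (path_end x p)); split=> //; rewrite (negPf x0).
have [r [b [-> hb]]] := sup v; have [s [c [-> hc]]] := sup w.
rewrite cmul_suml big1// => p _; rewrite cmul_sumr big1// => q _; rewrite mx_unitM.
case: eqP => // h; have [v0|v0] := boolP (v \in G0); last by case: vw; case: (idx_inj v0 h).
have [w0|w0] := boolP (w \in G0); last by case: vw; case: (idx_inj w0 (esym h)).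
by rewrite hb// hc// ext_proj_orth// mx_unit0.
Qed.

Lemma infl_iso_adj_mul e : adj (infl_iso e) *c infl_iso e = infl_proj (rng e).
Proof.
rewrite /infl_iso; case: ifP => [ie|/negbT/on_rayN we].
  have ra : anchored (rng e) by exact: on_ray_anchored.
  by rewrite mx_unit_adj mx_unitM eqxx anchor_proj_adj anchor_proj_idem// /infl_proj ra.
rewrite infl_proj_terminating// cadj_sum cmul_suml -[RHS](@diag_sum _ _ (hit_set (rng e)) (fun p q =>
  adj (infl_cell e p) *c infl_cell e q)).
- by apply: eq_bigr => p _; rewrite cmul_sumr.
- exact: fset_uniq.
move=> p q; rewrite !(mem_hit_set (contr_sing H) _ we) => hp hq.
by rewrite infl_cell_adj_mul// eqseq_cons eqxx.
Qed.

(** At most one of the two edges leads to a ray. If one does, the returns through the other are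
    exits of its range and [anchor_proj] annihilates them. *)
Lemma infl_iso_orth e f : e <> f -> src e = src f -> adj (infl_iso e) *c infl_iso f = 0.
Proof.
have half x y p : on_ray (rng x) -> y <> x -> src y = src x -> terminating G0 (rng y) ->
    p \in hit_set (rng y) ->
    adj (mu (idx (src x) [::]) (idx (rng x) [::]) (anchor_proj (rng x))) *c infl_cell y p = 0.
  move=> ix /eqP yx sxy wy; rewrite (mem_hit_set (contr_sing H) _ wy) => hp.
  rewrite /infl_cell /infl_cell_row /infl_cell_elt sxy (anchored_src ix) mx_unit_adj mx_unitM eqxx.
  by rewrite anchor_proj_adj anchor_proj_tr_off// mx_unit0.
move=> ef sef; rewrite /infl_iso; case: ifP => [ie|/negbT/on_rayN we].
  case: ifP => [jf|/negbT/on_rayN wfr]; first by case: ef; exact: (on_ray_edge_unique H ie jf).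
  by rewrite cmul_sumr big_seq big1// => p hp; apply: half => //; exact: nesym.
case: ifP => [jf|/negbT/on_rayN wfr].
  rewrite cadj_sum cmul_suml big_seq big1// => p hp; apply: cadj_inj.
  by rewrite cadjM cadjK half// cadj0.
rewrite cadj_sum cmul_suml big_seq big1// => p; rewrite (mem_hit_set (contr_sing H) _ we) => hp.
rewrite cmul_sumr big_seq big1// => q; rewrite (mem_hit_set (contr_sing H) _ wfr) => hq.
by rewrite infl_cell_adj_mul//; case: eqP => // -[ef']; case: ef.
Qed.

Lemma infl_proj_iso e : infl_proj (src e) *c infl_iso e = infl_iso e.
Proof.
have [sa|sna] := boolP (anchored (src e)).
  rewrite /infl_proj sa /infl_iso; case: ifP => [ie|/negbT/on_rayN we].
    by rewrite mx_unitM eqxx anchor_proj_src_rng.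
  rewrite cmul_sumr big_seq [RHS]big_seq; apply: eq_bigr => p.
  rewrite (mem_hit_set (contr_sing H) _ we) => hp.
  by rewrite /infl_cell /infl_cell_row /infl_cell_elt sa mx_unitM eqxx anchor_proj_ext_exit.
have [s0 ws] := unanchored sna.
have we : terminating G0 (rng e) by exact: terminating_rng ws.
have -> : infl_iso e = \sum_(p <- hit_set (rng e)) infl_cell e p.
  by rewrite /infl_iso; case: ifP => // /on_rayP.
rewrite cmul_sumr big_seq [RHS]big_seq; apply: eq_bigr => p.
rewrite (mem_hit_set (contr_sing H) _ we) => hp.
rewrite /infl_proj (negPf sna) cmul_suml /infl_cell /infl_cell_row /infl_cell_elt (negPf sna).
have eph : e :: p \in hit_set (src e) by rewrite (mem_hit_set (contr_sing H) _ ws) /= s0 eqxx.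
rewrite (bigD1_seq _ eph) ?fset_uniq//= mx_unitM eqxx path_end_cons ext_proj_idem.
rewrite big1 ?addr0// => q qp; rewrite mx_unitM.
by case: eqP => // /(idx_inj s0)[_ h]; rewrite h eqxx in qp.
Qed.

Lemma infl_iso_mul_adj e : anchored (src e) ->
  infl_iso e *c adj (infl_iso e) = mu (idx (src e) [::]) (idx (src e) [::])
   (if on_ray (rng e) then anchor_proj (rng e)
    else \sum_(p <- hit_set (rng e)) ext_iso (anchor_base (src e)) (anchor_edges (src e) ++ e :: p) *c
            adj (ext_iso (anchor_base (src e)) (anchor_edges (src e) ++ e :: p))).
Proof.
move=> sa; rewrite /infl_iso; case: ifP => [ie|/negbT/on_rayN we].
  have ra : anchored (rng e) by exact: on_ray_anchored.
  by rewrite mx_unit_adj mx_unitM eqxx anchor_proj_adj anchor_proj_idem.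
rewrite mx_unit_sum cadj_sum cmul_suml -[RHS](@diag_sum _ _ (hit_set (rng e)) (fun p q =>
  infl_cell e p *c adj (infl_cell e q))).
- by apply: eq_bigr => p _; rewrite cmul_sumr.
- exact: fset_uniq.
move=> p q; rewrite !(mem_hit_set (contr_sing H) _ we) => hp hq.
rewrite /infl_cell /infl_cell_row /infl_cell_elt sa mx_unit_adj mx_unitM.
have [->|pq] := eqVneq p q; first by rewrite eqxx.
have [r0|r0] := boolP (rng e \in G0).
  by move: hp hq pq; rewrite !hit_G0// => /eqP -> /eqP ->; rewrite eqxx.
by case: eqP => // /(idx_inj r0)[_ h]; rewrite h eqxx in pq.
Qed.

Lemma infl_sum v : ~ singularity v ->
  infl_proj v = \sum_(e <- out v) infl_iso e *c adj (infl_iso e).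
Proof.
move=> nv; have fin : finite_set (@src E @^-1` [set v]).
  by apply: contrapT => inf; apply: nv; right.
have [va|vna] := boolP (anchored v).
  pose x e := if on_ray (rng e) then anchor_proj (rng e)
    else \sum_(p <- hit_set (rng e)) ext_iso (anchor_base v) (anchor_edges v ++ e :: p)
                                     *c adj (ext_iso (anchor_base v) (anchor_edges v ++ e :: p)).
  transitivity (mu (idx v [::]) (idx v [::]) (\sum_(e <- out v) x e)); last first.
    rewrite mx_unit_sum big_seq [RHS]big_seq; apply: eq_bigr => e eo.
    have ev := out_src eo; rewrite infl_iso_mul_adj ev//.
  rewrite /infl_proj va; congr (mu _ _ _).
  (* If e leads to a ray, the projection of v is that of [rng e] plus the ranges of the exits at e,
     and these are the terms of the other edges. *)
  have [[e ev ie]|ni] := pselect (exists2 e, src e = v & on_ray (rng e)).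
    have eo : e \in out v by rewrite (mem_out _ fin) ev.
    rewrite (bigD1_seq _ eo) ?fset_uniq//= {1}/x ie anchor_proj_rng// ev.
    rewrite /range_sum big_allpairs_dep big_filter ev.
    apply/eqP; rewrite eq_sym addrAC subr_eq; apply/eqP; congr (_ + _).
    rewrite big_seq_cond [RHS]big_seq_cond; apply: eq_bigr => f /andP[fo fe].
    rewrite /x ifF//; apply/negP => jf; move/eqP: fe; apply.
    by apply: (on_ray_edge_unique H) => //; rewrite ev (out_src fo).
  (* Without such an edge v lies in G0 and is nonsingular in the contracted graph, so its relation
     in B is regrouped by first edges. *)
  have nie e : src e = v -> terminating G0 (rng e).
    by move=> ev; apply: on_rayN; apply/negP => ie; apply: ni; exists e.
  have v0 : v \in G0.
    by move: va => /orP[//|/on_ray_next[e ev ie]]; case: ni; exists e.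
  rewrite anchor_proj_G0//; pose w : vert (contr_graph G0) := exist _ v v0.
  have nw : ~ singularity w.
    apply: (contr_nonsingular H) => //.
    apply: contrapT => ne; apply: nv; left; rewrite /sink -subset0 => e /= ev.
    by apply: ne; exists e.
  rewrite -[ext_proj v]/(ext_proj (val w)) ext_proj_val (ck_sum_seq ckT nw).
  pose f p := ext_iso v p *c adj (ext_iso v p).
  transitivity (\sum_(b <- out w) f (pedges (val b))).
    rewrite big_seq [RHS]big_seq; apply: eq_bigr => b bo.
    have bv : psrc (val b) = v by have := congr1 val (out_src bo).
    by rewrite /f -bv ext_iso_val.
  rewrite (contr_sum H)//= big_seq [RHS]big_seq; apply: eq_bigr => e eo.
  have ev := out_src eo; rewrite /x ifF; last by apply/negP => /on_rayP; apply; exact: nie.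
  by rewrite !(anchor_path_G0 H v0).
have [v0 wv] := unanchored vna.
rewrite infl_proj_terminating// (perm_big _ (hit_set_perm (contr_sing H) v0 wv)) big_allpairs_dep.
rewrite big_seq [RHS]big_seq; apply: eq_bigr => e eo; have ev := out_src eo.
have we : terminating G0 (rng e) by exact: terminating_rng wv.
have -> : infl_iso e = \sum_(p <- hit_set (rng e)) infl_cell e p.
  by rewrite /infl_iso; case: ifP => // /on_rayP.
rewrite cadj_sum cmul_suml -[LHS](@diag_sum _ _ (hit_set (rng e)) (fun p q =>
  infl_cell e p *c adj (infl_cell e q))).
- by apply: eq_bigr => p _; rewrite cmul_sumr.
- exact: fset_uniq.
move=> p q; rewrite !(mem_hit_set (contr_sing H) _ we) => hp hq.
rewrite /infl_cell /infl_cell_row /infl_cell_elt ev (negPf vna) mx_unit_adj mx_unitM.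
have [->|pq] := eqVneq p q; first by rewrite eqxx ext_proj_adj ext_proj_idem path_end_cons.
have [r0|r0] := boolP (rng e \in G0).
  by move: hp hq pq; rewrite !hit_G0// => /eqP -> /eqP ->; rewrite eqxx.
by case: eqP => // /(idx_inj r0)[_ h]; rewrite h eqxx in pq.
Qed.

Lemma ck_inflation : ck_family infl_proj infl_iso.
Proof.
apply: ck_familyI.
- exact: infl_proj_is_proj.
- exact: infl_proj_orth.
- exact: infl_iso_adj_mul.
- exact: infl_iso_orth.
- exact: infl_proj_iso.
- exact: infl_sum.
Qed.

Local Notation infl_path := (path_elt infl_proj infl_iso).

Lemma infl_iso_terminating e : terminating G0 (rng e) ->
  infl_iso e = \sum_(p <- hit_set (rng e)) infl_cell e p.
Proof. by move=> we; rewrite /infl_iso; case: ifP => // /on_rayP. Qed.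

Lemma infl_proj_G0 v : v \in G0 -> infl_proj v = mu 0%N 0%N (ext_proj v).
Proof. by move=> v0; rewrite /infl_proj anchoredE v0 /idx v0 anchor_proj_G0. Qed.

Lemma infl_iso_mul_unit e q (b : B) j : terminating G0 (rng e) -> hit G0 (rng e) q ->
  infl_iso e *c mu (idx (rng e) q) j b = mu (infl_cell_row e q) j (infl_cell_elt e q *c b).
Proof.
move=> we hq; have qh : q \in hit_set (rng e) by rewrite (mem_hit_set (contr_sing H) _ we).
rewrite infl_iso_terminating// cmul_suml (bigD1_seq _ qh) ?fset_uniq//= mx_unitM eqxx.
rewrite big_seq_cond big1 ?addr0// => p /andP[+ pq].
rewrite (mem_hit_set (contr_sing H) _ we) => hp; rewrite mx_unitM.
have [r0|r0] := boolP (rng e \in G0).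
  by move: hp hq pq; rewrite !hit_G0// => /eqP -> /eqP ->; rewrite eqxx.
by case: eqP => // /(idx_inj r0)[_ h]; rewrite h eqxx in pq.
Qed.

Lemma infl_path_hit v p : terminating G0 v -> hit G0 v p ->
  infl_path v p = mu (idx v p) 0%N (ext_proj (path_end v p)).
Proof.
elim: p v => [|e q IH] v wv /=.
  by move=> v0; rewrite infl_proj_G0// /idx v0.
move=> /and3P[v0 /eqP ev hq]; have we : terminating G0 (rng e) by exact: terminating_rng wv.
have vna : anchored v = false.
  by apply/negbTE; rewrite anchoredE negb_or v0; apply/negP => /on_rayP.
rewrite IH// infl_iso_mul_unit// /infl_cell_row /infl_cell_elt ev vna.
by rewrite path_end_cons ext_proj_idem.
Qed.

(** While the path stays on rays, each edge is transferred to the anchor; once an edge ends at a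
    terminating vertex, the rest is a single column. *)
Lemma infl_path_anchored v e q : anchored v -> src e = v -> hit G0 (rng e) q ->
  infl_path v (e :: q) = mu (idx v [::]) 0%N (ext_iso (anchor_base v) (anchor_edges v ++ e :: q)).
Proof.
have terminating_case w e0 p : anchored w -> src e0 = w -> hit G0 (rng e0) p -> terminating G0 (rng e0) ->
    infl_path w (e0 :: p) = mu (idx w [::]) 0%N (ext_iso (anchor_base w) (anchor_edges w ++ e0 :: p)).
  move=> wa ew hp we /=; rewrite infl_path_hit// infl_iso_mul_unit// /infl_cell_row /infl_cell_elt ew wa.
  have fr := anchored_return wa ew hp; have u0 := anchored_base H wa.
  by rewrite -{2}(ext_iso_ext_proj u0 fr) path_end_cat path_end_cons.
elim: q v e => [|f q IH] v e va ev hq; have [ie|/on_rayN we] := boolP (on_ray (rng e)).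
- by move: (on_ray_notin ie); rewrite -[rng e \in G0]/(hit G0 (rng e) [::]) hq.
- exact: terminating_case.
- move: hq => /= /and3P[_ /eqP fe hq]; have ra : anchored (rng e) by exact: on_ray_anchored.
  rewrite -/(infl_path (rng e) (f :: q)) IH// /infl_iso ie ev mx_unitM eqxx anchor_proj_ext_exit//.
  by rewrite !(anchor_path_rng H ie) ev cat_rcons.
exact: terminating_case.
Qed.

Lemma infl_path_return v p : v \in G0 -> first_return G0 v p ->
  infl_path v p = mu 0%N 0%N (ext_iso v p).
Proof.
case: p => [|e q] // v0 /andP[/eqP ev hq].
have va : anchored v by rewrite anchoredE v0.
rewrite infl_path_anchored//.
by rewrite !(anchor_path_G0 H v0) /idx v0.
Qed.

End Inflation.

(** * The corner *)

Section IsometricMorphism.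
Variables (R : realType) (A B : cstarType R[i]) (f : {linear A -> B}).
Hypothesis f_iso : forall x, `|f x| = `|x|.

Lemma isometry_inj : injective f.
Proof.
by move=> x y h; apply/eqP; rewrite -subr_eq0 -normr_eq0 -f_iso raddfB /= h subrr normr0.
Qed.

(** The preimages of balls around a limit point form a Cauchy filter in the domain, which spares the
    choice of a sequence. *)
Lemma isometry_closed_range : closed (range f).
Proof.
apply/closed_epsP => y hy.
pose near_y (e : R) : set A := [set x | `|y - f x| <= e%:C].
pose F : set_system A := filter_from [set e : R | 0 < e] near_y.
have posC (e : R) : 0 < e -> 0 < e%:C by move=> e0; rewrite ltcR.
have FF : ProperFilter F.
  apply: filter_from_proper; last first.
    move=> e /= e0; have [_ [x _ <-] hx] := hy _ (posC _ e0).
    by exists x.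
  apply: filter_from_filter; first by exists 1 => /=; exact: ltr01.
  move=> e1 e2 /= h1 h2; exists (Order.min e1 e2); first by rewrite /= lt_min h1.
  move=> x; rewrite /near_y /= => hx; split; apply: le_trans hx _; rewrite lecR ge_min lexx ?orbT//.
have : cauchy F.
  apply/cauchyP => e e0; have er := pos_complexE (ltW e0).
  have e3 : 0 < complex.Re e / 3 by rewrite divr_gt0// -ltcR -er.
  have [_ [x _ <-] hx] := hy _ (posC _ e3).
  exists x; exists (complex.Re e / 3) => // z hz.
  rewrite -ball_normE /= -f_iso raddfB -(subrKA y); apply: le_lt_trans (ler_normD _ _) _.
  rewrite distrC; apply: le_lt_trans (lerD hx hz) _.
  rewrite -rmorphD er ltcR; have := e3; lra.
move/cauchy_cvg => /cvg_ex[l Fl]; exists l => //.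
have /cvgrPdist_le hl : id x @[x --> F] --> l by exact: Fl.
apply/eqP; rewrite -subr_eq0; apply/eqP; apply: (@norm_eps_eq0 _ _ _ 2) => // e e0.
have er := pos_complexE (ltW e0).
have Fe : F (near_y (complex.Re e)) by exists (complex.Re e) => //=; rewrite -ltcR -er.
have [x [h1 h2]] := filter_ex (filterI (hl _ e0) Fe).
rewrite -(subrKA (f x)); apply: le_trans (ler_normD _ _) _.
rewrite mulr_natr mulr2n lerD//; last by rewrite distrC er.
by rewrite -raddfB f_iso.
Qed.

End IsometricMorphism.

(** * Strict sums of vertex projections as multipliers *)

Section GraphAlgebra.
Variables (R : realType) (F : digraph) (C : graph_algebra R[i] F).
Local Notation K := R[i].
Local Notation P := (@ga_proj _ _ C).
Local Notation S := (@ga_iso _ _ C).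
Implicit Types (D : {pred vert F}) (a b : C).
Let ck := ga_family C.

(** Since X has to be stable under adjoints, one-sided properties are proved below for [a] and
    [adj a] together. *)
Lemma ga_ind (X : set C) : X 0 -> (forall (k : K) a b, X a -> X b -> X (k *: a + b)) ->
  (forall a b, X a -> X b -> X (a *c b)) -> (forall a, X a -> X (adj a)) ->
  (forall x, (forall e : K, 0 < e -> exists2 a, X a & `|x - a| <= e) -> X x) ->
  (forall v, X (P v)) -> (forall e, X (S e)) -> forall a, X a.
Proof.
move=> X0 Xl Xm Xa Xc XP XS a.
rewrite (_ : X = setT)//; apply: ga_generated => //; by [split|apply/closed_epsP].
Qed.

Definition verts D n : seq (vert F) := [seq v <- pmap pickle_inv (iota 0 n) | v \in D].

Lemma verts_uniq D n : uniq (verts D n).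
Proof. by rewrite filter_uniq// (pmap_uniq (@choice.pickle_invK _)) ?iota_uniq. Qed.

Lemma mem_verts D n v : (v \in verts D n) = (v \in D) && (choice.pickle v < n)%N.
Proof.
rewrite mem_filter mem_pmap; congr (_ && _); apply/mapP/idP => [[k]|vn].
  rewrite mem_iota add0n => iN vi; have := @choice.pickle_invK (vert F) k.
  by rewrite /oapp -vi => ->.
by exists (choice.pickle v); rewrite ?mem_iota// choice.pickleK_inv.
Qed.

Definition vert_sum D n : C := \sum_(v <- verts D n) P v.

Lemma vert_sum_adj D n : adj (vert_sum D n) = vert_sum D n.
Proof. by rewrite cadj_sum; apply: eq_bigr => v _; rewrite (ckP_adj ck). Qed.

Lemma vert_sumP D n w : vert_sum D n *c P w = if w \in verts D n then P w else 0.
Proof.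
rewrite cmul_suml; case: ifP => ws; last first.
  rewrite big_seq big1// => v vs; apply: (ckP_orth ck) => vw; by rewrite -vw vs in ws.
rewrite (bigD1_seq _ ws) ?verts_uniq//= (ckPP ck) big1 ?addr0// => v /eqP.
exact: (ckP_orth ck).
Qed.

Lemma vert_sumM D n m : (m <= n)%N -> vert_sum D n *c vert_sum D m = vert_sum D m.
Proof.
move=> mn; rewrite [X in _ *c X]/vert_sum cmul_sumr big_seq [RHS]big_seq.
apply: eq_bigr => v; rewrite vert_sumP !mem_verts => /andP[-> vm].
by rewrite (leq_trans vm mn).
Qed.

Lemma vert_sum_norm D n : `|vert_sum D n| <= 1.
Proof.
have := cnorm_adj_mul (vert_sum D n); rewrite vert_sum_adj vert_sumM//.
have [->|n0] := eqVneq (vert_sum D n) 0; first by rewrite normr0.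
rewrite expr2 -[X in X = _]mulr1 => /mulfI; rewrite normr_eq0 => /(_ n0) <-.
exact: lexx.
Qed.

Lemma vert_sum_le D n a : `|vert_sum D n *c a| <= `|a|.
Proof.
by apply: le_trans (cnormM _ _) _; rewrite ler_piMl// vert_sum_norm.
Qed.

Lemma vert_sum_ner D v : \forall n \near \oo, vert_sum D n *c P v = if v \in D then P v else 0.
Proof.
exists (choice.pickle v).+1 => // n /= vn.
by rewrite vert_sumP mem_verts vn andbT.
Qed.

(** The sums need not converge in norm, but on each P_v c they are eventually constant, and their
    uniform bound carries convergence over to limits of such elements. *)
Lemma vert_sum_cvg D a : cvgn (fun n => vert_sum D n *c a) /\ cvgn (fun n => a *c vert_sum D n).
Proof.
suff h b : cvgn (fun n => vert_sum D n *c b).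
  split=> //; have /cvg_ex[l hl] := h (adj a); apply/cvg_ex; exists (adj l).
  have -> : (fun n => a *c vert_sum D n) = (fun n => adj (vert_sum D n *c adj a)).
    by apply/funext => n; rewrite cadjM cadjK vert_sum_adj.
  exact: cvg_adj.
pose X c := cvgn (fun n => vert_sum D n *c c).
have XPr v : X (P v).
  apply/cvg_ex; exists (if v \in D then P v else 0).
  apply/cvgrPdist_le => e e0; apply: filterS (vert_sum_ner D v) => n ->.
  by rewrite subrr normr0 ltW.
have XM c d : X c -> X (c *c d).
  move=> /cvg_ex[l hl]; apply/cvg_ex; exists (l *c d).
  by rewrite (_ : (fun n => _) = (fun n => vert_sum D n *c c *c d));
    [exact: cvg_cmulr|apply/funext => n; rewrite cmulA].
have XPM v c : X (P v *c c) by exact: XM.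
have Xl (k : K) c d : X c -> X d -> X (k *: c + d).
  move=> /cvg_ex[l hl] /cvg_ex[m hm]; apply/cvg_ex; exists (k *: l + m).
  rewrite (_ : (fun n => _) = (fun n => k *: (vert_sum D n *c c) + vert_sum D n *c d)).
    by apply: cvgD => //; exact: cvgZr.
  by apply/funext => n; rewrite cmulDr cmulZr.
have Xc x : (forall e : K, 0 < e -> exists2 c, X c & `|x - c| <= e) -> X x.
  move=> hx; apply/cauchy_cvgP/cauchyP => e e0.
  have e4 : 0 < e / 2 / 2 by rewrite !divr_gt0.
  have [c /cvg_ex[l /cvgrPdist_le hl] xc] := hx _ e4.
  exists l; apply: filterS (hl _ e4) => n hn; rewrite -ball_normE /=.
  rewrite -(subrKA (vert_sum D n *c c)) -cmulBr; apply: le_lt_trans (ler_normD _ _) _.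
  apply: le_lt_trans (_ : e / 2 / 2 + e / 2 / 2 < _).
    rewrite lerD//; apply: le_trans (vert_sum_le _ _ _) _.
    by rewrite distrC.
  by rewrite -splitr ltr_pdivrMr// mulr_natr mulr2n ltrDl.
suff [] : X b /\ X (adj b) by [].
apply: (@ga_ind (fun b => X b /\ X (adj b))) b.
- have X0 : X 0.
    apply/cvg_ex; exists 0; rewrite (_ : (fun n => _) = cst 0); first exact: cvg_cst.
    by apply/funext => n; rewrite cmul0r.
  by rewrite cadj0.
- move=> k c d [c1 c2] [d1 d2]; split; first exact: Xl.
  by rewrite cadjD cadjZ; exact: Xl.
- move=> c d [c1 c2] [d1 d2]; split; first exact: XM.
  by rewrite cadjM; exact: XM.
- by move=> c [c1 c2]; rewrite cadjK.
- move=> x hx; split; apply: Xc => e e0; have [c [c1 c2] xc] := hx _ e0.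
    by exists c.
  by exists (adj c) => //; rewrite -cadjB cnorm_adj.
- by move=> v; rewrite (ckP_adj ck).
- move=> e; split; first by rewrite -(ckS_src ck); exact: XPM.
  by rewrite -(ckS_rng ck e) cadjM (ckP_adj ck); exact: XPM.
Qed.

Definition vert_mull D a : C := limn (fun n => vert_sum D n *c a).
Definition vert_mulr D a : C := limn (fun n => a *c vert_sum D n).

Lemma vert_mull_cvg D a : vert_sum D n *c a @[n --> \oo] --> vert_mull D a.
Proof. by case: (vert_sum_cvg D a). Qed.

Lemma vert_mulr_cvg D a : a *c vert_sum D n @[n --> \oo] --> vert_mulr D a.
Proof. by case: (vert_sum_cvg D a). Qed.

Lemma seq_cvg_unique (u : nat -> C) a b : u n @[n --> \oo] --> a ->
  u n @[n --> \oo] --> b -> a = b.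
Proof. by move=> h1 h2; apply: cvg_unique h1 h2 => //. Qed.

Lemma vert_mullE D a b : vert_sum D n *c a @[n --> \oo] --> b -> vert_mull D a = b.
Proof. by move=> h; exact: seq_cvg_unique (@vert_mull_cvg D a) h. Qed.

Lemma vert_mulrE D a b : a *c vert_sum D n @[n --> \oo] --> b -> vert_mulr D a = b.
Proof. by move=> h; exact: seq_cvg_unique (@vert_mulr_cvg D a) h. Qed.

Lemma vert_mull_linear D : linear (vert_mull D).
Proof.
move=> k a b; apply: vert_mullE.
rewrite (_ : (fun n => _) = (fun n => k *: (vert_sum D n *c a) + vert_sum D n *c b)).
  by apply: cvgD; [apply: cvgZr|]; exact: vert_mull_cvg.
by apply/funext => n; rewrite cmulDr cmulZr.
Qed.

Lemma vert_mull_le D a : `|vert_mull D a| <= `|a|.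
Proof.
apply: (cvg_norm_le (V := C) _ (@vert_mull_cvg D a)); first exact: normr_ge0.
by exists 0%N => // n _; exact: vert_sum_le.
Qed.

Lemma vert_mull_adj D a : vert_mulr D (adj a) = adj (vert_mull D a).
Proof.
apply: vert_mulrE; rewrite (_ : (fun n => _) = (fun n => adj (vert_sum D n *c a))).
  by apply: cvg_adj; exact: vert_mull_cvg.
by apply/funext => n; rewrite cadjM vert_sum_adj.
Qed.

Lemma vert_mulr_adj D a : vert_mulr D a = adj (vert_mull D (adj a)).
Proof. by rewrite -vert_mull_adj cadjK. Qed.

Lemma vert_mulr_linear D : linear (vert_mulr D).
Proof.
move=> k a b; rewrite !vert_mulr_adj cadjD cadjZ vert_mull_linear cadjD cadjZ.
by rewrite conjCK.
Qed.

Lemma vert_mullM D a b : vert_mull D (a *c b) = vert_mull D a *c b.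
Proof.
apply: vert_mullE; rewrite (_ : (fun n => _) = (fun n => vert_sum D n *c a *c b)).
  by apply: cvg_cmulr; exact: vert_mull_cvg.
by apply/funext => n; rewrite cmulA.
Qed.

Lemma vert_mulrM D a b : vert_mulr D (a *c b) = a *c vert_mulr D b.
Proof. by rewrite vert_mulr_adj cadjM vert_mullM cadjM cadjK -vert_mulr_adj. Qed.

Lemma vert_mull_idem D a : vert_mull D (vert_mull D a) = vert_mull D a.
Proof.
apply: vert_mullE; rewrite (_ : (fun n => _) = (fun n => vert_sum D n *c a)).
  exact: vert_mull_cvg.
apply/funext => n.
have h : vert_sum D n *c (vert_sum D m *c a) @[m --> \oo] --> vert_sum D n *c vert_mull D a.
  by apply: cvg_cmull; exact: vert_mull_cvg.
apply: (seq_cvg_unique h); apply/cvgrPdist_le => e e0; exists n => // m /= nm.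
rewrite cmulA (_ : vert_sum D n *c vert_sum D m = vert_sum D n).
  by rewrite subrr normr0 ltW.
by apply: cadj_inj; rewrite cadjM !vert_sum_adj vert_sumM.
Qed.

Lemma vert_mull_mulr D a b : vert_mulr D a *c b = a *c vert_mull D b.
Proof.
have h : a *c vert_sum D n *c b @[n --> \oo] --> vert_mulr D a *c b.
  by apply: cvg_cmulr; exact: vert_mulr_cvg.
apply: (seq_cvg_unique h).
rewrite (_ : (fun n => _) = (fun n => a *c (vert_sum D n *c b))).
  by apply: cvg_cmull; exact: vert_mull_cvg.
by apply/funext => n; rewrite cmulA.
Qed.

Lemma linear_contraction_continuous (f : C -> C) : linear f ->
  (forall a, `|f a| <= `|a|) -> continuous f.
Proof.
move=> fl fc x; apply: (@cvg_lipschitz _ _ _ f 1 _ (nbhs x) _ id x) => // y z.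
rewrite mul1r (_ : f y - f z = f (y - z)) ?fc//.
by have := fl (-1) z y; rewrite !scaleN1r addrC => <-; rewrite addrC.
Qed.

Definition vert_mult D : (C -> C) * (C -> C) := (vert_mull D, vert_mulr D).

Lemma vert_mult_proj D : mult_proj (vert_mult D).
Proof.
split; first split.
- by split; [exact: vert_mull_linear|exact: vert_mulr_linear].
- split; apply: linear_contraction_continuous.
  + exact: vert_mull_linear.
  + exact: vert_mull_le.
  + exact: vert_mulr_linear.
  + by move=> a; rewrite /= vert_mulr_adj cnorm_adj -(cnorm_adj a) vert_mull_le.
- exact: vert_mullM.
- exact: vert_mulrM.
- exact: vert_mull_mulr.
- rewrite /mult_adj /=; congr (_, _); apply/funext => a /=.
    by rewrite vert_mull_adj cadjK.
  by rewrite -vert_mulr_adj.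
rewrite /mult_mul /=; congr (_, _); apply/funext => a /=; first exact: vert_mull_idem.
by rewrite !vert_mulr_adj cadjK vert_mull_idem.
Qed.

Lemma vert_mull_proj D v : v \in D -> vert_mull D (P v) = P v.
Proof.
move=> vD; apply: vert_mullE; apply/cvgrPdist_le => e e0.
apply: filterS (vert_sum_ner D v) => n ->.
by rewrite vD subrr normr0 ltW.
Qed.

(** The finite vertex sums form an approximate unit, because each generator and its adjoint have a
    vertex projection as left unit. *)
Lemma vert_mull_all a : vert_mull predT a = a.
Proof.
suff [] : vert_mull predT a = a /\ vert_mull predT (adj a) = adj a by [].
apply: (@ga_ind (fun a => vert_mull predT a = a /\ vert_mull predT (adj a) = adj a)) a.
- have h : vert_mull predT (0 : C) = 0.
    by apply/eqP; rewrite -normr_le0 -(normr0 C) vert_mull_le.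
  by rewrite cadj0.
- move=> k a b [a1 a2] [b1 b2]; rewrite cadjD cadjZ !vert_mull_linear a1 a2 b1 b2//.
- by move=> a b [a1 a2] [b1 b2]; rewrite cadjM !vert_mullM a1 b2.
- by move=> a [a1 a2]; rewrite cadjK.
- move=> x hx; have sub a b : vert_mull predT (a - b) = vert_mull predT a - vert_mull predT b.
    have := vert_mull_linear predT (-1) b a.
    by rewrite !scaleN1r ![- _ + _]addrC.
  have main y : (forall e : K, 0 < e -> exists2 a, vert_mull predT a = a & `|y - a| <= e) ->
      vert_mull predT y = y.
    move=> hy; apply/eqP; rewrite -subr_eq0; apply/eqP.
    apply: (@norm_eps_eq0 _ _ _ 2) => // e e0; have [a ha ya] := hy _ e0.
    rewrite -(subrKA a) -{1}ha -sub; apply: le_trans (ler_normD _ _) _.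
    rewrite mulr_natr mulr2n lerD//; last by rewrite distrC.
    exact: le_trans (vert_mull_le _ _) _.
  split; apply: main => e e0; have [a [a1 a2] xa] := hx _ e0; first by exists a.
  by exists (adj a) => //; rewrite -cadjB cnorm_adj.
- by move=> v; rewrite (ckP_adj ck) vert_mull_proj.
move=> e; split; first by rewrite -(ckS_src ck) vert_mullM vert_mull_proj.
by rewrite -(ckS_rng ck e) cadjM (ckP_adj ck) vert_mullM vert_mull_proj.
Qed.

End GraphAlgebra.

(** * The range of [phi] as a full corner *)

Section Contraction.
Variables (R : realType) (E : digraph) (G0 : {pred vert E}).
Local Notation K := R[i].
Hypothesis H : contractible G0.
Variables (CE : graph_algebra K E) (CG : graph_algebra K (contr_graph G0)).
Local Notation P := (@ga_proj _ _ CE).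
Local Notation S := (@ga_iso _ _ CE).
Let ck := ga_family CE.
Let ckG := ga_family CG.
Local Notation sp := (path_elt P S).
Local Notation ext_proj := (ext_proj (@ga_proj _ _ CG)).
Local Notation ext_iso := (ext_iso (@ga_iso _ _ CG)).
Local Notation anchor_proj := (anchor_proj (@ga_proj _ _ CG) (@ga_iso _ _ CG)).
Local Notation hit_set := (hit_set G0).
Local Notation on_ray := (on_ray G0).
Local Notation anchored := (anchored G0).
Local Notation anchor_base := (anchor_base G0).
Local Notation anchor_edges := (anchor_edges G0).
Local Notation anchor_exits := (anchor_exits G0).
Implicit Types (u v w : vert E) (e : edge E) (p q : seq (edge E)).

Variable phi : {linear CG -> CE}.
Hypotheses (phi_star : star_morphism phi)
  (phiP : forall w : vert (contr_graph G0), phi (ga_proj CG w) = P (val w))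
  (phiS : forall b : edge (contr_graph G0), phi (ga_iso CG b) = sp (psrc (val b)) (pedges (val b))).

Lemma phiM x y : phi (x *c y) = phi x *c phi y. Proof. by case: phi_star. Qed.
Lemma phi_adj x : phi (adj x) = adj (phi x). Proof. by case: phi_star. Qed.

Lemma phi_ext_proj v : v \in G0 -> phi (ext_proj v) = P v.
Proof.
move=> v0; pose w : contr_vert G0 := exist _ v v0.
by rewrite -[v]/(val w) ext_proj_val phiP.
Qed.

Lemma phi_ext_iso v p : v \in G0 -> first_return G0 v p -> phi (ext_iso v p) = sp v p.
Proof.
by move=> v0 fp; have [b bv bp] := contr_edge_exists v0 fp; rewrite -bv -bp ext_iso_val phiS.
Qed.

(* The universal property of [CE] applied to the inflated family gives a left inverse of [phi]. *)
Lemma phi_isometric x : `|phi x| = `|x|.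
Proof.
have [psi [psi_star psiP psiS]] := @ga_universal _ _ CE _ _ _ (ck_inflation H ckG).
have [psiM psi_adj] := psi_star.
have psi_path v p : psi (sp v p) =
      path_elt (infl_proj (ga_proj CG) (ga_iso CG)) (infl_iso (ga_proj CG) (ga_iso CG)) v p.
  by elim: p v => [|e p IH] v /=; rewrite ?psiM ?IH ?psiS.
(* Both [phi] and [psi] are contractive while their composite is isometric, so [phi] cannot decrease
   the norm. *)
apply/eqP; rewrite eq_le star_morphism_contractive//=.
rewrite -(mx_unit_norm 0 x); suff -> : mx_unit 0 0 x = psi (phi x).
  exact: star_morphism_contractive.
apply: (@ga_ind _ _ CG (fun x => mx_unit 0 0 x = psi (phi x))) x.
- by rewrite mx_unit0 !linear0.
- by move=> k a b ha hb; rewrite mx_unitD mx_unitZ ha hb !linearP.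
- by move=> a b ha hb; rewrite phiM psiM -ha -hb mx_unitM eqxx.
- by move=> a ha; rewrite phi_adj psi_adj -ha mx_unit_adj.
- move=> x hx; apply/eqP; rewrite -subr_eq0; apply/eqP.
  apply: (@norm_eps_eq0 _ _ _ 2) => // e e0; have [a ha xa] := hx _ e0.
  rewrite -(subrKA (psi (phi a))) -{1}ha -mx_unitB -!raddfB.
  apply: le_trans (ler_normD _ _) _; rewrite mulr_natr mulr2n lerD//.
    exact: le_trans (mx_unit_norm_le _ _ _) _.
  do 2![apply: le_trans (star_morphism_contractive _ _) _ => //].
  by rewrite distrC.
- by move=> w; rewrite phiP psiP (infl_proj_G0 H)// ?ext_proj_val//; exact: (valP w).
- move=> b; rewrite phiS psi_path; have [b0 fb _] := contr_return b.
  by rewrite (infl_path_return H ckG)// ext_iso_val.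
Qed.

Lemma phi_closed : closed (range phi).
Proof. exact: isometry_closed_range phi_isometric. Qed.

Lemma range_phi0 : range phi 0. Proof. by exists 0 => //; rewrite linear0. Qed.

Lemma range_phiD (k : K) x y : range phi x -> range phi y -> range phi (k *: x + y).
Proof. by move=> [a _ <-] [b _ <-]; exists (k *: a + b) => //; rewrite linearP. Qed.

Lemma range_phiM x y : range phi x -> range phi y -> range phi (x *c y).
Proof. by move=> [a _ <-] [b _ <-]; exists (a *c b) => //; rewrite phiM. Qed.

Lemma range_phi_adj x : range phi x -> range phi (adj x).
Proof. by move=> [a _ <-]; exists (adj a) => //; rewrite phi_adj. Qed.

Lemma range_phi_sum (I : eqType) (r : seq I) (f : I -> CE) :
  {in r, forall i, range phi (f i)} -> range phi (\sum_(i <- r) f i).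
Proof.
elim: r => [|i r IH] h; first by rewrite big_nil; exact: range_phi0.
rewrite big_cons -[f i]scale1r; apply: range_phiD; first by apply: h; rewrite inE eqxx.
by apply: IH => j jr; apply: h; rewrite inE jr orbT.
Qed.

Lemma range_phi_cvg (u : nat -> CE) x : (forall n, range phi (u n)) ->
  u n @[n --> \oo] --> x -> range phi x.
Proof.
move=> hu /cvgrPdist_le ux; move/closed_epsP: phi_closed; apply => e e0.
by have [N _ /(_ N (leqnn N)) hN] := ux _ e0; exists (u N).
Qed.

(** Induction along the anchor: by (d) the last source is nonsingular, so g g^* splits over its
    outgoing edges. Every edge off the anchor ends at a terminating vertex and expands into returns,
    which are the terms subtracted in [anchor_proj]. *)
Lemma anchor_range v : anchored v ->
  sp (anchor_base v) (anchor_edges v) *c adj (sp (anchor_base v) (anchor_edges v)) = phi (anchor_proj v).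
Proof.
have phi_anchor_proj w : anchored w ->
    phi (anchor_proj w) = P (anchor_base w)
      - \sum_(b <- anchor_exits w) sp (anchor_base w) b *c adj (sp (anchor_base w) b).
  move=> wa; have u0 := anchored_base H wa; rewrite /anchor_proj /range_sum linearB linear_sum phi_ext_proj//.
  congr (_ - _); rewrite big_seq [RHS]big_seq; apply: eq_bigr => b bw.
  by rewrite phiM phi_adj phi_ext_iso//; exact: (anchor_exits_return H wa).
have [n sz] := ubnP (size (anchor_edges v)); elim: n v sz => // n IH v sz va.
have [v0|v0] := boolP (v \in G0).
  rewrite anchor_proj_G0// !(anchor_path_G0 H v0) /= phi_ext_proj// (ckP_adj ck); exact: (ckPP ck).
have iv : on_ray v by move: va; rewrite anchoredE (negPf v0).
have [e ev] : exists e, rng e = v.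
  move: (anchored_end H va) (anchored_base H va); case/lastP: (anchor_edges v) => [|g e].
    by rewrite /path_end /= => ->; rewrite (negPf v0).
  by rewrite path_end_rcons => ? _; exists e.
rewrite -ev in iv sz va *; have sa := anchored_src iv.
have fin := on_ray_finite H iv.
have nsing : ~ singularity (src e).
  by case=> // sk; have : set0 e by rewrite -sk.
have hp := anchored_path H va.
rewrite anchor_proj_rng// linearB -IH//; last by move: sz; rewrite !(anchor_path_rng H iv) size_rcons ltnS.
rewrite !(anchor_path_rng H iv) in hp *.
set g := anchor_edges (src e); set u := anchor_base (src e); rewrite -/u -/g in hp.
have ge : path_end u g = src e by exact: (anchored_end H sa).
have gp : is_path u g by exact: (anchored_path H sa).
rewrite (path_elt_rcons ck hp).
pose X f := (sp u g *c S f) *c adj (sp u g *c S f).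
have hX : sp u g *c adj (sp u g) = \sum_(f <- out (src e)) X f.
  rewrite -[sp u g in X in X *c _](path_elt_end ck u g) ge (ck_sum_seq ck nsing).
  rewrite cmul_sumr cmul_suml; apply: eq_bigr => f _.
  by rewrite /X cadjM !cmulA.
have Xf f : f \in out (src e) -> f != e -> X f =
    \sum_(p <- hit_set (rng f)) sp u (g ++ f :: p) *c adj (sp u (g ++ f :: p)).
  move=> fo fe; have wfr := terminating_sibling H iv fo fe.
  rewrite /X -[S f in X in X *c _](ckS_rng ck) {1}(terminating_sum H ck wfr).
  rewrite !cmul_sumr cmul_suml big_seq [RHS]big_seq; apply: eq_bigr => p.
  rewrite (mem_hit_set (contr_sing H) _ wfr) => hf.
  have fp : is_path (path_end u g) (f :: p) by rewrite /= ge (out_src fo) eqxx (hit_path hf).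
  by rewrite (path_elt_cat ck fp) /= !cadjM !cmulA.
have eo : e \in out (src e) by rewrite (mem_out _ fin).
rewrite hX (bigD1_seq _ eo) ?fset_uniq//= -[LHS]/(X e); apply/eqP; rewrite eq_sym subr_eq.
apply/eqP; congr (_ + _).
rewrite /range_sum big_allpairs_dep big_filter linear_sum big_seq_cond [RHS]big_seq_cond.
apply: eq_bigr => f /andP[fo fe]; rewrite Xf// linear_sum big_seq [RHS]big_seq.
have wfr := terminating_sibling H iv fo fe; apply: eq_bigr => p.
rewrite (mem_hit_set (contr_sing H) _ wfr) => hf; rewrite phiM phi_adj phi_ext_iso//.
  exact: (anchored_base H sa).
by apply: (anchored_return H sa) => //; exact: out_src.
Qed.

(* The corner is described in the coordinates [k_v], with [P v = sum k_v k_v^*] and every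
   [k_v] ending at a vertex of [G0]. *)
Definition coord v (c : CE) : Prop :=
  if anchored v then c = adj (sp (anchor_base v) (anchor_edges v))
  else exists2 p, hit G0 v p & c = sp v p.

Lemma coord_sum v : exists2 s : seq CE, {in s, forall c, coord v c} &
  P v = \sum_(c <- s) c *c adj c.
Proof.
have [va|vna] := boolP (anchored v); last have [v0 wv] := unanchored vna.
  rewrite /coord va; exists [:: adj (sp (anchor_base v) (anchor_edges v))].
    by move=> c; rewrite inE => /eqP.
  rewrite big_seq1 cadjK (path_elt_adj_mul ck) ?(anchored_end H va)//.
  exact: (anchored_path H va).
rewrite /coord (negPf vna); exists [seq sp v p | p <- hit_set v]; last first.
  by rewrite big_map (terminating_sum H ck wv).
by move=> _ /mapP[p + ->]; rewrite (mem_hit_set (contr_sing H) _ wv) => hp; exists p.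
Qed.

Lemma coord_src v c : coord v c -> P v *c c = c.
Proof.
rewrite /coord; case: ifP => [va ->|_ [p hp ->]]; last by rewrite (path_elt_src ck) ?(hit_path hp).
by rewrite -{2}(path_elt_end ck (anchor_base v) (anchor_edges v)) (anchored_end H va) cadjM (ckP_adj ck).
Qed.

Lemma coord_G0 v : v \in G0 -> coord v (P v).
Proof.
by move=> v0; rewrite /coord anchoredE v0 /= !(anchor_path_G0 H v0) /= (ckP_adj ck).
Qed.

Lemma range_phi_ext_proj v : v \in G0 -> range phi (P v).
Proof. by move=> v0; exists (ext_proj v) => //; rewrite phi_ext_proj. Qed.

Lemma coord_proj v c c' : coord v c -> coord v c' -> range phi (adj c *c c').
Proof.
rewrite /coord; case: ifP => [va -> ->|_ [p hp ->] [q hq ->]].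
  by rewrite cadjK (anchor_range va); exists (anchor_proj v).
have [<-|/eqP pq] := eqVneq p q; last by rewrite (path_elt_hit_orth ck hp hq pq); exact: range_phi0.
rewrite (path_elt_adj_mul ck) ?(hit_path hp)//; apply: range_phi_ext_proj.
exact: hit_end hp.
Qed.

Lemma coord_terminating v c : terminating G0 v -> coord v c -> exists2 p, hit G0 v p & c = sp v p.
Proof.
rewrite /coord => wv; case: ifP => // /orP[v0|/on_rayP//].
by rewrite !(anchor_path_G0 H v0) /= (ckP_adj ck) => ->; exists [::].
Qed.

(** With g the anchor of [src e], the product is the range projection of g S_e if e leads to a ray,
    and the element of a return if only [src e] is anchored. Otherwise S_e c' is itself a coordinate
    of [src e]. *)
Lemma coord_iso e c c' : coord (src e) c -> coord (rng e) c' ->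
  range phi (adj c *c S e *c c').
Proof.
have [ie|/on_rayN we] := boolP (on_ray (rng e)).
  have sa := anchored_src ie; have ra : anchored (rng e) by exact: on_ray_anchored.
  rewrite /coord sa ra => -> ->; have := anchored_path H ra; have := anchor_range ra.
  rewrite !(anchor_path_rng H ie) => h hp; rewrite cadjK -(path_elt_rcons ck hp) h.
  by exists (anchor_proj (rng e)).
move=> + /(coord_terminating we)[p hp ->]; have [sa|sna] := boolP (anchored (src e)).
  rewrite /coord sa => ->; rewrite cadjK -cmulA.
  have fr := anchored_return H sa erefl hp.
  have -> : S e *c sp (rng e) p = sp (src e) (e :: p) by [].
  have ep : is_path (path_end (anchor_base (src e)) (anchor_edges (src e))) (e :: p).
    by rewrite (anchored_end H sa) /= eqxx (hit_path hp).
  have := path_elt_cat ck ep; rewrite (anchored_end H sa) => <-.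
  exists (ext_iso (anchor_base (src e)) (anchor_edges (src e) ++ e :: p)) => //.
  by rewrite phi_ext_iso// (anchored_base H sa).
have [s0 _] := unanchored sna.
have hep : hit G0 (src e) (e :: p) by rewrite /= s0 eqxx.
move=> hc; rewrite -cmulA; apply: (coord_proj hc).
by rewrite /coord (negPf sna); exists (e :: p).
Qed.

(** Products are the difficult closure property: between the factors one inserts the vertex sums,
    each P_z written as a sum of d d^* over coordinates d. The sum over all vertices is only a
    limit, which closedness of the range allows. *)
Lemma coord_range a v w c c' : coord v c -> coord w c' -> range phi (adj c *c a *c c').
Proof.
pose X a := forall v w c c', coord v c -> coord w c' -> range phi (adj c *c a *c c').
suff : X a by apply.
have orth x y b : x <> y -> coord x b -> adj b *c P y = 0.
  move=> xy /coord_src <-; rewrite cadjM (ckP_adj ck) -cmulA (ckP_orth ck xy).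
  by rewrite cmul0r.
move: a; apply: (@ga_ind _ _ CE X).
- by move=> x y b b' _ _; rewrite cmul0r cmul0l; exact: range_phi0.
- move=> k a1 a2 h1 h2 x y b b' hb hb'.
  rewrite cmulDr cmulZr cmulDl cmulZl; apply: range_phiD.
    exact: h1 hb hb'.
  exact: h2 hb hb'.
- move=> a1 a2 h1 h2 x y b b' hb hb'.
  have h : adj b *c a1 *c (vert_sum CE predT n *c a2) *c b' @[n --> \oo] -->
      adj b *c a1 *c a2 *c b'.
    apply: cvg_cmulr; apply: cvg_cmull; rewrite -[X in _ --> X](vert_mull_all a2).
    exact: vert_mull_cvg.
  rewrite (cmulA (adj b)); apply: range_phi_cvg h => n.
  rewrite /vert_sum cmul_suml cmul_sumr cmul_suml; apply: range_phi_sum => z _.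
  have [s hs ->] := coord_sum z; rewrite cmul_suml cmul_sumr cmul_suml.
  apply: range_phi_sum => d ds.
  rewrite (_ : _ *c _ = (adj b *c a1 *c d) *c (adj d *c a2 *c b')); last by rewrite !cmulA.
  by apply: range_phiM; [exact: h1 hb (hs _ ds)|exact: h2 (hs _ ds) hb'].
- move=> a0 h x y b b' hb hb'.
  rewrite (_ : _ *c _ = adj (adj b' *c a0 *c b)); last by rewrite !cadjM cadjK !cmulA.
  by apply: range_phi_adj; exact: h hb' hb.
- move=> z hz x y b b' hb hb'; move/closed_epsP: phi_closed; apply => e e0.
  have M0 : 0 < `|b| * `|b'| + 1 by rewrite ltr_wpDl// mulr_ge0.
  have e'0 : 0 < e / (`|b| * `|b'| + 1) by rewrite divr_gt0.
  have [a0 ha0 za0] := hz _ e'0; exists (adj b *c a0 *c b'); first exact: ha0 hb hb'.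
  rewrite -cmulBl -cmulBr; apply: le_trans (cnormM _ _) _.
  apply: le_trans (ler_wpM2r _ (cnormM _ _)) _ => //; rewrite cnorm_adj mulrAC.
  apply: le_trans (_ : (`|b| * `|b'| + 1) * (e / (`|b| * `|b'| + 1)) <= _).
    by rewrite ler_pM ?mulr_ge0// lerDl.
  by rewrite mulrC divfK// gt_eqF.
- move=> z x y b b' hb hb'; have [xz|/eqP xz] := eqVneq x z; last first.
    by rewrite (orth _ _ _ xz hb) cmul0l; exact: range_phi0.
  have [yz|/eqP yz] := eqVneq y z; last first.
    rewrite -cmulA -[P z *c b']cadjK cadjM (ckP_adj ck) (orth _ _ _ yz hb') cadj0 cmul0r.
    exact: range_phi0.
  by rewrite -cmulA -yz (coord_src hb'); apply: coord_proj hb'; rewrite yz -xz.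
move=> e x y b b' hb hb'; have [xe|/eqP xe] := eqVneq x (src e); last first.
  rewrite -(ckS_src ck e) (cmulA (adj b)) (orth _ _ _ xe hb) !cmul0l; exact: range_phi0.
have [ye|/eqP ye] := eqVneq y (rng e); last first.
  rewrite -(ckS_rng ck e) -!cmulA -[P (rng e) *c b']cadjK cadjM (ckP_adj ck).
  by rewrite (orth _ _ _ ye hb') cadj0 !cmul0r; exact: range_phi0.
by subst x y; exact: coord_iso.
Qed.

Lemma range_phi_fixed x : vert_mull G0 (phi x) = phi x.
Proof.
pose X x := vert_mull G0 (phi x) = phi x.
suff [] : X x /\ X (adj x) by [].
have main y : (forall e : K, 0 < e -> exists2 a, X a & `|y - a| <= e) -> X y.
  move=> hy; apply/eqP; rewrite -subr_eq0; apply/eqP.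
  apply: (@norm_eps_eq0 _ _ _ 2) => // e e0; have [a ha ya] := hy _ e0.
  rewrite -(subrKA (phi a)) -{1}ha.
  have -> : vert_mull G0 (phi y) - vert_mull G0 (phi a) = vert_mull G0 (phi (y - a)).
    have := vert_mull_linear G0 (-1) (phi a) (phi y).
    by rewrite !scaleN1r ![- _ + _]addrC raddfB.
  apply: le_trans (ler_normD _ _) _; rewrite mulr_natr mulr2n lerD//.
    by apply: le_trans (vert_mull_le _ _) _; rewrite phi_isometric.
  by rewrite -raddfB phi_isometric distrC.
apply: (@ga_ind _ _ CG (fun x => X x /\ X (adj x))).
- have h : X 0 by rewrite /X linear0; apply/eqP; rewrite -normr_le0 -(normr0 CE) vert_mull_le.
  by rewrite cadj0.
- move=> k a b [a1 a2] [b1 b2]; rewrite /X cadjD cadjZ !linearP !vert_mull_linear.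
  by rewrite a1 a2 b1 b2.
- by move=> a b [a1 a2] [b1 b2]; rewrite /X cadjM !phiM !vert_mullM a1 b2.
- by move=> a [a1 a2]; rewrite cadjK.
- move=> y hy; split; apply: main => e e0; have [a [a1 a2] ya] := hy _ e0; first by exists a.
  by exists (adj a) => //; rewrite -cadjB cnorm_adj.
- move=> w; rewrite (ckP_adj ckG) /X phiP vert_mull_proj//; exact: (valP w).
move=> b; have XM c d : X c -> X (c *c d) by rewrite /X phiM vert_mullM => ->.
have Xq (w : vert (contr_graph G0)) : X (ga_proj CG w) by rewrite /X phiP vert_mull_proj//; exact: (valP w).
split; first by rewrite -(ckS_src ckG); exact: XM.
by rewrite -(ckS_rng ckG b) cadjM (ckP_adj ckG); exact: XM.
Qed.

Lemma range_phi_corner : range phi = corner (vert_mult CE G0).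
Proof.
apply/seteqP; split=> [_ [x _ <-]|_ [a _ <-]] /=.
  exists (phi x) => //=; rewrite range_phi_fixed vert_mulr_adj -phi_adj.
  by rewrite range_phi_fixed phi_adj cadjK.
suff : range phi (vert_mulr G0 (vert_mull G0 a)) by [].
have h1 := @vert_mulr_cvg _ _ CE G0 (vert_mull G0 a); apply: range_phi_cvg h1 => n.
have h : vert_sum CE G0 m *c a *c vert_sum CE G0 n @[m --> \oo] -->
    vert_mull G0 a *c vert_sum CE G0 n.
  by apply: cvg_cmulr; exact: vert_mull_cvg.
apply: range_phi_cvg h => m; rewrite /vert_sum !cmul_suml; apply: range_phi_sum => v.
rewrite mem_verts => /andP[v0 _]; rewrite cmul_sumr; apply: range_phi_sum => w.
rewrite mem_verts => /andP[w0 _]; rewrite -(ckP_adj ck v).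
by apply: coord_range; exact: coord_G0.
Qed.

Lemma corner_full (J : set CE) : closed_ideal J -> corner (vert_mult CE G0) `<=` J -> J = setT.
Proof.
rewrite -range_phi_corner => -[/closed_epsP Jc [J0 Jl] Jmr Jml] CJ.
have JP0 u : u \in G0 -> J (P u) by move=> u0; apply: CJ; exact: range_phi_ext_proj.
have Jsum (I : eqType) (r : seq I) (f : I -> CE) : {in r, forall i, J (f i)} ->
    J (\sum_(i <- r) f i).
  elim: r => [|i r IH] h; first by rewrite big_nil.
  rewrite big_cons -[f i]scale1r; apply: Jl; first by apply: h; rewrite inE eqxx.
  by apply: IH => j jr; apply: h; rewrite inE jr orbT.
(* A ray projection is g^* g = g^* P_u g with u in G0, and a terminating one is a sum of terms s P_w
   s^* with w in G0. *)
have JP v : J (P v).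
  have [iv|/on_rayN wv] := boolP (on_ray v).
    have va : anchored v by exact: on_ray_anchored.
    have hp := anchored_path H va.
    rewrite -(anchored_end H va) -(path_elt_adj_mul ck hp); apply: Jmr.
    by rewrite -(path_elt_src ck hp); apply: Jml; apply: JP0; exact: (anchored_base H va).
  rewrite (terminating_sum H ck wv); apply: Jsum => p; rewrite (mem_hit_set (contr_sing H) _ wv) => hp.
  rewrite -{1}(path_elt_end ck); apply: Jml; apply: Jmr; apply: JP0; exact: hit_end hp.
apply/seteqP; split=> // a _.
suff [] : J a /\ J (adj a) by [].
apply: (@ga_ind _ _ CE (fun a => J a /\ J (adj a))) a.
- by rewrite cadj0.
- by move=> k a b [a1 a2] [b1 b2]; rewrite cadjD cadjZ; split; exact: Jl.
- by move=> a b [a1 a2] [b1 b2]; rewrite cadjM; split; exact: Jml.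
- by move=> a [a1 a2]; rewrite cadjK.
- move=> x hx; split; apply: Jc => e e0; have [a [a1 a2] xa] := hx _ e0; first by exists a.
  by exists (adj a) => //; rewrite -cadjB cnorm_adj.
- by move=> v; rewrite (ckP_adj ck).
move=> e; split; first by rewrite -(ckS_src ck); exact: Jml.
by rewrite -(ckS_rng ck e) cadjM (ckP_adj ck); exact: Jml.
Qed.

End Contraction.

Local Close Scope ring_scope.

Theorem theorem3p1 (R : realType) (E : digraph) (G0 : {pred vert E})
  (CE : graph_algebra R[i] E) (CG : graph_algebra R[i] (contr_graph G0))
  (no_tails : ~ exists mu : nat -> edge E, is_tail mu)
  (sing_G0 : forall v : vert E, singularity v -> v \in G0)
  (acyclic_T : acyclic_graph (comp_graph G0))
  (cond_a : forall v : vert E, v \in G0 ->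
     forall rho rho' : nat -> edge E,
       infinite_path rho -> src (rho 0) = v ->
       (forall i, rng (rho i) \notin G0) ->
       infinite_path rho' -> src (rho' 0) = v ->
       (forall i, rng (rho' i) \notin G0) ->
       rho = rho')
  (cond_b : forall mu : nat -> edge (comp_graph G0), infinite_path mu ->
     set_reaches G0 (val (src (mu 0))))
  (cond_c : forall mu : nat -> edge (comp_graph G0), infinite_path mu ->
     forall i, exists e : edge E, @rng E @^-1` [set val (src (mu i))] = [set e])
  (cond_d : forall mu : nat -> edge (comp_graph G0), infinite_path mu ->
     forall e : edge E, rng e = val (src (mu 0)) ->
       finite_set (@src E @^-1` [set src e])) :
  iso_to_full_corner CG CE.
Proof.
have H : contractible G0 by [].
have [phi [phi_star phiP phiS]] := @ga_universal _ _ CG _ _ _ (ck_contr H (ga_family CE)).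
have iso := phi_isometric H phi_star phiP phiS.
exists (range phi).
  exists (vert_mult CE G0); first exact: vert_mult_proj.
  rewrite (range_phi_corner H phi_star phiP phiS); split=> // J.
  exact: (corner_full H phi_star phiP phiS).
by exists phi; split=> //; exact: isometry_inj iso.
Qed.
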